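(* Assume that $N>1$. Let $r(v)$ be a nondegenerate unitary solution of the AYBE for $A=\mathrm{Mat}(N,\mathbb{C})$ not depending on the variable $u$. Then $$r(v)=\overline{r}(v)+b\otimes 1-1\otimes b+\frac{c\cdot 1\otimes 1}{Nv},$$ where $\overline{r}(v)$ is equivalent to a rational nondegenerate solution of the CYBE for $\mathfrak{sl}_N$, $b\in\mathfrak{sl}_N$ is an infinitesimal symmetry of $\overline{r}(v)$, and $c\in\mathbb{C}^*$. Also, $$R(u,v)=\left(1+\frac{cu}{v}\right)^{-1}\cdot\left(1+u\,r(v)\right)$$ is, for fixed $u$, a unitary solution of the QYBE with spectral parameter (hence, the same is true for $\frac{v}{c}r(v)=\lim_{u\to\infty}R(u,v)$).
   Context: For $r\in A\otimes A$: $r^{12}=r\otimes 1\in A\otimes A\otimes A$, $r^{13}$ and $r^{23}$ are defined similarly, and $r^{21}\in A\otimes A$ is obtained from $r$ by exchanging the factors. A nondegenerate unitary solution of the AYBE not depending on $u$ is an $A\otimes A$-valued meromorphic function $r(v)$ in a neighborhood of $0$ such that $$r^{12}(v)r^{13}(v+v')-r^{23}(v')r^{12}(v)+r^{13}(v+v')r^{23}(v')=0,\qquad r^{21}(-v)=-r(v),$$ and $r(v)$ is a nondegenerate tensor for generic $v$. The CYBE for $\mathfrak{sl}_N$ is the equation $[r^{12}(v),r^{13}(v+v')]-[r^{23}(v'),r^{12}(v)]+[r^{13}(v+v'),r^{23}(v')]=0$ for functions with values in $\mathfrak{sl}_N\otimes\mathfrak{sl}_N$; a solution is nondegenerate if it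 is a nondegenerate tensor in $\mathfrak{sl}_N\otimes\mathfrak{sl}_N$ for generic $v$, and rational if it is a rational function of $v$. Two solutions $\rho,\tilde\rho$ of the CYBE are equivalent (in the sense of Belavin-Drinfeld) if $\tilde\rho(v_1-v_2)=(\varphi(v_1)\otimes\varphi(v_2))\rho(v_1-v_2)$ for a holomorphic function $\varphi$ with values in $\mathrm{Aut}(\mathfrak{sl}_N)$. An infinitesimal symmetry of an $A\otimes A$-valued function $f(x)$ is an element $a\in A$ with $[a\otimes 1+1\otimes a,f(x)]=0$ for all $x$. The QYBE with spectral parameter (for fixed $u$) is $R^{12}(u,v)R^{13}(u,v+v')R^{23}(u,v')=R^{23}(u,v')R^{13}(u,v+v')R^{12}(u,v)$; unitarity of $R$ means $R(u,v)R^{21}(u,-v)=1\otimes 1$. In the formula for $R$, $1$ in the second factor denotes $1\otimes 1$. *)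

(* Defs.v *)
From HB Require Import structures.
From mathcomp Require Import all_boot all_order all_algebra.
From mathcomp Require Import complex mxtens.
From mathcomp Require Import all_classical all_reals all_analysis.

Set Implicit Arguments.
Unset Strict Implicit.
Unset Printing Implicit Defensive.

Import Order.TTheory GRing.Theory Num.Theory.
Import numFieldNormedType.Exports.

Local Open Scope classical_set_scope.
Local Open Scope ring_scope.

(* R[i] seen through its numFieldType structure, so that it inherits the
   metric topology given by the modulus, and [derivable f z 1] is
   differentiability in the complex sense. *)
Definition Cplx (R : realType) : numFieldType := (R[i])%C.

Section Tensors.
Variables (R : realType) (N : nat).
Local Notation C := (Cplx R).
Local Notation A := ('M[C]_N).

(* A (x) A and A (x) A (x) A are realized by Kronecker products (tensmx, *t). *)
Definition tens2 := 'M[C]_(N * N).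
Definition tens3 := 'M[C]_(N * N * N).

(* The linear map A (x) A -> V that sends a (x) b to F a b, for F bilinear. *)
Definition tens_lift (V : lmodType C) (F : A -> A -> V) (t : tens2) : V :=
  \sum_i \sum_j \sum_k \sum_l
    t (mxtens_index (i, k)) (mxtens_index (j, l)) *:
      F (delta_mx i j) (delta_mx k l).

Lemma tens_lift_tensmx (V : lmodType C) (F : A -> A -> V) (a b : A) :
  (forall x, linear (F x)) -> (forall y, linear (F^~ y)) ->
  tens_lift F (a *t b) = F a b.
Proof.
move=> linr linl.
pose Fr x := GRing.isLinear.Build C A V *:%R (F x) (linr x).
pose Fl y := GRing.isLinear.Build C A V *:%R (F^~ y) (linl y).
pose FR x : {linear A -> V} := HB.pack (F x) (Fr x).
pose FL y : {linear A -> V} := HB.pack (F^~ y) (Fl y).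
rewrite [in RHS](matrix_sum_delta a) -[RHS]/(FL b _) linear_sum.
apply: eq_bigr => i _; rewrite linear_sum; apply: eq_bigr => j _.
rewrite linearZ /= [in RHS](matrix_sum_delta b) -[F _ (\sum_k _)]/(FR _ _).
rewrite linear_sum scaler_sumr; apply: eq_bigr => k _.
rewrite linear_sum scaler_sumr; apply: eq_bigr => l _.
by rewrite linearZ /= scalerA tensmxE.
Qed.

Definition tens_one : tens2 := 1%:M.
Definition leg12 : tens2 -> tens3 :=
  tens_lift (fun a b => a *t b *t (1%:M : A)).
Definition leg13 : tens2 -> tens3 :=
  tens_lift (fun a b => a *t (1%:M : A) *t b).
Definition leg23 : tens2 -> tens3 :=
  tens_lift (fun a b => (1%:M : A) *t a *t b).
Definition flip : tens2 -> tens2 := tens_lift (fun a b => b *t a).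
Definition tens_map (f g : A -> A) : tens2 -> tens2 :=
  tens_lift (fun a b => f a *t g b).
Definition contract (f : A -> C) : tens2 -> A :=
  tens_lift (fun a b => f a *: b).

Definition mxcomm n (x y : 'M[C]_n) : 'M[C]_n := x *m y - y *m x.

Definition sl : set A := [set a | \tr a = 0].

Definition in_tens (V : set A) (t : tens2) : Prop :=
  exists n (a b : 'I_n -> A),
    (forall i, V (a i) /\ V (b i)) /\ t = \sum_i a i *t b i.

(* For a linear subspace V of A, t in V (x) V is nondegenerate when
   f |-> (f (x) id) t is an isomorphism from V^* to V. Every functional on V
   extends to A, and the value does not depend on the extension. *)
Definition nondegenerate (V : set A) (t : tens2) : Prop :=
  [/\ in_tens V t,
      forall f : {linear A -> C^o},
        contract f t = 0 -> forall x, V x -> f x = 0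
    & forall y, V y -> exists f : {linear A -> C^o}, contract f t = y].

(* f represents an automorphism of the Lie algebra sl_N; its values outside
   sl_N are irrelevant. *)
Definition sl_automorphism (f : {linear A -> A}) : Prop :=
  set_bij sl sl f /\
  forall x y, sl x -> sl y -> f (mxcomm x y) = mxcomm (f x) (f y).

End Tensors.

Section Functions.
Variables (R : realType).
Local Notation C := (Cplx R).

Definition holomorphic_at m n (f : C -> 'M[C]_(m, n)) (z : C) : Prop :=
  forall i j, \forall w \near z, derivable (fun x => f x i j : C^o) w 1.

(* Meromorphic functions are represented by total functions whose values at
   the points where they are not holomorphic are arbitrary. Accordingly, all
   identities between meromorphic functions below are required at the points
   where every function involved is holomorphic. *)
Definition meromorphic_on m n (U : set C) (f : C -> 'M[C]_(m, n)) : Prop :=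
  forall z, U z -> exists (k : nat) (g : C -> 'M[C]_(m, n)),
    holomorphic_at g z /\
    \forall w \near z^', (w - z) ^+ k *: f w = g w.

Definition regular_pt m n (U : set C) (f : C -> 'M[C]_(m, n)) : set C :=
  [set z | U z /\ holomorphic_at f z].

(* P holds on U outside a subset without accumulation points in U. *)
Definition for_generic (U : set C) (P : C -> Prop) : Prop :=
  forall z, U z -> \forall w \near z^', P w.

Definition rational_function m n (f : C -> 'M[C]_(m, n)) : Prop :=
  exists (p : 'M[{poly C}]_(m, n)) (q : {poly C}), q != 0 /\
    forall v, q.[v] != 0 -> f v = q.[v]^-1 *: map_mx (horner^~ v) p.

(* The filter of neighborhoods of infinity in the complex plane. *)
Definition cinfty : set_system C :=
  filter_from [set M : C | 0 < M] (fun M => [set u | M < `|u|]).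

End Functions.

Section YangBaxter.
Variables (R : realType) (N : nat).
Local Notation C := (Cplx R).
Local Notation A := ('M[C]_N).
Local Notation AA := (tens2 R N).

Definition unitary_AYBE_solution (U : set C) (r : C -> AA) : Prop :=
  [/\ meromorphic_on U r,
      forall v v', regular_pt U r v -> regular_pt U r v' ->
        regular_pt U r (v + v') ->
        leg12 (r v) *m leg13 (r (v + v')) - leg23 (r v') *m leg12 (r v)
          + leg13 (r (v + v')) *m leg23 (r v') = 0
    & forall v, regular_pt U r v -> regular_pt U r (- v) ->
        flip (r (- v)) = - r v].

Definition nondegenerate_unitary_AYBE_solution (U : set C) (r : C -> AA)
    : Prop :=
  unitary_AYBE_solution U r /\
  for_generic U (fun v => nondegenerate [set: A] (r v)).

Definition CYBE_solution (U : set C) (r : C -> AA) : Prop :=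
  [/\ meromorphic_on U r,
      forall v, regular_pt U r v -> in_tens (@sl R N) (r v)
    & forall v v', regular_pt U r v -> regular_pt U r v' ->
        regular_pt U r (v + v') ->
        mxcomm (leg12 (r v)) (leg13 (r (v + v')))
          - mxcomm (leg23 (r v')) (leg12 (r v))
          + mxcomm (leg13 (r (v + v'))) (leg23 (r v')) = 0].

Definition rational_nondegenerate_CYBE_solution (rho : C -> AA) : Prop :=
  [/\ CYBE_solution setT rho, rational_function rho
    & for_generic setT (fun v => nondegenerate (@sl R N) (rho v))].

(* Belavin-Drinfeld equivalence of a solution rho', meromorphic on U, and a
   solution rho, meromorphic on the whole plane. *)
Definition CYBE_equivalent (U : set C) (rho' rho : C -> AA) : Prop :=
  [/\ CYBE_solution U rho', CYBE_solution setT rho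
    & exists phi : C -> {linear A -> A},
      [/\ forall v, sl_automorphism (phi v),
          forall a, sl a -> forall v, holomorphic_at (fun w => phi w a) v
        & forall v1 v2, regular_pt U rho' (v1 - v2) ->
            regular_pt setT rho (v1 - v2) ->
            rho' (v1 - v2) = tens_map (phi v1) (phi v2) (rho (v1 - v2))]].

Definition infinitesimal_symmetry (U : set C) (f : C -> AA) (a : A) : Prop :=
  forall v, regular_pt U f v ->
    mxcomm (a *t (1%:M : A) + (1%:M : A) *t a) (f v) = 0.

Definition unitary_QYBE_solution (U : set C) (Q : C -> AA) : Prop :=
  [/\ meromorphic_on U Q,
      forall v v', regular_pt U Q v -> regular_pt U Q v' ->
        regular_pt U Q (v + v') ->
        leg12 (Q v) *m leg13 (Q (v + v')) *m leg23 (Q v') =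
        leg23 (Q v') *m leg13 (Q (v + v')) *m leg12 (Q v)
    & forall v, regular_pt U Q v -> regular_pt U Q (- v) ->
        Q v *m flip (Q (- v)) = tens_one R N].

Definition AYBE_to_QYBE (r : C -> AA) (c u v : C) : AA :=
  (1 + c * u / v)^-1 *: (tens_one R N + u *: r v).

End YangBaxter.

(* Main.v *)
(* Read as a linear system for the coefficients of r(v'), the AYBE can be
   solved as v' -> 0 because r(v) is nondegenerate. Hence r(v) has a simple pole
   c P / v at 0, where c <> 0 and P is the permutation tensor, and satisfies the
   Riccati equation c N r' = [1 (x) a, r] - r * r, where * is the product of
   A (x) A^op. Partial traces of the AYBE show that r^2 is scalar near 0, which
   forces r^2 = (c / v)^2 and tr_2 r = N b + c / v with tr b = 0, and that a and
   b are infinitesimal symmetries of r. Conjugation by 1 (x) exp (v a / (c N))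
   removes the commutator; after transposition of the second factor the equation
   becomes q' = - q^2 / (c N), so q(v) = q0 (1 + (v - v0) q0 / (c N))^-1 on all
   of the connected set U. Thus r is gauge equivalent to a rational function Q,
   and every identity known near 0 becomes an identity between rational
   functions. Removing from Q the terms with b and c / v gives the solution of
   the CYBE. The AYBE, its opposite (which is its image under unitarity) and
   r^2 = scalar formally imply the QYBE for r and for 1 + u r. Identities proved
   at generic points reach all regular points by continuity. *)

From HB Require Import structures.
Require Import Defs.
From mathcomp Require Import all_boot all_order all_algebra.
From mathcomp Require Import ring lra zify.
From mathcomp Require Import complex mxtens.
From mathcomp Require Import all_classical all_reals all_analysis.

Set Implicit Arguments.
Unset Strict Implicit.
Unset Printing Implicit Defensive.

Import Order.TTheory GRing.Theory Num.Theory.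
Import numFieldNormedType.Exports.
Local Open Scope classical_set_scope.
Local Open Scope ring_scope.

(** * Complex calculus *)

Section ComplexCalculus.

Definition hasder (K : numFieldType) (f : K -> K) (z d : K) : Prop :=
  is_derive (z : K^o) (1 : K^o) (f : K^o -> K^o) (d : K^o).

Lemma hasderP (K : numFieldType) (f : K -> K) (z d : K) :
  hasder f z d <->
  forall e : K, 0 < e -> exists2 del : K, 0 < del &
    forall h, `|h| < del -> `|f (z + h) - f z - d * h| <= e * `|h|.
Proof.
split.
- case=> df dE e e0.
  move/cvg_ex: (df) => [/= l hl].
  have lE : l = d by rewrite -dE; apply/esym/cvg_lim.
  move/cvgrPdist_le: hl => /(_ e e0) /nbhs_ballP[/= del del0 hdel].
  exists del => // h hh.
  have [->|h0] := eqVneq h 0; first by rewrite addr0 mulr0 !subrr normr0 mulr0.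
  have := hdel h; rewrite /ball /= sub0r normrN => /(_ hh h0).
  rewrite -(ler_pM2r (x := `|h|)) ?normr_gt0// -normrM lE => H.
  apply: le_trans H; rewrite le_eqVlt; apply/orP; left; apply/eqP.
  rewrite -[LHS]normrN; congr `| _ |.
  rewrite /GRing.scale/= mulr1 (addrC h z) mulrBl mulrAC mulVf// mul1r.
  by rewrite opprB.
- move=> H.
  suff hl : (fun h : K => h^-1 *: ((f : K^o -> K^o) (h *: (1 : K^o) + z) - f z))
      @ (0:K)^' --> (d : K^o).
    by split; [apply/cvg_ex; exists d | apply/cvg_lim].
  apply/cvgrPdist_le => e e0; have [del del0 hdel] := H _ e0.
  apply/nbhs_ballP; exists del => //= h; rewrite /ball/= sub0r normrN => hh h0.
  rewrite -(ler_pM2r (x := `|h|)) ?normr_gt0// -normrM.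
  apply: le_trans (hdel _ hh); rewrite le_eqVlt; apply/orP; left; apply/eqP.
  rewrite -[LHS]normrN; congr `| _ |.
  rewrite /GRing.scale/= mulr1 (addrC h z) mulrBl mulrAC mulVf// mul1r.
  by rewrite opprB.
Qed.

Section Rules.
Variable K : numFieldType.
Implicit Types (f g : K -> K) (z c d : K).

Lemma hasder_cst c z : hasder (fun=> c) z 0.
Proof. exact: is_derive_cst. Qed.

Lemma hasder_id z : hasder id z 1.
Proof. exact: is_derive_id. Qed.

Lemma hasderD f g z c d : hasder f z c -> hasder g z d ->
  hasder (fun x => f x + g x) z (c + d).
Proof. by move=> ? ?; apply: is_deriveD. Qed.

Lemma hasderN f z c : hasder f z c -> hasder (fun x => - f x) z (- c).
Proof. by move=> ?; apply: is_deriveN. Qed.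

Lemma hasderB f g z c d : hasder f z c -> hasder g z d ->
  hasder (fun x => f x - g x) z (c - d).
Proof. by move=> ? ?; apply: hasderD => //; apply: hasderN. Qed.

Lemma hasder_eq f z c d : hasder f z c -> c = d -> hasder f z d.
Proof. by move=> ? <-. Qed.

Lemma hasderM f g z c d : hasder f z c -> hasder g z d ->
  hasder (fun x => f x * g x) z (c * g z + f z * d).
Proof.
move=> hf hg; apply: hasder_eq; first exact: (is_deriveM hf hg).
by rewrite addrC /GRing.scale/= (mulrC c).
Qed.

Lemma hasderV f z c : f z != 0 -> hasder f z c ->
  hasder (fun x => (f x)^-1) z (- c / f z ^+ 2).
Proof.
move=> fz0 [df <-]; split; first exact: derivableV.
by rewrite deriveV// /GRing.scale/= !mulNr mulrC.
Qed.

Lemma hasder_sum (I : Type) (s : seq I) (F : I -> K -> K) z (D : I -> K) :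
  (forall i, hasder (F i) z (D i)) ->
  hasder (fun x => \sum_(i <- s) F i x) z (\sum_(i <- s) D i).
Proof.
move=> H; elim: s => [|i s IH].
  rewrite big_nil; rewrite (_ : (fun x => _) = (fun=> 0)); first exact: hasder_cst.
  by apply/funext => x; rewrite big_nil.
rewrite big_cons; rewrite (_ : (fun x => _) = (fun x => F i x + \sum_(j <- s) F j x)).
  exact: hasderD.
by apply/funext => x; rewrite big_cons.
Qed.

Lemma hasderP_unique f z c d : hasder f z c -> hasder f z d -> c = d.
Proof. by case=> _ <- [_ <-]. Qed.

Lemma hasder_cvg f z c : hasder f z c -> f x @[x --> z] --> f z.
Proof.
case=> df _.
by have /derivable1_diffP/differentiable_continuous := df.
Qed.

Lemma hasder_near f g z c : (\forall x \near z, f x = g x) ->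
  hasder f z c -> hasder g z c.
Proof. move=> fg hf; exact: (near_eq_is_derive fg hf). Qed.

Lemma hasder_shift f z a c : hasder f (z + a) c -> hasder (fun x => f (x + a)) z c.
Proof.
move=> /hasderP H; apply/hasderP => e /H[del del0 hd]; exists del => // h /hd.
by rewrite (addrAC z h a).
Qed.

Lemma hasder_scale f z a c : hasder f (a * z) c ->
  hasder (fun x => f (a * x)) z (a * c).
Proof.
move=> /hasderP H; apply/hasderP => e e0.
have a0 : 0 < `|a| + 1 by rewrite ltr_wpDl// normr_ge0.
have [|del del0 hd] := H (e / (`|a| + 1)); first exact: divr_gt0.
exists (del / (`|a| + 1)); first exact: divr_gt0.
move=> h hh; have /hd : `|a * h| < del.
  rewrite normrM; move: hh; rewrite ltr_pdivlMr// => hh.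
  apply: le_lt_trans hh; rewrite mulrC ler_wpM2l ?normr_ge0// lerDl//.
rewrite mulrDr => H1; rewrite -mulrA mulrCA; apply: le_trans H1 _.
rewrite normrM mulrA ler_wpM2r ?normr_ge0// mulrAC ler_pdivrMr//.
by rewrite ler_wpM2l ?lerDl ?ler01// ltW.
Qed.

End Rules.

Definition tends (K : numFieldType) (T : Type) (F : set_system T) (f : T -> K) (a : K)
  : Prop := f x @[x --> F] --> (a : K^o).

Section Limits.
Variables (K : numFieldType) (T : Type) (F : set_system T).
Context {FF : ProperFilter F}.
Implicit Types (f g : T -> K) (a b c : K).

Lemma tendsP f a : tends F f a <->
  forall e, 0 < e -> \forall x \near F, `|a - f x| <= e.
Proof. by split=> [/cvgrPdist_le|h]//; apply/cvgrPdist_le. Qed.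

Lemma tends_cst a : tends F (fun=> a) a.
Proof. exact: cvg_cst. Qed.

Lemma tendsD f g a b : tends F f a -> tends F g b -> tends F (fun x => f x + g x) (a + b).
Proof. by move=> fa gb; apply: cvgD. Qed.

Lemma tendsN f a : tends F f a -> tends F (fun x => - f x) (- a).
Proof. by move=> fa; apply: cvgN. Qed.

Lemma tendsB f g a b : tends F f a -> tends F g b -> tends F (fun x => f x - g x) (a - b).
Proof. by move=> fa gb; apply: cvgB. Qed.

Lemma tendsM f g a b : tends F f a -> tends F g b -> tends F (fun x => f x * g x) (a * b).
Proof. by move=> fa gb; apply: cvgM. Qed.

Lemma tendsV f a : a != 0 -> tends F f a -> tends F (fun x => (f x)^-1) a^-1.
Proof. by move=> a0 fa; apply: cvgV. Qed.

Lemma tends_sum (I : Type) (s : seq I) (f : I -> T -> K) (a : I -> K) :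
  (forall i, tends F (f i) (a i)) ->
  tends F (fun x => \sum_(i <- s) f i x) (\sum_(i <- s) a i).
Proof.
move=> H; elim: s => [|i s IH].
  rewrite big_nil (_ : (fun=> _) = (fun=> 0)); first exact: tends_cst.
  by apply/funext => x; rewrite big_nil.
rewrite big_cons (_ : (fun=> _) = (fun x => f i x + \sum_(j <- s) f j x)).
  exact: tendsD.
by apply/funext => x; rewrite big_cons.
Qed.

Lemma tends_prod (I : Type) (s : seq I) (f : I -> T -> K) (a : I -> K) :
  (forall i, tends F (f i) (a i)) ->
  tends F (fun x => \prod_(i <- s) f i x) (\prod_(i <- s) a i).
Proof.
move=> H; elim: s => [|i s IH].
  rewrite big_nil (_ : (fun=> _) = (fun=> 1)); first exact: tends_cst.
  by apply/funext => x; rewrite big_nil.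
rewrite big_cons (_ : (fun=> _) = (fun x => f i x * \prod_(j <- s) f j x)).
  exact: tendsM.
by apply/funext => x; rewrite big_cons.
Qed.

Lemma tends_unique f a b : tends F f a -> tends F f b -> a = b.
Proof. exact: cvg_unique. Qed.

Lemma tends_near f g a : (\forall x \near F, f x = g x) -> tends F f a -> tends F g a.
Proof.
move=> fg /tendsP fa; apply/tendsP => e e0.
by apply: filterS2 fg (fa e e0) => x <-.
Qed.

Lemma tends_eq f a b : tends F f a -> a = b -> tends F f b.
Proof. by move=> ? <-. Qed.

Lemma tends_norm_le f a c : tends F f a -> (\forall x \near F, `|f x| <= c) -> `|a| <= c.
Proof.
move=> /tendsP fa fc; apply/ler_addgt0Pr => e e0.
have [x [h1 h2]] := filter_ex (filterI (fa _ e0) fc).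
rewrite -[a](subrK (f x)) addrC; apply: le_trans (ler_normD _ _) _.
exact: lerD.
Qed.

Lemma tends_neq0 f a : a != 0 -> tends F f a -> \forall x \near F, f x != 0.
Proof.
move=> a0 /tendsP/(_ (`|a| / 2)); rewrite divr_gt0 ?normr_gt0// => /(_ isT).
apply: filterS => x; apply: contraTneq => ->; rewrite subr0.
by rewrite ler_pdivlMr// ger_pMr ?normr_gt0// (ler_nat _ 2 1).
Qed.

End Limits.

Lemma hasder_tends (K : numFieldType) (f : K -> K) z c : hasder f z c -> tends (nbhs z) f (f z).
Proof. exact: hasder_cvg. Qed.

Section MVT.
Variable R : realType.
Local Notation C := (Cplx R).
Local Notation re := (@complex.Re R).
Local Notation im := (@complex.Im R).

Lemma ReC_norm (z : C) : (`|re z|%:C)%C <= `|z|.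
Proof. exact: normc_ge_Re. Qed.

Lemma hasder_Re_line (f : C -> C) (a e d : C) (t : R) :
  hasder f (a + (t%:C)%C * e) d ->
  hasder (fun s : R => re (f (a + (s%:C)%C * e))) t (re (d * e)).
Proof.
move=> /hasderP H; apply/hasderP => eps eps0.
have n0 : 0 < re `|e| + 1.
  have : 0 <= `|e| by [].
  by rewrite lecE/= => /andP[_]/= ?; rewrite ltr_wpDl.
have [|del del0 hd] := H ((eps / (re `|e| + 1))%:C)%C.
  by rewrite ltcR divr_gt0.
have eE : `|e| = ((re `|e|)%:C)%C by rewrite RRe_real// normr_real.
have delE : del = ((re del)%:C)%C by rewrite RRe_real// gtr0_real.
have del0' : 0 < re del by rewrite -ltcR -delE.
exists (re del / (re `|e| + 1)); first exact: divr_gt0.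
move=> h hh; set k : C := (h%:C)%C * e.
have kE : `|k| = ((`|h| * re `|e|)%:C)%C.
  rewrite normrM eE rmorphM/=; congr (_ * _).
  by rewrite normc_def/= expr0n/= addr0 sqrtr_sqr.
have /hd H1 : `|k| < del.
  rewrite kE delE ltcR; move: hh; rewrite ltr_pdivlMr//.
  by apply: le_lt_trans; rewrite ler_wpM2l ?normr_ge0// lerDl.
have E : re (f (a + ((t + h)%:C)%C * e)) - re (f (a + (t%:C)%C * e)) - re (d * e) * h
    = re (f (a + (t%:C)%C * e + k) - f (a + (t%:C)%C * e) - d * k).
  rewrite rmorphD/= mulrDl addrA -/k !raddfB/=; congr (_ - _).
  by rewrite /k mulrCA; case: (d * e) => x y /=; rewrite mul0r subr0 mulrC.
rewrite E -lecR; apply: (le_trans (ReC_norm _)); apply: le_trans H1 _.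
rewrite kE -rmorphM/= lecR (mulrC `|h|) mulrA ler_wpM2r ?normr_ge0//.
by rewrite mulrAC ler_pdivrMr// ler_wpM2l ?ltW// ltrDl.
Qed.

Lemma re_le_norm (z : C) (M : R) : `|z| <= (M%:C)%C -> `|re z| <= M.
Proof. by move=> h; rewrite -lecR; apply: le_trans (ReC_norm z) h. Qed.

Lemma MVT_re (f f' : C -> C) (a b : C) (M : R) :
  (forall t : R, 0 <= t <= 1 ->
     hasder f (a + (t%:C)%C * (b - a)) (f' (a + (t%:C)%C * (b - a)))) ->
  (forall t : R, 0 <= t <= 1 ->
     `|f' (a + (t%:C)%C * (b - a)) * (b - a)| <= (M%:C)%C) ->
  `|re (f b) - re (f a)| <= M.
Proof.
move=> Hd Hb.
set g := fun s : R => re (f (a + (s%:C)%C * (b - a))).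
have gd t : 0 <= t <= 1 ->
    hasder g t (re (f' (a + (t%:C)%C * (b - a)) * (b - a))).
  by move=> /Hd; apply: hasder_Re_line.
have [t|t|c] := @MVT R g
    (fun t => re (f' (a + (t%:C)%C * (b - a)) * (b - a))) 0 1 ltr01.
- by rewrite in_itv/= => /andP[? ?]; apply: gd; rewrite !ltW.
- apply: (derivable_within_continuous (U := R^o)) => {}t.
  by rewrite in_itv/= => /gd[].
rewrite in_itv/= => /andP[c0 c1]; rewrite subr0 mulr1 => E.
have -> : re (f b) - re (f a) = g 1 - g 0.
  by rewrite /g rmorph1 rmorph0 mul1r mul0r addr0 (addrC a) subrK.
by rewrite E; apply: re_le_norm; apply: Hb; rewrite !ltW.
Qed.

Lemma MVT_complex (f f' : C -> C) (a b : C) (M : R) :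
  (forall t : R, 0 <= t <= 1 ->
     hasder f (a + (t%:C)%C * (b - a)) (f' (a + (t%:C)%C * (b - a)))) ->
  (forall t : R, 0 <= t <= 1 ->
     `|f' (a + (t%:C)%C * (b - a))| <= (M%:C)%C) ->
  `|f b - f a| <= (2 * M)%:C%C * `|b - a|.
Proof.
move=> Hd Hb; set m := complex.Re `|b - a|.
have mE : `|b - a| = (m%:C)%C by rewrite RRe_real// normr_real.
have Hb' t : 0 <= t <= 1 ->
    `|f' (a + (t%:C)%C * (b - a)) * (b - a)| <= ((M * m)%:C)%C.
  by move=> /Hb h; rewrite normrM rmorphM/= -mE ler_wpM2r.
have H1 := MVT_re Hd Hb'.
have H2 : `|re ('i%C * f b) - re ('i%C * f a)| <= M * m.
  apply: (@MVT_re (fun z => 'i%C * f z) (fun z => 'i%C * f' z)) => t tI.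
    apply: hasder_eq; first exact: (hasderM (hasder_cst _ _) (Hd _ tI)).
    by rewrite mul0r add0r.
  rewrite -mulrA normrM (_ : `|'i%C| = 1) ?mul1r; first exact: Hb'.
  by rewrite normc_def/= expr0n/= add0r expr1n sqrtr1.
rewrite mE -rmorphM/= -mulrA mulr2n mulrDl mul1r rmorphD/=.
set w := f b - f a.
rewrite [w]complexE; apply: le_trans (ler_normD _ _) _; apply: lerD.
  have -> : `|((re w)%:C)%C| = ((`|re w|)%:C)%C.
    by rewrite normc_def/= expr0n/= addr0 sqrtr_sqr.
  by rewrite lecR /w raddfB.
rewrite normrM (_ : `|'i%C| = 1) ?mul1r; last first.
  by rewrite normc_def/= expr0n/= add0r expr1n sqrtr1.
have -> : `|((im w)%:C)%C| = ((`|im w|)%:C)%C.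
  by rewrite normc_def/= expr0n/= addr0 sqrtr_sqr.
rewrite lecR; move: H2; rewrite -raddfB -mulrBr -/w.
by case: (w) => x y/=; rewrite mul0r mul1r sub0r normrN.
Qed.

Lemma seg_norm (a b : C) (t : R) : `|(t%:C)%C * (b - a)| = (`|t|%:C)%C * `|b - a|.
Proof. by rewrite normrM normc_def/= expr0n/= addr0 sqrtr_sqr. Qed.

Definition convexC (S : set C) := forall a b t, S a -> S b -> 0 <= t <= 1 ->
  S (a + (t%:C)%C * (b - a)).

Lemma half_pow_eq0 (z : C) (B : R) :
  (forall k : nat, `|z| <= ((B / 2 ^+ k)%:C)%C) -> z = 0.
Proof.
move=> H; apply/eqP; rewrite -normr_eq0.
have [y yE] : exists y : R, `|z| = (y%:C)%C.
  by exists (complex.Re `|z|); rewrite RRe_real// normr_real.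
have y0 : 0 <= y by rewrite -ler0c -yE.
rewrite {}yE in H *.
suff -> : y = 0 by [].
apply/eqP; rewrite eq_le y0 andbT leNgt; apply/negP => yp.
have {}H k : y * 2 ^+ k <= B.
  by have := H k; rewrite lecR ler_pdivlMr ?exprn_gt0.
have [k hk] : exists k : nat, B / y < k%:R.
  by exists (Num.truncn (B / y)).+1; apply: truncnS_gt.
have := H k; apply/negP; rewrite -ltNge mulrC -ltr_pdivrMr//.
apply: lt_le_trans hk _; rewrite -natrX ler_nat ltnW//; exact: ltn_expl.
Qed.

Lemma gronwall m n (S : set C) (E E' : C -> 'M[C]_(m, n)) (K B : R) (a : C) :
  convexC S -> 0 < K ->
  (forall z, S z -> forall i j, hasder (fun x => E x i j) z (E' z i j)) ->
  (forall z M, S z -> (forall i j, `|E z i j| <= (M%:C)%C) ->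
     forall i j, `|E' z i j| <= ((K * M)%:C)%C) ->
  (forall z i j, S z -> `|E z i j| <= (B%:C)%C) ->
  S a -> E a = 0 -> forall z, S z -> E z = 0.
Proof.
move=> Sc K0 dE bE' bE.
pose rho : R := (4 * K)^-1.
have rho0 : 0 < rho by rewrite invr_gt0 mulr_gt0.
have loc w : S w -> E w = 0 -> forall z, S z -> `|z - w| <= (rho%:C)%C -> E z = 0.
  move=> Sw Ew z Sz zw; apply/matrixP => i j; rewrite mxE.
  apply: (@half_pow_eq0 _ B) => k; elim: k z Sz zw i j => [|k IH] z Sz zw i j.
    by rewrite expr0 divr1; apply: bE.
  have zt t : 0 <= t <= 1 -> S (w + (t%:C)%C * (z - w)) by move=> tI; apply: Sc.
  have zwt t : 0 <= t <= 1 -> `|w + (t%:C)%C * (z - w) - w| <= (rho%:C)%C.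
    move=> /andP[t0 t1]; rewrite addrAC subrr add0r seg_norm.
    apply: le_trans zw; rewrite ler_piMl ?normr_ge0// lecR ger0_norm//.
  have := @MVT_complex (fun x => E x i j) (fun x => E' x i j) w z (K * (B / 2 ^+ k)).
  rewrite Ew mxE subr0 => H.
  apply: le_trans (H _ _) _ => [t tI|t tI|].
  - by apply: dE; apply: zt.
  - by apply: bE' (zt _ tI) _ _ _ => i' j'; apply: IH; [exact: zt | exact: zwt].
  have b0 : 0 <= B / 2 ^+ k.
    have := IH z Sz zw i j; have : 0 <= `|E z i j| by [].
    by move=> h1 h2; have := le_trans h1 h2; rewrite ler0c.
  apply: (@le_trans _ _ ((2 * (K * (B / 2 ^+ k)))%:C%C * (rho%:C)%C)).
    by rewrite ler_wpM2l// ler0c mulr_ge0// mulr_ge0// ltW.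
  rewrite -rmorphM/= lecR /rho exprSr.
  rewrite le_eqVlt; apply/orP; left; apply/eqP; field.
  by rewrite !gt_eqF// exprn_gt0.
move=> Sa Ea z Sz.
have [k hk] : exists k : nat, `|z - a| <= ((k%:R * rho)%:C)%C.
  exists (Num.truncn (complex.Re `|z - a| / rho)).+1.
  have -> : `|z - a| = ((complex.Re `|z - a|)%:C)%C by rewrite RRe_real// normr_real.
  rewrite lecR -ler_pdivrMr//= ltW//; exact: truncnS_gt.
elim: k z Sz hk => [|k IH] z Sz.
  by rewrite mul0r normr_le0 subr_eq0 => /eqP->.
have [->//|k0] := eqVneq k 0%N.
  by rewrite mul1r => h; apply: loc Sa Ea z Sz h.
move=> hk; pose t : R := k%:R / k.+1%:R.
have t01 : 0 <= t <= 1.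
  by rewrite divr_ge0//= ler_pdivrMr// mul1r ler_nat.
have tE : `|t| = t by rewrite ger0_norm//; case/andP: t01.
have wS : S (a + (t%:C)%C * (z - a)) by apply: Sc.
apply: (loc _ wS) => //.
  apply: IH => //; rewrite addrAC subrr add0r seg_norm tE.
  apply: le_trans (ler_wpM2l _ hk) _; first by rewrite ler0c; case/andP: t01.
  rewrite -rmorphM/= lecR /t mulrA divfK ?pnatr_eq0//.
have -> : z - (a + (t%:C)%C * (z - a)) = ((1 - t)%:C)%C * (z - a).
  by rewrite rmorphB rmorph1 mulrBl mul1r opprD addrA.
rewrite seg_norm ger0_norm; last by case/andP: t01; rewrite subr_ge0.
apply: le_trans (ler_wpM2l _ hk) _.
  by rewrite ler0c subr_ge0; case/andP: t01.
rewrite -rmorphM/= lecR /t le_eqVlt; apply/orP; left; apply/eqP; field.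
by rewrite addrC natr1 pnatr_eq0.
Qed.

Definition half_disc (eps : R) (u : C) (eta : R) : set C :=
  [set z | `|z| < (eps%:C)%C /\ eta <= re (u * z)].

Lemma half_disc_convex eps u eta : convexC (half_disc eps u eta).
Proof.
move=> a b t [ae ua] [be ub] /andP[t0 t1].
have E : a + (t%:C)%C * (b - a) = ((1 - t)%:C)%C * a + (t%:C)%C * b.
  by rewrite rmorphB rmorph1 mulrBr mulrBl mul1r addrA addrAC.
rewrite E; split => /=.
  apply: le_lt_trans (ler_normD _ _) _.
  rewrite !normrM (ger0_norm (x := ((1 - t)%:C)%C)) ?ler0c ?subr_ge0//.
  rewrite (ger0_norm (x := (t%:C)%C)) ?ler0c//.
  have [->|t_neq0] := eqVneq t 0.
    by rewrite subr0 rmorph1 rmorph0 mul1r mul0r addr0.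
  have -> : (eps%:C)%C = ((1 - t)%:C)%C * (eps%:C)%C + (t%:C)%C * (eps%:C)%C.
    by rewrite -mulrDl -rmorphD subrK rmorph1 mul1r.
  apply: ler_ltD; first by rewrite ler_wpM2l ?ler0c ?subr_ge0// ltW.
  by rewrite ltr_pM2l// ltcR lt_neqAle eq_sym t_neq0.
have -> : re (u * (((1 - t)%:C)%C * a + (t%:C)%C * b)) =
    (1 - t) * re (u * a) + t * re (u * b).
  rewrite mulrDr raddfD/= mulrCA (mulrCA u).
  by case: (u * a) (u * b) => [? ?] [? ?]/=; rewrite !mul0r !subr0.
have -> : eta = (1 - t) * eta + t * eta by rewrite -mulrDl subrK mul1r.
by apply: lerD; rewrite ler_wpM2l// subr_ge0.
Qed.

Lemma half_disc_norm eps u eta z : `|u| = 1 -> half_disc eps u eta z ->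
  (eta%:C)%C <= `|z| < (eps%:C)%C.
Proof.
move=> u1 [/= ze uz]; rewrite ze andbT -[`|z|]mul1r -u1 -normrM.
apply: le_trans (ReC_norm _); rewrite lecR.
exact: le_trans uz (ler_norm _).
Qed.

(* A punctured disc is a chain of four half discs. *)
Lemma punctured_connect (P : C -> Prop) (eps : R) (a : C) :
  (forall u eta p q, `|u| = 1 -> 0 < eta ->
     half_disc eps u eta p -> half_disc eps u eta q -> P p -> P q) ->
  0 < `|a| < (eps%:C)%C -> P a -> forall z, 0 < `|z| < (eps%:C)%C -> P z.
Proof.
move=> HP.
have half u p q : `|u| = 1 -> 0 < re (u * p) -> 0 < re (u * q) ->
    `|p| < (eps%:C)%C -> `|q| < (eps%:C)%C -> P p -> P q.
  move=> u1 up uq pe qe.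
  apply: (HP u (Num.min (re (u * p)) (re (u * q)))) => //.
  - by rewrite lt_min up.
  - by split => //=; rewrite ge_min lexx.
  - by split => //=; rewrite ge_min lexx orbT.
move=> /andP[a0 ae] Pa z /andP[z0 ze].
have eps0 : 0 < eps by rewrite -ltcR; apply: lt_trans a0 ae.
pose k := eps / 4.
have k0 : 0 < k by rewrite divr_gt0.
have kk (x y : R) : `|x| = k -> `|y| = k -> `|(x +i* y)%C| < (eps%:C)%C.
  move=> hx hy; rewrite [(x +i* y)%C]complexE/=.
  apply: le_lt_trans (ler_normD _ _) _.
  rewrite normrM (_ : `|'i%C| = 1) ?mul1r; last first.
    by rewrite normc_def/= expr0n/= add0r expr1n sqrtr1.
  rewrite !normc_def/= expr0n/= !addr0 !sqrtr_sqr hx hy -rmorphD/= ltcR /k; lra.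
have nu : [/\ `|1 : C| = 1, `|-1 : C| = 1, `|'i%C : C| = 1 & `|- 'i%C : C| = 1].
  have i1 : `|'i%C : C| = 1 by rewrite normc_def/= expr0n/= add0r expr1n sqrtr1.
  by rewrite !normrN normr1.
have kN : `|- k| = k by rewrite normrN gtr0_norm.
have kP : `|k| = k by rewrite gtr0_norm.
case: nu => n1 n2 n3 n4.
have reM (x y : R) : [/\ re (1 * (x +i* y)%C) = x, re (-1 * (x +i* y)%C) = - x,
    re ('i%C * (x +i* y)%C) = - y & re (- 'i%C * (x +i* y)%C) = y].
  split; rewrite /= ?mul1r ?mulN1r//; simpc => //; rewrite ?mul0r ?mul1r ?oppr0; lra.
have {}half u p q x y x' y' : `|u| = 1 -> p = (x +i* y)%C -> q = (x' +i* y')%C ->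
    0 < re (u * (x +i* y)%C) -> 0 < re (u * (x' +i* y')%C) ->
    `|p| < (eps%:C)%C -> `|q| < (eps%:C)%C -> (P p <-> P q).
  by move=> ? pE qE; rewrite -pE -qE => ? ? ? ?; split; apply: (half u).
pose c1 := (k +i* k)%C; pose c2 := (- k +i* k)%C.
pose c3 := (- k +i* - k)%C; pose c4 := (k +i* - k)%C.
have c12 : P c1 <-> P c2.
  apply: (half (- 'i%C)) => //; rewrite ?kk//.
    by case: (reM k k) => [? ? ? ->].
  by case: (reM (-k) k) => [? ? ? ->].
have c23 : P c2 <-> P c3.
  apply: (half (- 1)) => //; rewrite ?kk//.
    by case: (reM (-k) k) => [? -> ? ?]; rewrite opprK.
  by case: (reM (-k) (-k)) => [? -> ? ?]; rewrite opprK.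
have c34 : P c3 <-> P c4.
  apply: (half 'i%C) => //; rewrite ?kk//.
    by case: (reM (-k) (-k)) => [? ? -> ?]; rewrite opprK.
  by case: (reM k (-k)) => [? ? -> ?]; rewrite opprK.
have key w : 0 < `|w| -> `|w| < (eps%:C)%C -> (P w <-> P c1).
  case: w => x y w0 we.
  have : (x != 0) || (y != 0).
    by rewrite -negb_and; apply: contraTN w0 => /andP[/eqP-> /eqP->]; rewrite normr0 ltxx.
  rewrite !neq_lt -orbA => /or4P[] h.
  - rewrite c12; apply: (half (-1)) => //; rewrite ?kk//.
      by case: (reM x y) => [? -> ? ?]; rewrite oppr_gt0.
    by case: (reM (-k) k) => [? -> ? ?]; rewrite opprK.
  - apply: (half 1) => //; rewrite ?kk//.
      by case: (reM x y) => [-> ? ? ?].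
    by case: (reM k k) => [-> ? ? ?].
  - rewrite c12 c23; apply: (half 'i%C) => //; rewrite ?kk//.
      by case: (reM x y) => [? ? -> ?]; rewrite oppr_gt0.
    by case: (reM (-k) (-k)) => [? ? -> ?]; rewrite opprK.
  - apply: (half (- 'i%C)) => //; rewrite ?kk//.
      by case: (reM x y) => [? ? ? ->].
    by case: (reM k k) => [? ? ? ->].
by apply/(key _ z0 ze)/(key _ a0 ae).
Qed.

Lemma gronwall_punctured m n (E E' : C -> 'M[C]_(m, n)) (eps : R) (a : C) :
  (forall z, 0 < `|z| < (eps%:C)%C ->
     forall i j, hasder (fun x => E x i j) z (E' z i j)) ->
  (forall eta : R, 0 < eta -> exists2 K : R, 0 < K &
     forall z M, (eta%:C)%C <= `|z| < (eps%:C)%C ->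
     (forall i j, `|E z i j| <= (M%:C)%C) ->
     forall i j, `|E' z i j| <= ((K * M)%:C)%C) ->
  (forall eta : R, 0 < eta -> exists B : R,
     forall z i j, (eta%:C)%C <= `|z| < (eps%:C)%C -> `|E z i j| <= (B%:C)%C) ->
  0 < `|a| < (eps%:C)%C -> E a = 0 ->
  forall z, 0 < `|z| < (eps%:C)%C -> E z = 0.
Proof.
move=> dE bE' bE aI Ea.
apply: (punctured_connect (P := fun z => E z = 0) _ aI Ea) => u eta p q u1 eta0 hp hq Ep.
have sub := half_disc_norm u1.
have sub0 z : half_disc eps u eta z -> 0 < `|z| < (eps%:C)%C.
  move=> /sub/andP[h ->]; rewrite andbT; apply: lt_le_trans h.
  by rewrite ltcR.
have [K K0 hK] := bE' _ eta0; have [B hB] := bE _ eta0.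
apply: (@gronwall _ _ (half_disc eps u eta) E E' K B p) => //.
- exact: half_disc_convex.
- by move=> z /sub0 ? i j; apply: dE.
- by move=> z M /sub; apply: hK.
- by move=> z i j /sub; apply: hB.
Qed.

Lemma der0_convex (S : set C) (f : C -> C) (a b : C) : convexC S ->
  (forall z, S z -> hasder f z 0) -> S a -> S b -> f a = f b.
Proof.
move=> Sc H Sa Sb; apply/eqP; rewrite -subr_eq0 -normr_eq0 eq_le normr_ge0 andbT.
have := @MVT_complex f (fun=> 0) b a 0.
rewrite mulr0 mul0r; apply => [t tI|t _]; last by rewrite normr0.
by apply: H; apply: Sc.
Qed.

Lemma der0_punctured (f : C -> C) (eps : R) (a z : C) :
  (forall z, 0 < `|z| < (eps%:C)%C -> hasder f z 0) ->
  0 < `|a| < (eps%:C)%C -> 0 < `|z| < (eps%:C)%C -> f z = f a.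
Proof.
move=> H aI zI.
apply: (punctured_connect (P := fun z => f z = f a) _ aI erefl zI).
move=> u eta p q u1 eta0 hp hq <-.
apply: (der0_convex _ _ hq hp); first exact: half_disc_convex.
move=> x /(half_disc_norm u1)/andP[h h']; apply: H; rewrite h' andbT.
by apply: lt_le_trans h; rewrite ltcR.
Qed.

Lemma der0_const (f : C -> C) (a b : C) : (forall z, hasder f z 0) -> f a = f b.
Proof. by move=> H; apply: (@der0_convex setT). Qed.

Lemma der0_ray (f : C -> C) (a : C) (s t : R) :
  (forall x : R, 0 < x <= 1 -> hasder f ((x%:C)%C * a) 0) ->
  0 < s <= 1 -> 0 < t <= 1 -> f ((s%:C)%C * a) = f ((t%:C)%C * a).
Proof.
move=> H /andP[s0 s1] /andP[t0 t1].
pose S : set C := [set z | exists2 x : R, 0 < x <= 1 & z = (x%:C)%C * a].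
apply: (@der0_convex S); last 2 first.
- by exists s => //; apply/andP.
- by exists t => //; apply/andP.
- move=> _ _ x [p /andP[p0 p1] ->] [q /andP[q0 q1] ->] /andP[x0 x1].
  exists ((1 - x) * p + x * q); last by rewrite !(rmorphD, rmorphM, rmorphB, rmorph1)/=; ring.
  apply/andP; split.
    have [->|x_neq0] := eqVneq x 0; first by rewrite subr0 mul1r mul0r addr0.
    by rewrite ltr_wpDl ?mulr_ge0 ?subr_ge0// ?ltW// mulr_gt0// lt_neqAle eq_sym x_neq0.
  have E1 : (1 - x) * 1 + x * 1 = 1 by rewrite -mulrDl subrK mul1r.
  rewrite -[leRHS]E1.
  by apply: lerD; rewrite ler_wpM2l// subr_ge0.
- by move=> _ [x xI ->]; apply: H.
Qed.

End MVT.
End ComplexCalculus.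

Section PowerSeries.
Variable R : realType.
Local Notation C := (Cplx R).

Definition psum (a : nat -> C) (n : nat) (v : C) : C :=
  \sum_(k < n) a k * v ^+ k.

Definition exp_bounded (a : nat -> C) (M : R) :=
  forall k, `|a k| <= ((M ^+ k / k`!%:R)%:C)%C.

Definition is_ps (a : nat -> C) (v l : C) : Prop :=
  tends \oo (fun n => psum a n v) l.

Lemma normCR (x : R) : `|(x%:C)%C : C| = (`|x|%:C)%C.
Proof. by rewrite normc_def/= expr0n/= addr0 sqrtr_sqr. Qed.

Lemma normCi : `|'i%C : C| = 1.
Proof. by rewrite normc_def/= expr0n/= add0r expr1n sqrtr1. Qed.

Lemma normC_real (z : C) : exists2 x : R, 0 <= x & `|z| = (x%:C)%C.
Proof.
have E : `|z| = ((complex.Re `|z|)%:C)%C by rewrite RRe_real// normr_real.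
by exists (complex.Re `|z|) => //; rewrite -ler0c -E.
Qed.

Lemma norm_le_ReIm (z : C) :
  `|z| <= ((`|complex.Re z| + `|complex.Im z|)%:C)%C.
Proof.
rewrite {1}[z]complexE; apply: le_trans (ler_normD _ _) _.
by rewrite normrM normCi mul1r !normCR rmorphD.
Qed.

Lemma norm_ge_Im (z : C) : (`|complex.Im z|%:C)%C <= `|z|.
Proof.
have := normc_ge_Re ('i%C * z); rewrite normrM normCi mul1r.
by case: z => x y/=; rewrite mul0r mul1r sub0r normrN.
Qed.

Lemma psum_cvg a M v : 0 <= M -> exp_bounded a M -> exists l, is_ps a v l.
Proof.
move=> M0 aM; have [x x0 xE] := normC_real v.
have bnd k : `|a k * v ^+ k| <= ((exp_coeff (M * x) k)%:C)%C.
  rewrite normrM normrX xE -rmorphXn /exp_coeff/= exprMn mulrAC rmorphM/=.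
  by rewrite ler_wpM2r// ler0c exprn_ge0.
have cv (p : C -> R) : (forall z, (`|p z|%:C)%C <= `|z|) ->
    cvgn (series (fun k => p (a k * v ^+ k))).
  move=> hp; apply: normed_cvg; apply: series_le_cvg (is_cvg_series_exp_coeff (M * x)) => k //=.
    by rewrite /exp_coeff/= divr_ge0// exprn_ge0// mulr_ge0.
  by rewrite -lecR; apply: le_trans (hp _) (bnd k).
have /cvg_ex[/= lr hr] := cv _ (@normc_ge_Re _).
have /cvg_ex[/= li hi] := cv _ norm_ge_Im.
exists (lr +i* li)%C; apply/tendsP => e e0.
have eE : e = ((complex.Re e)%:C)%C by rewrite RRe_real// gtr0_real.
have e20 : 0 < complex.Re e / 2 by rewrite divr_gt0// -ltcR -eE.
move/cvgrPdist_le: hr => /(_ _ e20) hr.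
move/cvgrPdist_le: hi => /(_ _ e20) hi.
near=> n.
apply: le_trans (norm_le_ReIm _) _; rewrite eE lecR (splitr (complex.Re e)).
apply: lerD.
  have -> : complex.Re ((lr +i* li)%C - psum a n v) =
      lr - series (fun k => complex.Re (a k * v ^+ k)) n.
    by rewrite raddfB/= /psum /series/= raddf_sum big_mkord.
  by near: n.
have -> : complex.Im ((lr +i* li)%C - psum a n v) =
    li - series (fun k => complex.Im (a k * v ^+ k)) n.
  by rewrite raddfB/= /psum /series/= raddf_sum big_mkord.
by near: n.
Unshelve. all: by end_near. Qed.


Lemma psum_der_bound a a' M v h x n : 0 <= M -> exp_bounded a M ->
  (forall k, a' k = k.+1%:R * a k.+1) -> 1 <= x ->
  `|v| <= (x%:C)%C -> `|v + h| <= (x%:C)%C ->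
  `|psum a n.+1 (v + h) - psum a n.+1 v - psum a' n v * h|
    <= ((expR (4 * (M * x)))%:C)%C * `|h| ^+ 2.
Proof.
move=> M0 aM a'E x1 vx vhx; have x0 : 0 <= x by apply: le_trans x1.
pose T k := (v + h) ^+ k - v ^+ k - k%:R * h * v ^+ k.-1.
have TS k : T k.+1 = (v + h) * T k + k%:R * h ^+ 2 * v ^+ k.-1.
  rewrite /T -natr1; case: k => [|k] /=; first by rewrite !expr0 !expr1; ring.
  by rewrite !exprS; ring.
have Tb k : `|T k| <= ((k%:R ^+ 2 * x ^+ k)%:C)%C * `|h| ^+ 2.
  elim: k => [|k IH].
    by rewrite /T !expr0 subrr mul0r mul0r subr0 normr0 expr0n/= mul0r rmorph0 mul0r.
  rewrite TS; apply: le_trans (ler_normD _ _) _.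
  rewrite !normrM !normrX.
  have h1 : `|v + h| * `|T k| <= (x%:C)%C * (((k%:R ^+ 2 * x ^+ k)%:C)%C * `|h| ^+ 2).
    by rewrite ler_pM.
  have h2 : `|k%:R : C| * `|h| ^+ 2 * `|v| ^+ k.-1 <=
      ((k%:R * x ^+ k.+1)%:C)%C * `|h| ^+ 2.
    rewrite normr_nat -mulrA (mulrC (`|h| ^+ 2)) mulrA ler_wpM2r ?exprn_ge0//.
    rewrite rmorphM/= rmorph_nat ler_wpM2l ?ler0n//.
    apply: (@le_trans _ _ (((x%:C)%C : C) ^+ k.-1)).
      by rewrite lerXn2r// nnegrE// ler0c.
    rewrite -rmorphXn lecR ler_weXn2l//; lia.
  apply: le_trans (lerD h1 h2) _; rewrite mulrA -mulrDl ler_wpM2r ?exprn_ge0//.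
  rewrite -rmorphM -rmorphD lecR -natr1.
  have -> : x * (k%:R ^+ 2 * x ^+ k) + k%:R * x ^+ k.+1 =
      (k%:R ^+ 2 + k%:R) * x ^+ k.+1 by rewrite (exprS x k); ring.
  rewrite ler_wpM2r ?exprn_ge0//.
  by rewrite sqrrD1 -addrA lerD2l mulr2n -addrA lerDl addr_ge0.
have -> : psum a n.+1 (v + h) - psum a n.+1 v - psum a' n v * h =
    \sum_(k < n.+1) a k * T k.
  have -> : psum a' n v * h = \sum_(k < n.+1) a k * (k%:R * h * v ^+ k.-1).
    rewrite big_ord_recl/= mul0r mul0r mulr0 add0r mulr_suml.
    by apply: eq_bigr => k _; rewrite a'E /bump/=; ring.
  rewrite -!sumrB; apply: eq_bigr => k _; rewrite /T; ring.
apply: le_trans (ler_norm_sum _ _ _) _.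
apply: (@le_trans _ _ (((\sum_(k < n.+1) exp_coeff (4 * (M * x)) k)%:C)%C * `|h| ^+ 2)).
  rewrite rmorph_sum/= mulr_suml; apply: ler_sum => k _.
  rewrite normrM; apply: le_trans (ler_pM _ _ (aM k) (Tb k)) _ => //.
  rewrite [leLHS]mulrA ler_wpM2r ?exprn_ge0// -rmorphM/= lecR /exp_coeff/= !exprMn.
  set f := (k`!%:R)^-1.
  have -> : M ^+ k * f * (k%:R ^+ 2 * x ^+ k) = k%:R ^+ 2 * (M ^+ k * x ^+ k * f) by ring.
  rewrite -[leRHS]mulrA ler_wpM2r ?mulr_ge0 ?exprn_ge0 ?invr_ge0//.
  rewrite -natrX -(natrX _ 4) ler_nat -[4%N]/(2 ^ 2)%N -expnM mulnC expnM.
  by rewrite leq_exp2r// ltnW// ltn_expl.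
rewrite ler_wpM2r ?exprn_ge0// lecR -(big_mkord xpredT (exp_coeff _)).
apply: (nondecreasing_cvgn_le (u_ := series (exp_coeff (4 * (M * x))))).
  apply: nondecreasing_series => k _ _; apply: exp_coeff_ge0.
  by rewrite !mulr_ge0.
exact: is_cvg_series_exp_coeff.
Qed.

Lemma ps_hasder a a' M (f g : C -> C) v : 0 <= M -> exp_bounded a M ->
  (forall k, a' k = k.+1%:R * a k.+1) ->
  (forall w, is_ps a w (f w)) -> (forall w, is_ps a' w (g w)) ->
  hasder f v (g v).
Proof.
move=> M0 aM a'E af a'g; apply/hasderP => e e0.
have [y y0 yE] := normC_real v.
pose x := y + 1; have x1 : 1 <= x by rewrite lerDr.
set K : C := ((expR (4 * (M * x)))%:C)%C.
have K0 : 0 < K by rewrite ltcR expR_gt0.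
have Ke0 : 0 < K + e by rewrite addr_gt0.
exists (e / (K + e)); first by rewrite divr_gt0.
move=> h hh.
have h1 : `|h| < 1 by apply: lt_trans hh _; rewrite ltr_pdivrMr// mul1r ltrDr.
have he : `|h| < e / K.
  by apply: lt_trans hh _; rewrite ltr_pM2l// ltf_pV2// ltrDl.
have vx : `|v| <= (x%:C)%C by rewrite yE lecR lerDl.
have vhx : `|v + h| <= (x%:C)%C.
  by apply: le_trans (ler_normD _ _) _; rewrite yE /x rmorphD/= lerD// ltW.
apply: (@le_trans _ _ (K * `|h| ^+ 2)); last first.
  rewrite expr2 mulrA ler_wpM2r// mulrC -ler_pdivlMr// ltW//.
have shift (u : nat -> C) (l : C) : tends \oo u l -> tends \oo (fun n => u n.+1) l.
  by rewrite /tends (cvg_shiftS u).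
apply: (@tends_norm_le _ _ \oo _ (fun n => psum a n.+1 (v + h) - psum a n.+1 v - psum a' n v * h)).
  apply: tendsB; last by apply: tendsM; [exact: a'g | exact: tends_cst].
  by apply: tendsB; [exact: (shift (fun n => psum a n (v + h)) _ (af _)) | exact: (shift (fun n => psum a n v) _ (af _))].
by apply: nearW => n; apply: psum_der_bound.
Qed.

Lemma is_ps_unique a v l l' : is_ps a v l -> is_ps a v l' -> l = l'.
Proof. exact: tends_unique. Qed.

Lemma is_ps_sum (I : Type) (s : seq I) (c : I -> C) (a : I -> nat -> C) v (l : I -> C) :
  (forall i, is_ps (a i) v (l i)) ->
  is_ps (fun k => \sum_(i <- s) c i * a i k) v (\sum_(i <- s) c i * l i).
Proof.
move=> H; rewrite /is_ps.
have -> : (psum (fun k => \sum_(i <- s) c i * a i k))^~ v =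
    (fun n => \sum_(i <- s) c i * psum (a i) n v).
  apply/funext => n; rewrite /psum.
  under eq_bigr do rewrite mulr_suml.
  rewrite exchange_big/=; apply: eq_bigr => i _; rewrite mulr_sumr.
  by apply: eq_bigr => k _; rewrite mulrA.
by apply: tends_sum => i; apply: tendsM; [exact: tends_cst | exact: H].
Qed.

End PowerSeries.

Section MatrixCalculus.
Variable K : numFieldType.

Definition mder m n (f : K -> 'M[K]_(m, n)) (z : K) (d : 'M[K]_(m, n)) : Prop :=
  forall i j, hasder (fun x => f x i j) z (d i j).

Lemma mder_cst m n (A : 'M[K]_(m, n)) z : mder (fun=> A) z 0.
Proof. by move=> i j; rewrite mxE; apply: hasder_cst. Qed.

Lemma mderD m n (f g : K -> 'M[K]_(m, n)) z c d : mder f z c -> mder g z d ->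
  mder (fun x => f x + g x) z (c + d).
Proof.
move=> fc gd i j; rewrite mxE.
rewrite (_ : (fun=> _) = (fun x => f x i j + g x i j)); first exact: hasderD.
by apply/funext => x; rewrite mxE.
Qed.

Lemma mderN m n (f : K -> 'M[K]_(m, n)) z c : mder f z c -> mder (fun x => - f x) z (- c).
Proof.
move=> fc i j; rewrite mxE.
rewrite (_ : (fun=> _) = (fun x => - f x i j)); first exact: hasderN.
by apply/funext => x; rewrite mxE.
Qed.

Lemma mderB m n (f g : K -> 'M[K]_(m, n)) z c d : mder f z c -> mder g z d ->
  mder (fun x => f x - g x) z (c - d).
Proof. by move=> fc gd; apply: mderD => //; apply: mderN. Qed.

Lemma mderM m n p (f : K -> 'M[K]_(m, n)) (g : K -> 'M[K]_(n, p)) z c d :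
  mder f z c -> mder g z d -> mder (fun x => f x *m g x) z (c *m g z + f z *m d).
Proof.
move=> fc gd i j; rewrite !mxE -big_split/=.
rewrite (_ : (fun=> _) = (fun x => \sum_k f x i k * g x k j)).
  by apply: hasder_sum => k; apply: hasderM.
by apply/funext => x; rewrite mxE.
Qed.

Lemma mderZ m n (f : K -> K) (g : K -> 'M[K]_(m, n)) z c d :
  hasder f z c -> mder g z d -> mder (fun x => f x *: g x) z (c *: g z + f z *: d).
Proof.
move=> fc gd i j; rewrite !mxE.
rewrite (_ : (fun=> _) = (fun x => f x * g x i j)); first exact: hasderM.
by apply/funext => x; rewrite mxE.
Qed.

Lemma mder_eq m n (f : K -> 'M[K]_(m, n)) z c d : mder f z c -> c = d -> mder f z d.
Proof. by move=> ? <-. Qed.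

Lemma mder_unique m n (f : K -> 'M[K]_(m, n)) z c d : mder f z c -> mder f z d -> c = d.
Proof. by move=> fc fd; apply/matrixP => i j; apply: hasderP_unique (fc i j) (fd i j). Qed.

Definition mtends (T : Type) (F : set_system T) m n (f : T -> 'M[K]_(m, n)) (A : 'M[K]_(m, n)) : Prop :=
  forall i j, tends F (fun x => f x i j) (A i j).

Lemma mder_tends m n (f : K -> 'M[K]_(m, n)) z c : mder f z c -> mtends (nbhs z) f (f z).
Proof. by move=> fc i j; apply: hasder_tends (fc i j). Qed.

Section MLimits.
Variables (T : Type) (F : set_system T).
Context {FF : ProperFilter F}.

Lemma mtends_cst m n (A : 'M[K]_(m, n)) : mtends F (fun=> A) A.
Proof. by move=> i j; apply: tends_cst. Qed.

Lemma mtendsD m n (f g : T -> 'M[K]_(m, n)) A B : mtends F f A -> mtends F g B ->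
  mtends F (fun x => f x + g x) (A + B).
Proof.
move=> fA gB i j. rewrite mxE.
rewrite (_ : (fun=> _) = (fun x => f x i j + g x i j)); first exact: tendsD.
by apply/funext => x; rewrite mxE.
Qed.

Lemma mtendsN m n (f : T -> 'M[K]_(m, n)) A : mtends F f A -> mtends F (fun x => - f x) (- A).
Proof.
move=> fA i j; rewrite mxE.
rewrite (_ : (fun=> _) = (fun x => - f x i j)); first exact: tendsN.
by apply/funext => x; rewrite mxE.
Qed.

Lemma mtendsB m n (f g : T -> 'M[K]_(m, n)) A B : mtends F f A -> mtends F g B ->
  mtends F (fun x => f x - g x) (A - B).
Proof. by move=> fA gB; apply: mtendsD => //; apply: mtendsN. Qed.

Lemma mtendsM m n p (f : T -> 'M[K]_(m, n)) (g : T -> 'M[K]_(n, p)) A B :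
  mtends F f A -> mtends F g B -> mtends F (fun x => f x *m g x) (A *m B).
Proof.
move=> fA gB i j; rewrite !mxE.
rewrite (_ : (fun=> _) = (fun x => \sum_k f x i k * g x k j)).
  by apply: tends_sum => k; apply: tendsM.
by apply/funext => x; rewrite mxE.
Qed.

Lemma mtendsZ m n (f : T -> K) (g : T -> 'M[K]_(m, n)) a B :
  tends F f a -> mtends F g B -> mtends F (fun x => f x *: g x) (a *: B).
Proof.
move=> fA gB i j; rewrite !mxE.
rewrite (_ : (fun=> _) = (fun x => f x * g x i j)); first exact: tendsM.
by apply/funext => x; rewrite mxE.
Qed.

Lemma mtends_near m n (f g : T -> 'M[K]_(m, n)) A : (\forall x \near F, f x = g x) ->
  mtends F f A -> mtends F g A.
Proof.
move=> fg fA i j; apply: tends_near (fA i j).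
by apply: filterS fg => x ->.
Qed.

Lemma mtends_eq m n (f : T -> 'M[K]_(m, n)) A B : mtends F f A -> A = B -> mtends F f B.
Proof. by move=> ? <-. Qed.

Lemma mtends_unique m n (f : T -> 'M[K]_(m, n)) A B : mtends F f A -> mtends F f B -> A = B.
Proof. by move=> fA fB; apply/matrixP => i j; apply: tends_unique (fA i j) (fB i j). Qed.

Lemma det_tends n (f : T -> 'M[K]_n) A : mtends F f A -> tends F (fun x => \det (f x)) (\det A).
Proof.
move=> fA; apply: tends_sum => s; apply: tendsM; first exact: tends_cst.
by apply: tends_prod => i; apply: fA.
Qed.

Lemma invmx_tends n (f : T -> 'M[K]_n) A : \det A != 0 -> mtends F f A ->
  mtends F (fun x => (\det (f x))^-1 *: \adj (f x)) ((\det A)^-1 *: \adj A).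
Proof.
move=> dA fA; apply: mtendsZ; first by apply: tendsV => //; apply: det_tends.
move=> i j; rewrite mxE.
rewrite (_ : (fun=> _) = (fun x => cofactor (f x) j i)).
  apply: tendsM; first exact: tends_cst.
  apply: det_tends => k l; rewrite !mxE.
  rewrite (_ : (fun=> _) = (fun x => f x (lift j k) (lift i l))); first exact: fA.
  by apply/funext => x; rewrite !mxE.
by apply/funext => x; rewrite mxE.
Qed.

End MLimits.
End MatrixCalculus.

Lemma mx_bounded (R : realType) m n (X : 'M[Cplx R]_(m, n)) :
  exists2 B : R, 0 <= B & forall i j, `|X i j| <= (B%:C)%C.
Proof.
have ge0 i j : 0 <= complex.Re `|X i j| by have [y y0 ->] := normC_real (X i j).
exists (\sum_i \sum_j complex.Re `|X i j|).
  by apply: sumr_ge0 => i _; apply: sumr_ge0 => j _; apply: ge0.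
move=> i j; have [x x0 xE] := normC_real (X i j).
rewrite [`|X i j|](_ : _ = ((complex.Re `|X i j|)%:C)%C); last by rewrite xE.
rewrite lecR (bigD1 i)//= (bigD1 j)//= -addrA lerDl addr_ge0//.
  by apply: sumr_ge0 => j' _; apply: ge0.
by apply: sumr_ge0 => i' _; apply: sumr_ge0 => j' _; apply: ge0.
Qed.

Lemma mulmx_bounded (R : realType) m n p (X : 'M[Cplx R]_(m, n)) (Y : 'M[Cplx R]_(n, p)) (a b : R) :
  (forall i j, `|X i j| <= (a%:C)%C) -> (forall i j, `|Y i j| <= (b%:C)%C) ->
  forall i j, `|(X *m Y) i j| <= ((n%:R * (a * b))%:C)%C.
Proof.
move=> Xa Yb i j; rewrite mxE; apply: le_trans (ler_norm_sum _ _ _) _.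
apply: (@le_trans _ _ (\sum_(l < n) ((a * b)%:C)%C)).
  by apply: ler_sum => l _; rewrite normrM rmorphM/= ler_pM.
by rewrite sumr_const card_ord -rmorphMn/= lecR -mulr_natl.
Qed.

Section MatrixExponential.
Variable R : realType.
Local Notation C := (Cplx R).
Variable n : nat.
Variable al : 'M[C]_n.

Let pw k : 'M[C]_n := iter k (mulmx al) 1%:M.

Let pwC k : pw k *m al = al *m pw k.
Proof.
elim: k => [|k IH]; first by rewrite /pw/= mul1mx mulmx1.
by rewrite /pw/= -/(pw k) -mulmxA IH.
Qed.

Let cf i j k : C := pw k i j / k`!%:R.

Let cf_bounded : exists2 M : R, 0 <= M & forall i j, exp_bounded (cf i j) M.
Proof.
have [m m0 hm] := mx_bounded al.
exists (n%:R * m); first by rewrite mulr_ge0.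
move=> i j k; rewrite /cf normrM [`|_^-1|]ger0_norm ?invr_ge0// rmorphM/= fmorphV/= rmorph_nat.
rewrite ler_wpM2r ?invr_ge0//.
elim: k i j => [|k IH] i j.
  by rewrite /pw/= mxE expr0 rmorph1; case: (i == j); rewrite ?normr1 ?normr0.
rewrite /pw/= -/(pw k) mxE; apply: le_trans (ler_norm_sum _ _ _) _.
apply: (@le_trans _ _ (\sum_(l < n) ((m * (n%:R * m) ^+ k)%:C)%C)).
  by apply: ler_sum => l _; rewrite normrM rmorphM/= ler_pM.
by rewrite sumr_const card_ord -rmorphMn/= lecR exprS -mulrA -mulr_natl.
Qed.

Lemma mexp_exists : exists E : C -> 'M[C]_n,
  E 0 = 1%:M /\ (forall v, mder E v (al *m E v)) /\ (forall v, E v *m al = al *m E v).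
Proof.
have [M M0 hM] := cf_bounded.
have lim i j v : {l | is_ps (cf i j) v l} by apply: cid; apply: psum_cvg M0 (hM i j).
exists (fun v => \matrix_(i, j) proj1_sig (lim i j v)).
have limP i j v : is_ps (cf i j) v (proj1_sig (lim i j v)) by case: (lim i j v).
have cfS i j k : k.+1%:R * cf i j k.+1 = pw k.+1 i j / k`!%:R.
  have k0 : k.+1%:R != 0 :> C by rewrite pnatr_eq0.
  by rewrite /cf factS natrM invfM mulrCA; congr (_ * _); rewrite mulrA mulfV// mul1r.
split; [|split].
- apply/matrixP => i j; rewrite !mxE; apply: (is_ps_unique (limP i j 0)).
  have : tends \oo (fun=> (1%:M : 'M[C]_n) i j) ((1%:M : 'M[C]_n) i j) by apply: tends_cst.
  rewrite mxE; apply: tends_near; near=> k.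
  have k0 : (0 < k)%N by near: k; exact: nbhs_infty_gt.
  rewrite -(prednK k0) /psum big_ord_recl/= expr0 mulr1 big1 ?addr0; last first.
    by move=> l _; rewrite expr0n/= mulr0.
  by rewrite /cf/pw/= fact0 divr1 mxE.
- move=> v i j; rewrite (_ : (fun=> _) = (fun x => proj1_sig (lim i j x))); last first.
    by apply/funext => x; rewrite mxE.
  rewrite mxE; under eq_bigr do rewrite mxE.
  apply: (@ps_hasder _ (cf i j) (fun k => \sum_l al i l * cf l j k) M _
    (fun x => \sum_l al i l * proj1_sig (lim l j x))) => //.
    move=> k; rewrite cfS /pw/= -/(pw k) mxE mulr_suml.
    by apply: eq_bigr => l _; rewrite mulrA.
  by move=> w; apply: is_ps_sum.
- move=> v; apply/matrixP => i j; rewrite !mxE.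
  under eq_bigr do rewrite mxE mulrC; under [RHS]eq_bigr do rewrite mxE.
  apply: (@is_ps_unique _ (fun k => \sum_l al l j * cf i l k) v); first exact: is_ps_sum.
  rewrite (_ : (fun k => _) = (fun k => \sum_l al i l * cf l j k)); first exact: is_ps_sum.
  apply/funext => k; have /matrixP/(_ i j) := pwC k; rewrite !mxE => E.
  rewrite /cf; under eq_bigr do rewrite mulrA [al _ _ * _]mulrC.
  by rewrite -mulr_suml E mulr_suml; apply: eq_bigr => l _; rewrite mulrA.
Unshelve. all: by end_near. Qed.

End MatrixExponential.

Section MexpTheory.
Variable R : realType.
Local Notation C := (Cplx R).

Lemma mder0_const m n (f : C -> 'M[C]_(m, n)) (a b : C) :
  (forall z, mder f z 0) -> f a = f b.
Proof.
move=> H; apply/matrixP => i j; apply: (@der0_const R (fun x => f x i j)) => z.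
by have := H z i j; rewrite mxE.
Qed.

Lemma mder_opp m n (f : C -> 'M[C]_(m, n)) (z : C) D : mder f (- z) D ->
  mder (fun x => f (- x)) z (- D).
Proof.
move=> fD i j; rewrite mxE -mulN1r.
rewrite (_ : (fun=> _) = (fun x => f (-1 * x) i j)).
  by apply: (@hasder_scale _ (fun x => f x i j)); rewrite mulN1r.
by apply/funext => x; rewrite mulN1r.
Qed.

Lemma mder_shift m n (f : C -> 'M[C]_(m, n)) (z a : C) D : mder f (z + a) D ->
  mder (fun x => f (x + a)) z D.
Proof. by move=> fD i j; apply: (@hasder_shift _ (fun x => f x i j)). Qed.

Definition is_mexp n (al : 'M[C]_n) (E : C -> 'M[C]_n) :=
  [/\ E 0 = 1%:M, forall v, mder E v (al *m E v) & forall v, E v *m al = al *m E v].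

Variables (n : nat) (al : 'M[C]_n) (E : C -> 'M[C]_n).
Hypothesis EP : is_mexp al E.

Lemma mexp_comm B v : B *m al = al *m B -> B *m E v = E v *m B.
Proof.
case: EP => E0 dE Eal Bal.
have H (x y : C) : E (- x) *m B *m E x = E (- y) *m B *m E y.
  apply: (@mder0_const _ _ (fun v => E (- v) *m B *m E v)) => {x y}z.
  apply: mder_eq.
    exact: mderM (mderM (mder_opp (dE (- z))) (mder_cst B z)) (dE z).
  rewrite mulmx0 addr0 !mulNmx -(Eal (- z)) -!mulmxA (mulmxA al B) -Bal.
  by rewrite -mulmxA addNr.
have K (u : C) : E (- u) *m E u = 1%:M.
  have K' (x y : C) : E (- x) *m E x = E (- y) *m E y.
    apply: (@mder0_const _ _ (fun v => E (- v) *m E v)) => {x y}z.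
    apply: mder_eq; first exact: mderM (mder_opp (dE (- z))) (dE z).
    by rewrite !mulNmx -(Eal (- z)) -!mulmxA addNr.
  by rewrite (K' u 0) oppr0 E0 mulmx1.
have := H v 0; rewrite oppr0 E0 mul1mx mulmx1 => HB.
by rewrite -{2}HB 2!mulmxA -{2}[v]opprK K mul1mx.
Qed.

Lemma mexp_opp v : E v *m E (- v) = 1%:M.
Proof.
case: EP => E0 dE Eal.
have K' (w u : C) : E w *m E (- w) = E u *m E (- u).
  apply: (@mder0_const _ _ (fun v => E v *m E (- v))) => {w u}z.
  apply: mder_eq; first exact: mderM (dE z) (mder_opp (dE (- z))).
  by rewrite mulmxN mulmxA Eal subrr.
by rewrite (K' v 0) oppr0 E0 mulmx1.
Qed.

Lemma mexpN v : E (- v) *m E v = 1%:M.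
Proof. by rewrite -{2}[v]opprK mexp_opp. Qed.

Lemma mexp_add v w : E (v + w) = E v *m E w.
Proof.
case: EP => E0 dE Eal.
have K' (x y : C) : E (x + w) *m E (- x) = E (y + w) *m E (- y).
  apply: (@mder0_const _ _ (fun v => E (v + w) *m E (- v))) => {x y}z.
  apply: mder_eq.
    by apply: mderM (mder_opp (dE (- z))); apply: mder_shift (dE _).
  by rewrite mulmxN mulmxA Eal subrr.
have := K' v 0; rewrite oppr0 E0 mulmx1 add0r => H.
have -> : E v *m E w = E w *m E v by apply/esym/mexp_comm; rewrite Eal.
by rewrite -H -mulmxA mexpN mulmx1.
Qed.

End MexpTheory.

Section LinearSystems.
Variables (K : numFieldType) (T : Type) (F : set_system T).
Context {FF : ProperFilter F}.

Lemma linsys_cvg n m (M : T -> 'M[K]_(n, m)) M0 (b : T -> 'rV[K]_m) b0 (x : T -> 'rV[K]_n) :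
  mtends F M M0 -> mtends F b b0 -> (forall y : 'rV_n, y *m M0 = 0 -> y = 0) ->
  (\forall t \near F, x t *m M t = b t) -> exists x0, mtends F x x0.
Proof.
move=> MM bb M0inj xM.
have M0V : M0 *m pinvmx M0 = 1%:M.
  apply: mulmxVp; rewrite -kermx_eq0; apply/eqP/row_matrixP => i.
  by rewrite row0; apply: M0inj; rewrite -row_mul mulmx_ker row0.
pose D t := M t *m pinvmx M0.
have Dt : mtends F D 1%:M.
  by rewrite -M0V; apply: mtendsM => //; apply: mtends_cst.
have d1 : tends F (fun t => \det (D t)) 1 by rewrite -(det1 K n); apply: det_tends.
have Dn0 : \forall t \near F, \det (D t) != 0.
  exact: tends_neq0 d1.
exists (b0 *m pinvmx M0 *m ((\det (1%:M : 'M[K]_n))^-1 *: \adj 1%:M)).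
apply: (@mtends_near _ _ _ _ _ _ (fun t => b t *m pinvmx M0 *m ((\det (D t))^-1 *: \adj (D t)))).
  apply: filterS2 xM Dn0 => t <- dn0.
  rewrite -mulmxA -(mulmxA (x t)) (mulmxA (M t)) -/(D t) -scalemxAr mul_mx_adj.
  by rewrite scale_scalar_mx mulVf// mulmx1.
apply: mtendsM; first by apply: mtendsM => //; apply: mtends_cst.
by apply: invmx_tends => //; rewrite det1 oner_eq0.
Qed.

Lemma linear_sum_delta (N m n : nat) (g : 'M[K]_N -> 'M[K]_(m, n)) X i j : linear g ->
  g X i j = \sum_a mxvec X 0 a * g (vec_mx (delta_mx 0 a)) i j.
Proof.
move=> lg.
pose G0 := GRing.isLinear.Build K 'M[K]_N 'M[K]_(m, n) *:%R g lg.
pose G : {linear 'M[K]_N -> 'M[K]_(m, n)} := HB.pack g G0.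
rewrite -{1}[X]mxvecK {1}(row_sum_delta (mxvec X)) linear_sum/=.
rewrite -[g]/(G : _ -> _) linear_sum summxE.
by apply: eq_bigr => a _; rewrite !linearZ !mxE.
Qed.

Lemma linsys_cvg_mx N (J : finType) (g : T -> J -> 'M[K]_N -> 'M[K]_N) g0
    (b : T -> J -> 'M[K]_N) b0 (S : T -> 'M[K]_N) :
  (forall t s, linear (g t s)) -> (forall s, linear (g0 s)) ->
  (forall s X, mtends F (fun t => g t s X) (g0 s X)) ->
  (forall s, mtends F (fun t => b t s) (b0 s)) ->
  (forall X, (forall s, g0 s X = 0) -> X = 0) ->
  (\forall t \near F, forall s, g t s (S t) = b t s) -> exists S0, mtends F S S0.
Proof.
move=> lg lg0 gg bb g0inj gS.
pose e (q : 'I_#|{: J * 'I_N * 'I_N}|) := enum_val q.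
pose M (h : J -> 'M[K]_N -> 'M[K]_N) : 'M[K]_(N * N, _) :=
  \matrix_(a, q) h (e q).1.1 (vec_mx (delta_mx 0 a)) (e q).1.2 (e q).2.
pose B (c : J -> 'M[K]_N) : 'rV[K]_#|{: J * 'I_N * 'I_N}| :=
  \row_q c (e q).1.1 (e q).1.2 (e q).2.
have ME h X : (forall s, linear (h s)) -> mxvec X *m M h = B (h^~ X).
  move=> lh; apply/rowP => q; rewrite !mxE (linear_sum_delta _ _ _ (lh _)).
  by apply: eq_bigr => a _; rewrite mxE.
have [||y hy|| x0 hx] := @linsys_cvg _ _ (fun t => M (g t)) (M g0)
    (fun t => B (b t)) (B b0) (mxvec \o S).
- move=> i j; rewrite mxE.
  rewrite (_ : (fun=> _) = (fun t => g t (e j).1.1 (vec_mx (delta_mx 0 i)) (e j).1.2 (e j).2)).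
    exact: gg.
  by apply/funext => t; rewrite mxE.
- move=> i j; rewrite mxE.
  rewrite (_ : (fun=> _) = (fun t => b t (e j).1.1 (e j).1.2 (e j).2)); first exact: bb.
  by apply/funext => t; rewrite mxE.
- rewrite -[y]vec_mxK; apply/eqP; rewrite mxvec_eq0; apply/eqP/g0inj => s.
  move: hy; rewrite -[y]vec_mxK ME// vec_mxK => /rowP hy.
  apply/matrixP => i j; have := hy (enum_rank (s, i, j)).
  by rewrite !mxE /e enum_rankK.
- apply: filterS gS => t gS /=; rewrite ME//.
  by apply/rowP => q; rewrite !mxE gS.
exists (vec_mx x0) => i j; rewrite mxE.
rewrite (_ : (fun=> _) = (fun t => (mxvec \o S) t 0 (mxvec_index i j))); first exact: hx.
by apply/funext => t /=; rewrite mxvecE.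
Qed.

End LinearSystems.

Section PolyFun.
Variable R : realType.
Local Notation C := (Cplx R).

Lemma nearCP (z : C) (P : C -> Prop) : (\forall w \near z, P w) <->
  exists2 e : R, 0 < e & forall w, `|w - z| < (e%:C)%C -> P w.
Proof.
split.
  case/nbhs_ballP => e /= e0 H; exists (complex.Re e).
    by rewrite -ltcR RRe_real// gtr0_real.
  by move=> w; rewrite RRe_real ?gtr0_real// distrC => hw; apply: H.
case=> e e0 H; apply/nbhs_ballP; exists (e%:C)%C; first by rewrite /= ltcR.
by move=> w hw; apply: H; rewrite distrC.
Qed.

Lemma dnearCP (z : C) (P : C -> Prop) : (\forall w \near z^', P w) <->
  exists2 e : R, 0 < e & forall w, 0 < `|w - z| < (e%:C)%C -> P w.
Proof.
split.
  move=> /nearCP[e e0 H]; exists e => // w /andP[w0 we]; apply: H => //.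
  by apply: contraTneq w0 => ->; rewrite subrr normr0 ltxx.
case=> e e0 H; apply/nearCP; exists e => // w we wz; apply: H.
by rewrite we normr_gt0 subr_eq0 wz.
Qed.

Definition polyfun (f : C -> C) : Prop := exists p : {poly C}, forall x, f x = p.[x].

Lemma polyfun_cst c : polyfun (fun=> c).
Proof. by exists c%:P => x; rewrite hornerC. Qed.

Lemma polyfun_id : polyfun id.
Proof. by exists 'X => x; rewrite hornerX. Qed.

Lemma polyfunD f g : polyfun f -> polyfun g -> polyfun (fun x => f x + g x).
Proof. by case=> p hp [q hq]; exists (p + q) => x; rewrite hornerD hp hq. Qed.

Lemma polyfunN f : polyfun f -> polyfun (fun x => - f x).
Proof. by case=> p hp; exists (- p) => x; rewrite hornerN hp. Qed.

Lemma polyfunB f g : polyfun f -> polyfun g -> polyfun (fun x => f x - g x).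
Proof. by move=> hf hg; apply: polyfunD => //; apply: polyfunN. Qed.

Lemma polyfunM f g : polyfun f -> polyfun g -> polyfun (fun x => f x * g x).
Proof. by case=> p hp [q hq]; exists (p * q) => x; rewrite hornerM hp hq. Qed.

Lemma polyfun_sum (I : Type) (s : seq I) (f : I -> C -> C) :
  (forall i, polyfun (f i)) -> polyfun (fun x => \sum_(i <- s) f i x).
Proof.
move=> H; elim: s => [|i s IH].
  rewrite (_ : (fun=> _) = (fun=> 0)); first exact: polyfun_cst.
  by apply/funext => x; rewrite big_nil.
rewrite (_ : (fun=> _) = (fun x => f i x + \sum_(j <- s) f j x)); first exact: polyfunD.
by apply/funext => x; rewrite big_cons.
Qed.

Lemma polyfun_prod (I : Type) (s : seq I) (f : I -> C -> C) :
  (forall i, polyfun (f i)) -> polyfun (fun x => \prod_(i <- s) f i x).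
Proof.
move=> H; elim: s => [|i s IH].
  rewrite (_ : (fun=> _) = (fun=> 1)); first exact: polyfun_cst.
  by apply/funext => x; rewrite big_nil.
rewrite (_ : (fun=> _) = (fun x => f i x * \prod_(j <- s) f j x)); first exact: polyfunM.
by apply/funext => x; rewrite big_cons.
Qed.

Lemma polyfun_comp f g : polyfun f -> polyfun g -> polyfun (fun x => f (g x)).
Proof. by case=> p hp [q hq]; exists (p \Po q) => x; rewrite horner_comp hp hq. Qed.

Lemma poly_near0 (p : {poly C}) (z : C) (eps : R) :
  0 < eps -> (forall x, 0 < `|x - z| < (eps%:C)%C -> p.[x] = 0) -> p = 0.
Proof.
move=> eps0 H; apply: contraTeq isT => p0.
pose u (k : nat) : C := z + ((eps / k.+2%:R)%:C)%C.
have uI : injective u.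
  move=> k l /addrI/complexI/(mulfI (lt0r_neq0 eps0))/invr_inj/eqP.
  by rewrite eqr_nat eqSS eqSS => /eqP.
have := @max_poly_roots _ p [seq u k | k <- iota 0 (size p)] p0.
rewrite size_map size_iota ltnn map_inj_uniq ?iota_uniq// => H'.
suff : all (root p) [seq u k | k <- iota 0 (size p)] by move=> /H'/(_ isT).
apply/allP => _ /mapP[k _ ->]; apply/eqP/H.
rewrite /u addrAC subrr add0r.
have k0 : 0 < eps / k.+2%:R by rewrite divr_gt0.
rewrite normCR gtr0_norm// !ltcR k0/= ltr_pdivrMr// ltr_pMr// ltr1n//.
Qed.

Lemma polyfun_eq0 f (eps : R) : polyfun f -> 0 < eps ->
  (forall x, 0 < `|x| < (eps%:C)%C -> f x = 0) -> forall x, f x = 0.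
Proof.
case=> p hp eps0 H x; rewrite hp (@poly_near0 p 0 eps)// ?horner0// => y.
by rewrite subr0 -hp => /H.
Qed.

Lemma hasder_poly (p : {poly C}) z : hasder (horner p) z p^`().[z].
Proof.
elim/poly_ind: p => [|p c IH].
  rewrite deriv0 horner0 (_ : horner _ = fun=> 0); first exact: hasder_cst.
  by apply/funext => x; rewrite horner0.
rewrite (_ : horner _ = (fun x => p.[x] * x + c)); last first.
  by apply/funext => x; rewrite hornerMXaddC.
apply: hasder_eq; first exact: (hasderD (hasderM IH (hasder_id z)) (hasder_cst c z)).
by rewrite derivD derivM derivX derivC hornerD hornerD hornerM hornerX hornerC hornerM hornerC addr0.
Qed.

Lemma poly_near_neq0 (p : {poly C}) (z : C) : p != 0 -> \forall w \near z^', p.[w] != 0.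
Proof.
move=> p0; have [k [q]] := multiplicity_XsubC p z; rewrite p0/= => qz pE.
have qw : \forall x \near z, q.[x] != 0.
  exact: (tends_neq0 qz (hasder_tends (hasder_poly q z))).
case/nearCP: qw => e e0 qw; apply/dnearCP; exists e => // w /andP[w0 we].
rewrite pE hornerM mulf_neq0 ?qw//.
by rewrite horner_exp hornerXsubC expf_neq0// -normr_gt0.
Qed.

Lemma hasder_polyfun f z : polyfun f -> exists d, hasder f z d.
Proof.
case=> p hp; exists p^`().[z]; rewrite (_ : f = horner p); first exact: hasder_poly.
exact/funext.
Qed.

End PolyFun.

(** * Tensors in coordinates *)

Section TensorCoordinates.
Variables (R : realType) (N : nat).
Local Notation C := (Cplx R).
Local Notation A := ('M[C]_N).
Local Notation AA := (tens2 R N).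
Local Notation AAA := (tens3 R N).
Implicit Types (s t : AA) (a b : A).

(* The coefficient of [delta_mx i j *t delta_mx k l]: row indices come first. *)
Definition co t (i k j l : 'I_N) : C := t (mxtens_index (i, k)) (mxtens_index (j, l)).

Definition mkt (f : 'I_N -> 'I_N -> 'I_N -> 'I_N -> C) : AA :=
  \matrix_(x, y) f (mxtens_unindex x).1 (mxtens_unindex x).2
                   (mxtens_unindex y).1 (mxtens_unindex y).2.

Definition co3 (T : AAA) (i1 i2 i3 j1 j2 j3 : 'I_N) : C :=
  T (mxtens_index (mxtens_index (i1, i2), i3)) (mxtens_index (mxtens_index (j1, j2), j3)).

Lemma co_mkt f i k j l : co (mkt f) i k j l = f i k j l.
Proof. by rewrite /co mxE !mxtens_indexK. Qed.

Lemma coP s t : (forall i k j l, co s i k j l = co t i k j l) -> s = t.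
Proof.
move=> H; apply/matrixP => x y.
by case: (mxtens_indexP x) => i k; case: (mxtens_indexP y) => j l; apply: H.
Qed.

Lemma co3P (S T : AAA) : (forall i1 i2 i3 j1 j2 j3, co3 S i1 i2 i3 j1 j2 j3 = co3 T i1 i2 i3 j1 j2 j3) -> S = T.
Proof.
move=> H; apply/matrixP => x y.
case: (mxtens_indexP x) => x12 i3; case: (mxtens_indexP y) => y12 j3.
case: (mxtens_indexP x12) => i1 i2; case: (mxtens_indexP y12) => j1 j2.
exact: H.
Qed.

Lemma coD s t i k j l : co (s + t) i k j l = co s i k j l + co t i k j l.
Proof. by rewrite /co mxE. Qed.
Lemma coN t i k j l : co (- t) i k j l = - co t i k j l.
Proof. by rewrite /co mxE. Qed.
Lemma coB s t i k j l : co (s - t) i k j l = co s i k j l - co t i k j l.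
Proof. by rewrite coD coN. Qed.
Lemma coZ c t i k j l : co (c *: t) i k j l = c * co t i k j l.
Proof. by rewrite /co mxE. Qed.
Lemma co_tens a b i k j l : co (a *t b) i k j l = a i j * b k l.
Proof. by rewrite /co tensmxE. Qed.

Lemma sum_mxtens (m n : nat) (F : 'I_(m * n) -> C) :
  \sum_x F x = \sum_i \sum_j F (mxtens_index (i, j)).
Proof.
rewrite pair_big/= (reindex (fun p : 'I_m * 'I_n => mxtens_index p))/=; last first.
  by exists (@mxtens_unindex m n) => x _; rewrite ?mxtens_indexK ?mxtens_unindexK.
by apply: eq_bigr => -[i j].
Qed.

Lemma coM s t i k j l : co (s *m t) i k j l = \sum_p \sum_q co s i k p q * co t p q j l.
Proof. by rewrite /co mxE sum_mxtens. Qed.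

Lemma mxtens_index_eq (m n : nat) (i i' : 'I_m) (j j' : 'I_n) :
  (mxtens_index (i, j) == mxtens_index (i', j')) = (i == i') && (j == j').
Proof. by rewrite (can_eq (@mxtens_indexK _ _)) xpair_eqE. Qed.

Lemma co1 i k j l : co 1%:M i k j l = (i == j)%:R * (k == l)%:R.
Proof. by rewrite /co mxE mxtens_index_eq -natrM mulnb. Qed.

Lemma sumDr (n : nat) (f : 'I_n -> C) i : \sum_p f p * (i == p)%:R = f i.
Proof.
rewrite (bigD1 i)//= eqxx mulr1 big1 ?addr0// => p pi.
by rewrite eq_sym (negbTE pi) mulr0.
Qed.

Lemma sumDl (n : nat) (f : 'I_n -> C) i : \sum_p f p * (p == i)%:R = f i.
Proof. by under eq_bigr do rewrite eq_sym; rewrite sumDr. Qed.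

Lemma sumD'r (n : nat) (f : 'I_n -> C) i : \sum_p (i == p)%:R * f p = f i.
Proof. by under eq_bigr do rewrite mulrC; rewrite sumDr. Qed.

Lemma sumD'l (n : nat) (f : 'I_n -> C) i : \sum_p (p == i)%:R * f p = f i.
Proof. by under eq_bigr do rewrite mulrC; rewrite sumDl. Qed.

Lemma sum4 (f : 'I_N -> 'I_N -> 'I_N -> 'I_N -> C) i j k l (c : C) :
  \sum_i' \sum_j' \sum_k' \sum_l' f i' j' k' l' *
     (((i == i')%:R * (j == j')%:R) * ((k == k')%:R * (l == l')%:R) * c) = f i j k l * c.
Proof.
rewrite -(sumDr (fun i' => f i' j k l * c) i); apply: eq_bigr => i' _.
rewrite -(sumDr (fun j' => f i' j' k l * c) j) mulr_suml; apply: eq_bigr => j' _.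
rewrite -(sumDr (fun k' => f i' j' k' l * c) k) !mulr_suml; apply: eq_bigr => k' _.
rewrite -(sumDr (fun l' => f i' j' k' l' * c) l) !mulr_suml; apply: eq_bigr => l' _.
ring.
Qed.

Lemma co3_leg12 t i1 i2 i3 j1 j2 j3 :
  co3 (leg12 t) i1 i2 i3 j1 j2 j3 = co t i1 i2 j1 j2 * (i3 == j3)%:R.
Proof.
rewrite -(sum4 (fun i j k l => co t i k j l)) /co3 /leg12 /tens_lift.
do 4 (rewrite summxE; apply: eq_bigr => ? _).
by rewrite mxE !tensmxE !mxE -!mulnb !natrM.
Qed.

Lemma co3_leg13 t i1 i2 i3 j1 j2 j3 :
  co3 (leg13 t) i1 i2 i3 j1 j2 j3 = co t i1 i3 j1 j3 * (i2 == j2)%:R.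
Proof.
rewrite -(sum4 (fun i j k l => co t i k j l)) /co3 /leg13 /tens_lift.
do 4 (rewrite summxE; apply: eq_bigr => ? _).
by rewrite mxE !tensmxE !mxE -!mulnb !natrM mulrAC.
Qed.

Lemma co3_leg23 t i1 i2 i3 j1 j2 j3 :
  co3 (leg23 t) i1 i2 i3 j1 j2 j3 = co t i2 i3 j2 j3 * (i1 == j1)%:R.
Proof.
rewrite -(sum4 (fun i j k l => co t i k j l)) /co3 /leg23 /tens_lift.
do 4 (rewrite summxE; apply: eq_bigr => ? _).
by rewrite mxE !tensmxE !mxE -!mulnb !natrM /co; ring.
Qed.

Lemma co_flip t i k j l : co (flip t) i k j l = co t k i l j.
Proof.
rewrite -[RHS]mulr1 -(sum4 (fun i j k l => co t i k j l)) /co /flip /tens_lift.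
do 4 (rewrite summxE; apply: eq_bigr => ? _).
by rewrite mxE !tensmxE !mxE -!mulnb !natrM mulr1 /co; ring.
Qed.

Lemma contractE (f : A -> C) t k l :
  Defs.contract f t k l = \sum_i \sum_j co t i k j l * f (delta_mx i j).
Proof.
rewrite /Defs.contract /tens_lift.
do 2 (rewrite summxE; apply: eq_bigr => ? _).
rewrite -(sumDr (fun k' => co t _ k' _ l * f (delta_mx _ _)) k).
rewrite summxE; apply: eq_bigr => k' _.
rewrite -(sumDr (fun l' => co t _ k' _ l' * f (delta_mx _ _)) l) mulr_suml.
rewrite summxE; apply: eq_bigr => l' _.
by rewrite !mxE -!mulnb !natrM /co; ring.
Qed.

Lemma co3M (S T : AAA) i1 i2 i3 j1 j2 j3 : co3 (S *m T) i1 i2 i3 j1 j2 j3 =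
  \sum_p \sum_q \sum_u co3 S i1 i2 i3 p q u * co3 T p q u j1 j2 j3.
Proof. by rewrite /co3 mxE sum_mxtens sum_mxtens. Qed.

Lemma co3D (S T : AAA) i1 i2 i3 j1 j2 j3 : co3 (S + T) i1 i2 i3 j1 j2 j3 =
  co3 S i1 i2 i3 j1 j2 j3 + co3 T i1 i2 i3 j1 j2 j3.
Proof. by rewrite /co3 mxE. Qed.
Lemma co3N (S : AAA) i1 i2 i3 j1 j2 j3 : co3 (- S) i1 i2 i3 j1 j2 j3 =
  - co3 S i1 i2 i3 j1 j2 j3.
Proof. by rewrite /co3 mxE. Qed.
Lemma co3Z c (S : AAA) i1 i2 i3 j1 j2 j3 : co3 (c *: S) i1 i2 i3 j1 j2 j3 =
  c * co3 S i1 i2 i3 j1 j2 j3.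
Proof. by rewrite /co3 mxE. Qed.

Lemma co3_12_13 s t i1 i2 i3 j1 j2 j3 : co3 (leg12 s *m leg13 t) i1 i2 i3 j1 j2 j3 =
  \sum_p co s i1 i2 p j2 * co t p i3 j1 j3.
Proof.
rewrite co3M; apply: eq_bigr => p _.
rewrite -(sumDl (fun q => co s i1 i2 p q * co t p i3 j1 j3) j2); apply: eq_bigr => q _.
rewrite -(sumDr (fun u => co s i1 i2 p q * co t p u j1 j3) i3) mulr_suml.
by apply: eq_bigr => u _; rewrite co3_leg12 co3_leg13; ring.
Qed.

Lemma co3_13_12 s t i1 i2 i3 j1 j2 j3 : co3 (leg13 s *m leg12 t) i1 i2 i3 j1 j2 j3 =
  \sum_p co s i1 i3 p j3 * co t p i2 j1 j2.
Proof.
rewrite co3M; apply: eq_bigr => p _.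
rewrite -(sumDr (fun q => co s i1 i3 p j3 * co t p q j1 j2) i2); apply: eq_bigr => q _.
rewrite -(sumDl (fun u => co s i1 i3 p u * co t p q j1 j2) j3) mulr_suml.
by apply: eq_bigr => u _; rewrite co3_leg12 co3_leg13; ring.
Qed.

Lemma co3_23_12 s t i1 i2 i3 j1 j2 j3 : co3 (leg23 s *m leg12 t) i1 i2 i3 j1 j2 j3 =
  \sum_p co s i2 i3 p j3 * co t i1 p j1 j2.
Proof.
rewrite co3M -(sumDr (fun p' => \sum_p co s i2 i3 p j3 * co t p' p j1 j2) i1).
apply: eq_bigr => p _; rewrite mulr_suml; apply: eq_bigr => q _.
rewrite -(sumDl (fun u => co s i2 i3 q u * co t p q j1 j2) j3) mulr_suml.
by apply: eq_bigr => u _; rewrite co3_leg12 co3_leg23; ring.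
Qed.

Lemma co3_12_23 s t i1 i2 i3 j1 j2 j3 : co3 (leg12 s *m leg23 t) i1 i2 i3 j1 j2 j3 =
  \sum_p co s i1 i2 j1 p * co t p i3 j2 j3.
Proof.
rewrite co3M -(sumDl (fun p' => \sum_p co s i1 i2 p' p * co t p i3 j2 j3) j1).
apply: eq_bigr => p _; rewrite mulr_suml; apply: eq_bigr => q _.
rewrite -(sumDr (fun u => co s i1 i2 p q * co t q u j2 j3) i3) mulr_suml.
by apply: eq_bigr => u _; rewrite co3_leg12 co3_leg23; ring.
Qed.

Lemma co3_13_23 s t i1 i2 i3 j1 j2 j3 : co3 (leg13 s *m leg23 t) i1 i2 i3 j1 j2 j3 =
  \sum_p co s i1 i3 j1 p * co t i2 p j2 j3.
Proof.
rewrite co3M -(sumDl (fun p' => \sum_p co s i1 i3 p' p * co t i2 p j2 j3) j1).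
apply: eq_bigr => p _.
rewrite -(sumDr (fun q => (\sum_u co s i1 i3 p u * co t q u j2 j3) * (p == j1)%:R) i2).
apply: eq_bigr => q _; rewrite !mulr_suml.
by apply: eq_bigr => u _; rewrite co3_leg13 co3_leg23; ring.
Qed.

Lemma co3_23_13 s t i1 i2 i3 j1 j2 j3 : co3 (leg23 s *m leg13 t) i1 i2 i3 j1 j2 j3 =
  \sum_p co s i2 i3 j2 p * co t i1 p j1 j3.
Proof.
rewrite co3M -(sumDr (fun p' => \sum_p co s i2 i3 j2 p * co t p' p j1 j3) i1).
apply: eq_bigr => p _.
rewrite -(sumDl (fun q => (\sum_u co s i2 i3 q u * co t p u j1 j3) * (i1 == p)%:R) j2).
apply: eq_bigr => q _; rewrite !mulr_suml.
by apply: eq_bigr => u _; rewrite co3_leg13 co3_leg23; ring.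
Qed.

Lemma leg12M s t : leg12 (s *m t) = leg12 s *m leg12 t.
Proof.
apply: co3P => i1 i2 i3 j1 j2 j3; rewrite co3_leg12 co3M coM mulr_suml.
apply: eq_bigr => p _; rewrite mulr_suml; apply: eq_bigr => q _.
rewrite -(sumDr (fun u => co s i1 i2 p q * co t p q j1 j2 * (u == j3)%:R) i3).
by apply: eq_bigr => u _; rewrite !co3_leg12; ring.
Qed.

Lemma leg13M s t : leg13 (s *m t) = leg13 s *m leg13 t.
Proof.
apply: co3P => i1 i2 i3 j1 j2 j3; rewrite co3_leg13 co3M coM mulr_suml.
apply: eq_bigr => p _.
rewrite -(sumDr (fun q => (\sum_u co s i1 i3 p u * co t p u j1 j3) * (q == j2)%:R) i2).
apply: eq_bigr => q _; rewrite !mulr_suml; apply: eq_bigr => u _.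
by rewrite !co3_leg13; ring.
Qed.

Lemma leg23M s t : leg23 (s *m t) = leg23 s *m leg23 t.
Proof.
apply: co3P => i1 i2 i3 j1 j2 j3; rewrite co3_leg23 co3M coM.
rewrite -(sumDr (fun p => (\sum_q \sum_u co s i2 i3 q u * co t q u j2 j3) * (p == j1)%:R) i1).
apply: eq_bigr => p _; rewrite !mulr_suml; apply: eq_bigr => q _.
by rewrite !mulr_suml; apply: eq_bigr => u _; rewrite !co3_leg23; ring.
Qed.

Lemma leg12_lin c s t : leg12 (c *: s + t) = c *: leg12 s + leg12 t.
Proof. by apply: co3P => *; rewrite co3D co3Z !co3_leg12 coD coZ; ring. Qed.
Lemma leg13_lin c s t : leg13 (c *: s + t) = c *: leg13 s + leg13 t.
Proof. by apply: co3P => *; rewrite co3D co3Z !co3_leg13 coD coZ; ring. Qed.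
Lemma leg23_lin c s t : leg23 (c *: s + t) = c *: leg23 s + leg23 t.
Proof. by apply: co3P => *; rewrite co3D co3Z !co3_leg23 coD coZ; ring. Qed.

Lemma leg12_tens a b : leg12 (a *t b) = a *t b *t (1%:M : A).
Proof. by apply: co3P => *; rewrite co3_leg12 co_tens /co3 !tensmxE mxE. Qed.
Lemma leg13_tens a b : leg13 (a *t b) = a *t (1%:M : A) *t b.
Proof. by apply: co3P => *; rewrite co3_leg13 co_tens /co3 !tensmxE mxE mulrAC. Qed.
Lemma leg23_tens a b : leg23 (a *t b) = (1%:M : A) *t a *t b.
Proof. by apply: co3P => *; rewrite co3_leg23 co_tens /co3 !tensmxE mxE mulrC mulrA. Qed.

Lemma flipM s t : flip (s *m t) = flip s *m flip t.
Proof.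
apply: coP => i k j l; rewrite co_flip !coM exchange_big/=.
by apply: eq_bigr => p _; apply: eq_bigr => q _; rewrite !co_flip.
Qed.

Lemma flip_lin c s t : flip (c *: s + t) = c *: flip s + flip t.
Proof. by apply: coP => *; rewrite coD coZ !co_flip coD coZ. Qed.

Lemma flip_tens a b : flip (a *t b) = b *t a.
Proof. by apply: coP => *; rewrite co_flip !co_tens mulrC. Qed.

Lemma flipK t : flip (flip t) = t.
Proof. by apply: coP => *; rewrite !co_flip. Qed.

Definition blk t (i j : 'I_N) : A := \matrix_(k, l) co t i k j l.

Lemma nondeg_inj t : Defs.nondegenerate [set: A] t -> forall F : 'I_N -> 'I_N -> C,
  (forall k l, \sum_i \sum_j F i j * co t i k j l = 0) -> forall i j, F i j = 0.
Proof.
case=> _ Hinj _ F HF i j.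
pose f (X : A) : C^o := \sum_i \sum_j F i j * X i j.
have lf : linear f.
  move=> c X Y; rewrite /f /GRing.scale/= mulr_sumr -big_split/=; apply: eq_bigr => p _.
  by rewrite mulr_sumr -big_split/=; apply: eq_bigr => q _; rewrite !mxE; ring.
pose f0 := GRing.isLinear.Build C A C^o *:%R f lf.
pose fL : {linear A -> C^o} := HB.pack f f0.
have fd p q : f (delta_mx p q) = F p q.
  rewrite /f -(sumDl (fun i => F i q) p); apply: eq_bigr => i' _.
  rewrite -(sumDl (fun j => F i' j) q) mulr_suml; apply: eq_bigr => j' _.
  by rewrite mxE -mulnb natrM; ring.
rewrite -fd; apply: (Hinj fL) => //.
apply/matrixP => k l; rewrite contractE mxE -[RHS](HF k l).
by apply: eq_bigr => p _; apply: eq_bigr => q _; rewrite -fd mulrC.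
Qed.

Lemma nondeg_surj t : Defs.nondegenerate [set: A] t -> forall Y : A,
  exists F : 'I_N -> 'I_N -> C, forall k l, \sum_i \sum_j F i j * co t i k j l = Y k l.
Proof.
case=> _ _ Hs Y; have [f fY] := Hs Y I.
exists (fun i j => f (delta_mx i j)) => k l; rewrite -fY contractE.
by apply: eq_bigr => p _; apply: eq_bigr => q _; rewrite mulrC.
Qed.

End TensorCoordinates.

(** * The Riccati equation *)

Section Algebra.
Variables (R : realType) (N : nat).
Hypothesis N0 : (0 < N)%N.
Local Notation C := (Cplx R).
Local Notation A := ('M[C]_N).
Local Notation AA := (tens2 R N).
Implicit Types (s t : AA).

Lemma NC0 : (N%:R : C) != 0. Proof. by rewrite pnatr_eq0 -lt0n. Qed.

Lemma central_scalar (X : A) : (forall Y : A, X *m Y = Y *m X) -> X = (\tr X / N%:R)%:M.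
Proof.
move=> H.
have E i j k l : X i k * (l == j)%:R = (i == k)%:R * X l j.
  have /matrixP/(_ i j) := H (delta_mx k l); rewrite !mxE.
  under eq_bigr do rewrite mxE; under [X in _ = X]eq_bigr do rewrite mxE.
  rewrite (bigD1 k)//= eqxx/= [X in _ + X]big1 ?addr0; last first.
    by move=> p /negbTE ->; rewrite mulr0.
  rewrite [X in _ = X](bigD1 l)//= eqxx/= andbT [X in _ + X]big1 ?addr0; last first.
    by move=> p /negbTE ->; rewrite andbF mul0r.
  by rewrite eq_sym.
apply/matrixP => i j; rewrite mxE.
have -> : \tr X / N%:R = X j j.
  rewrite /mxtrace (eq_bigr (fun=> X j j)); last first.
    by move=> k _; have := E k j k j; rewrite !eqxx mulr1 mul1r.
  by rewrite sumr_const card_ord -[X in X / _]mulr_natr mulfK// NC0.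
have := E i j j j; rewrite eqxx mulr1 => ->.
by rewrite mulr_natl.
Qed.

Definition tsl t (a b : 'I_N) : A := \matrix_(k, l) co t a k l b.

Definition quad s t (a b i j : 'I_N) : A :=
  \matrix_(k, l) \sum_p co s i a p l * co t p k j b.

Lemma nondeg_comm t (X : A) : Defs.nondegenerate [set: A] t ->
  (forall i j, X *m blk t i j = blk t i j *m X) -> X = (\tr X / N%:R)%:M.
Proof.
move=> nt H; apply: central_scalar => Y.
have [F HF] := nondeg_surj nt Y.
have -> : Y = \sum_i \sum_j F i j *: blk t i j.
  apply/matrixP => k l; rewrite -HF summxE; apply: eq_bigr => i _.
  by rewrite summxE; apply: eq_bigr => j _; rewrite !mxE.
rewrite mulmx_sumr mulmx_suml; apply: eq_bigr => i _.
rewrite mulmx_sumr mulmx_suml; apply: eq_bigr => j _.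
by rewrite -scalemxAr -scalemxAl H.
Qed.

(* If the quadratic part of the AYBE were an inner derivation of the second
   factor, it would vanish on the functional that r sends to 1. *)
Lemma nondeg_no_inner t : Defs.nondegenerate [set: A] t ->
  (forall a b, exists X : A, forall i j,
     X *m blk t i j - blk t i j *m X = quad t t a b i j) -> False.
Proof.
move=> nt H; have [F HF] := nondeg_surj nt 1%:M.
have F1 : \sum_i \sum_j F i j *: blk t i j = 1%:M.
  apply/matrixP => k l; rewrite -HF summxE; apply: eq_bigr => i _.
  by rewrite summxE; apply: eq_bigr => j _; rewrite !mxE.
have FQ a b : \sum_i \sum_j F i j *: quad t t a b i j = 0.
  have [X HX] := H a b.
  transitivity (X *m (\sum_i \sum_j F i j *: blk t i j) -
                (\sum_i \sum_j F i j *: blk t i j) *m X).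
    rewrite mulmx_sumr mulmx_suml -sumrB; apply: eq_bigr => i _.
    rewrite mulmx_sumr mulmx_suml -sumrB; apply: eq_bigr => j _.
    by rewrite -HX scalerBr -scalemxAr -scalemxAl.
  by rewrite F1 mulmx1 mul1mx subrr.
have K0 k b i p : \sum_j F i j * co t p k j b = 0.
  apply: (nondeg_inj nt (F := fun i p => \sum_j F i j * co t p k j b)) => a l.
  have /matrixP/(_ k l) := FQ a b; rewrite [RHS]mxE summxE; apply: etrans.
  apply: eq_bigr => i' _; rewrite summxE.
  under eq_bigr do rewrite mulr_suml.
  rewrite exchange_big/=; apply: eq_bigr => j _.
  by rewrite !mxE mulr_sumr; apply: eq_bigr => p' _; ring.
have Fz i j : F i j = 0.
  have := nondeg_inj nt (F := fun p j => (p == i)%:R * F i j) _ i j.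
  rewrite eqxx mul1r; apply => k b.
  apply: etrans (K0 k b i i).
  rewrite -(sumD'l (fun p => \sum_j F i j * co t p k j b) i).
  by apply: eq_bigr => p _; rewrite mulr_sumr; apply: eq_bigr => j' _; rewrite mulrA.
have := F1; rewrite big1 => [|i _]; last first.
  by rewrite big1// => j _; rewrite Fz scale0r.
move=> /matrixP/(_ (Ordinal N0) (Ordinal N0)); rewrite !mxE eqxx => /eqP.
by rewrite eq_sym oner_eq0.
Qed.

End Algebra.

Section LocalSolution.
Variables (R : realType) (N : nat).
Hypothesis N0 : (0 < N)%N.
Local Notation C := (Cplx R).
Local Notation A := ('M[C]_N).
Local Notation AA := (tens2 R N).

Lemma hasder_quot (K : numFieldType) (f : K -> K) z d : hasder f z d ->
  tends (0 : K)^' (fun h => (f (z + h) - f z) / h) d.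
Proof.
move=> /hasderP H; apply/tendsP => e e0; have [del del0 hd] := H e e0.
apply/nbhs_ballP; exists del => //= h; rewrite /ball/= sub0r normrN => hh h0.
rewrite -(ler_pM2r (x := `|h|)) ?normr_gt0// -normrM mulrBl divfK// -normrN opprB.
exact: hd.
Qed.

Lemma tends_comp (K : numFieldType) (T : Type) (F : set_system T) (f : T -> K) (g : K -> K) a b :
  tends F f a -> tends (nbhs a) g b -> tends F (g \o f) b.
Proof. by move=> fa gb; apply: cvg_comp fa gb. Qed.

Lemma tends_dnbhs (K : numFieldType) (f : K -> K) z a : tends (nbhs z) f a -> tends z^' f a.
Proof. by move=> fa; apply: cvg_within_filter. Qed.

Lemma tends_shift (K : numFieldType) (f : K -> K) z a : tends (nbhs z) f a ->
  tends (0 : K)^' (fun h => f (z + h)) a.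
Proof.
move=> fa; apply: (@tends_comp _ _ _ (fun h => z + h) f z) fa.
apply: tends_dnbhs.
apply: (@tends_eq _ _ _ _ (z + 0)); last by rewrite addr0.
apply: tendsD; first exact: tends_cst.
exact: cvg_id.
Qed.

Lemma near_forall2 (K : numFieldType) (z : K) (I J : finType) (P : I -> J -> K -> Prop) :
  (forall i j, \forall w \near z, P i j w) -> \forall w \near z, forall i j, P i j w.
Proof.
move=> H.
refine (@filter_forall K I (fun i w => forall j, P i j w) (nbhs z) _ _) => i.
by refine (@filter_forall K J (P i) (nbhs z) _ _) => j; apply: H.
Qed.

Lemma holo_der m n (f : C -> 'M[C]_(m, n)) z : holomorphic_at f z ->
  \forall w \near z, exists D, mder f w D.
Proof.
move=> H.
have := near_forall2 H.
apply: filterS => w hw; exists (\matrix_(i, j) 'D_1 (fun x => f x i j : C^o) w) => i j.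
by rewrite mxE; split => //; apply: hw.
Qed.

Lemma der_holo m n (f : C -> 'M[C]_(m, n)) z :
  (\forall w \near z, exists D, mder f w D) -> holomorphic_at f z.
Proof.
by move=> H i j; apply: filterS H => w [D HD]; case: (HD i j).
Qed.


Lemma mder_invpow_scale m n (g : C -> 'M[C]_(m, n)) (z w : C) (k : nat) D : w != z ->
  mder g w D -> exists D', mder (fun x => ((x - z) ^+ k)^-1 *: g x) w D'.
Proof.
move=> wz gD.
have [d hd] : exists d, hasder (fun x : C => (x - z) ^+ k) w d.
  apply: hasder_polyfun; exists (('X - z%:P) ^+ k) => x.
  by rewrite horner_exp hornerXsubC.
have wk : (w - z) ^+ k != 0 by rewrite expf_neq0// subr_eq0.
by eexists; exact: (mderZ (@hasderV _ (fun x => (x - z) ^+ k) _ _ wk hd) gD).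
Qed.

Lemma dball_open (z w : C) (e : R) : 0 < `|w - z| < (e%:C)%C ->
  \forall x \near w, 0 < `|x - z| < (e%:C)%C.
Proof.
have [a a0 aE] := normC_real (w - z); rewrite aE !ltcR => /andP[{}a0 ae].
apply/nearCP; exists (Num.min a (e - a)); first by rewrite lt_min a0 subr_gt0.
move=> x xw.
have [x1 x2] : `|x - w| < (a%:C)%C /\ `|x - w| < ((e - a)%:C)%C.
  by split; apply: lt_le_trans xw _; rewrite lecR ge_min lexx ?orbT.
apply/andP; split.
  rewrite normr_gt0; apply: contraTneq x1 => /subr0_eq ->.
  by rewrite distrC aE ltxx.
rewrite (_ : x - z = (x - w) + (w - z)); last by rewrite addrA subrK.
apply: le_lt_trans (ler_normD _ _) _; rewrite aE.
have -> : e = (e - a) + a by rewrite subrK.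
by rewrite rmorphD/= ltrD2r.
Qed.

Lemma mder_near m n (f g : C -> 'M[C]_(m, n)) z D : (\forall x \near z, f x = g x) ->
  mder f z D -> mder g z D.
Proof.
move=> fg fD i j; apply: hasder_near (fD i j).
by apply: filterS fg => x ->.
Qed.

Section Regular.
Variables (U : set C) (r : C -> AA).
Hypotheses (Uo : open U) (rm : meromorphic_on U r).
Local Notation reg := (regular_pt U r).

Definition rd (v : C) : AA := \matrix_(x, y) 'D_1 (fun w => r w x y : C^o) v.

Lemma reg_der v : reg v -> mder r v (rd v).
Proof.
case=> _ hv x y; rewrite mxE; split => //.
exact: (nbhs_singleton (hv x y)).
Qed.

Lemma reg_open v : reg v -> \forall w \near v, reg w.
Proof.
case=> Uv /holo_der hv.
have H1 : \forall w \near v, U w by apply: open_nbhs_nbhs.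
have H2 := near_join hv.
by apply: filterS2 H1 H2 => w Uw hw; split => //; apply: der_holo.
Qed.

Lemma reg_generic z : U z -> \forall w \near z^', reg w.
Proof.
move=> Uz; have [k [g [/holo_der gz rg]]] := rm Uz.
case/nearCP: gz => e1 e10 H1; case/dnearCP: rg => e2 e20 H2.
have /nearCP[e3 e30 H3] : \forall w \near z, U w by apply: open_nbhs_nbhs.
pose e := Num.min e1 (Num.min e2 e3).
have e0 : 0 < e by rewrite !lt_min e10 e20.
have lt_e (x : C) : x < (e%:C)%C -> [/\ x < (e1%:C)%C, x < (e2%:C)%C & x < (e3%:C)%C].
  move=> xe; have ce t : e <= t -> x < (t%:C)%C by move=> et; apply: lt_le_trans xe _; rewrite lecR.
  by split; apply: ce; rewrite !ge_min lexx ?orbT.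
apply/dnearCP; exists e => // w /andP[w0 we]; have [w1 w2 w3] := lt_e _ we.
split; first exact: H3.
have inv : \forall x \near w, 0 < `|x - z| < (e%:C)%C.
  by apply: dball_open; rewrite w0.
apply: der_holo; apply: filterS inv => x /andP[x0 xe]; have [x1 x2 x3] := lt_e _ xe.
have [D gD] := H1 _ x1.
have xz : x != z by rewrite -subr_eq0 -normr_gt0.
have [D' HD'] := mder_invpow_scale k xz gD.
exists D'; apply: mder_near HD'.
have : \forall y \near x, 0 < `|y - z| < (e%:C)%C by apply: dball_open; rewrite x0.
apply: filterS => y /andP[y0 ye]; have [_ y2 _] := lt_e _ ye.
rewrite -H2 ?y0// scalerA mulVf ?scale1r// expf_neq0//.
by rewrite -normr_gt0.
Qed.

End Regular.
End LocalSolution.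

Section RiccatiAtZero.
Variables (R : realType) (N : nat).
Hypothesis N0 : (0 < N)%N.
Local Notation C := (Cplx R).
Local Notation A := ('M[C]_N).
Local Notation AA := (tens2 R N).
Variables (U : set C) (r : C -> AA).
Hypotheses (Uo : open U) (U0 : U 0) (hr : nondegenerate_unitary_AYBE_solution U r).
Local Notation reg := (regular_pt U r).

Let rm : meromorphic_on U r. Proof. by case: hr => -[]. Qed.

Lemma local_ball : exists2 eps : R, 0 < eps &
  forall z, 0 < `|z| < (eps%:C)%C -> reg z /\ Defs.nondegenerate [set: A] (r z).
Proof.
have /dnearCP[e1 e10 H1] := reg_generic Uo rm U0.
have /dnearCP[e2 e20 H2] := hr.2 _ U0.
exists (Num.min e1 e2); first by rewrite lt_min e10.
move=> z /andP[z0 ze]; split; [apply: H1|apply: H2]; rewrite subr0 z0/=.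
  by apply: lt_le_trans ze _; rewrite lecR ge_min lexx.
by apply: lt_le_trans ze _; rewrite lecR ge_min lexx orbT.
Qed.

Lemma co3_AYBE (X Y Z : tens3 R N) i1 i2 i3 j1 j2 j3 : co3 (X - Y + Z) i1 i2 i3 j1 j2 j3 =
  co3 X i1 i2 i3 j1 j2 j3 - co3 Y i1 i2 i3 j1 j2 j3 + co3 Z i1 i2 i3 j1 j2 j3.
Proof. by rewrite co3D co3D co3N. Qed.

Lemma co30 i1 i2 i3 j1 j2 j3 : co3 (0 : tens3 R N) i1 i2 i3 j1 j2 j3 = 0.
Proof. by rewrite /co3 mxE. Qed.

Lemma AYBE_coord v v' a b i j : reg v -> reg v' -> reg (v + v') ->
  tsl (r v') a b *m blk (r v) i j - blk (r (v + v')) i j *m tsl (r v') a b =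
  quad (r v) (r (v + v')) a b i j.
Proof.
move=> hv hv' hw; case: hr => -[_ AY _] _.
apply/matrixP => k l.
have aux (x y z X Y Z o : C) : o = x - y + z -> o = 0 -> x = X -> y = Y -> z = Z -> X + Z = Y.
  move=> -> h <- <- <-; apply/eqP; rewrite -subr_eq0 -h; apply/eqP; ring.
have E := AY _ _ hv hv' hw.
have E2 := co3_AYBE (leg12 (r v) *m leg13 (r (v + v'))) (leg23 (r v') *m leg12 (r v))
  (leg13 (r (v + v')) *m leg23 (r v')) i a k j l b.
rewrite E in E2.
have H := aux _ _ _ _ _ _ _ E2 (co30 _ _ _ _ _ _) (co3_12_13 _ _ _ _ _ _ _ _)
  (co3_23_12 _ _ _ _ _ _ _ _) (co3_13_23 _ _ _ _ _ _ _ _).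
rewrite !mxE; apply/eqP; rewrite subr_eq; apply/eqP.
have -> : \sum_p tsl (r v') a b k p * blk (r v) i j p l =
    \sum_p co (r v') a k p b * co (r v) i p j l by apply: eq_bigr => p _; rewrite !mxE.
rewrite -H; congr (_ + _).
by apply: eq_bigr => p _; rewrite !mxE.
Qed.

Lemma blk_der v i j : reg v -> mder (fun w => blk (r w) i j) v (blk (rd r v) i j).
Proof.
move=> /reg_der hv k l; rewrite mxE.
rewrite (_ : (fun=> _) = (fun w => r w (mxtens_index (i, k)) (mxtens_index (j, l)))).
  exact: hv.
by apply/funext => w; rewrite mxE.
Qed.

Lemma blk_tends v i j : reg v -> mtends (nbhs v) (fun w => blk (r w) i j) (blk (r v) i j).
Proof. by move=> hv; apply: mder_tends (blk_der i j hv). Qed.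

Lemma co_tends v i k j l : reg v -> tends (nbhs v) (fun w => co (r w) i k j l) (co (r v) i k j l).
Proof. by move=> hv; apply: (mder_tends (reg_der hv)). Qed.

Lemma quad_tends (T : Type) (F : set_system T) {FF : ProperFilter F} (f g : T -> AA) s t a b i j :
  (forall i k j l, tends F (fun x => co (f x) i k j l) (co s i k j l)) ->
  (forall i k j l, tends F (fun x => co (g x) i k j l) (co t i k j l)) ->
  mtends F (fun x => quad (f x) (g x) a b i j) (quad s t a b i j).
Proof.
move=> fs gt k l; rewrite mxE.
rewrite (_ : (fun=> _) = (fun x => \sum_p co (f x) i a p l * co (g x) p k j b)).
  by apply: tends_sum => p; apply: tendsM.
by apply/funext => x; rewrite mxE.
Qed.

Variable eps : R.
Hypotheses (eps0 : 0 < eps)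
  (ball : forall z, 0 < `|z| < (eps%:C)%C -> reg z /\ Defs.nondegenerate [set: A] (r z)).

Let regb z : 0 < `|z| < (eps%:C)%C -> reg z. Proof. by case/ball. Qed.

Lemma subr_swap (V : zmodType) (a b c d : V) : a - c = b - d -> a - b = c - d.
Proof.
move=> H; rewrite -[a](subrK c) H.
by rewrite addrAC [b - d - b]addrAC subrr sub0r addrC.
Qed.

Definition inner_at (al : A) v :=
  forall i j, blk (rd r v) i j = al *m blk (r v) i j - blk (r v) i j *m al.

Lemma not_inner_ball (al : A) :
  (forall v, 0 < `|v| < (eps%:C)%C -> inner_at al v) -> False.
Proof.
move=> H; have [E EP] := mexp_exists al; have {}EP : is_mexp al E.
  by case: EP => ? [? ?]; split.
have [E0 dE Eal] := EP.
pose v1 : C := ((eps / 2)%:C)%C.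
have v1n : `|v1| = v1 by rewrite normCR gtr0_norm// divr_gt0.
have ray (s : R) : 0 < s <= 1 -> 0 < `|(s%:C)%C * v1| < (eps%:C)%C.
  move=> /andP[s0 s1]; rewrite normrM v1n normCR gtr0_norm// -rmorphM/= !ltcR.
  rewrite mulr_gt0// ?divr_gt0//= mulrCA gtr_pMr// ltr_pdivrMr// mul1r.
  by apply: le_lt_trans s1 _; rewrite ltr1n.
pose q v i j := E (- v) *m blk (r v) i j *m E v.
have qd v i j : 0 < `|v| < (eps%:C)%C -> mder (fun x => q x i j) v 0.
  move=> hv; apply: mder_eq.
    exact: mderM (mderM (mder_opp (dE (- v))) (blk_der i j (regb hv))) (dE v).
  rewrite (H _ hv) mulNmx -(Eal (- v)) mulmxBr !mulmxDl !mulNmx !mulmxA.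
  by rewrite addKr addNr.
have qc (s : R) i j : 0 < s <= 1 -> q ((s%:C)%C * v1) i j = q v1 i j.
  move=> sI; apply/matrixP => k l.
  have := @der0_ray R (fun x => q x i j k l) v1 s 1.
  rewrite rmorph1 mul1r; apply => //; last by rewrite ltr01 lexx.
  by move=> x xI; have := qd _ i j (ray _ xI) k l; rewrite mxE.
have blkE (s : R) i j : 0 < s <= 1 ->
    blk (r ((s%:C)%C * v1)) i j = E ((s%:C)%C * v1) *m q v1 i j *m E (- ((s%:C)%C * v1)).
  move=> sI; rewrite -(qc s)// /q !mulmxA (mexp_opp EP) mul1mx -mulmxA (mexp_opp EP).
  by rewrite mulmx1.
have sv1 : tends (0 : R)^'+ (fun s => (s%:C)%C * v1) 0.
  rewrite -(mul0r v1); apply: tendsM; last exact: tends_cst.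
  apply/tendsP => e e_gt0; have eE : e = ((complex.Re e)%:C)%C by rewrite RRe_real// gtr0_real.
  have re0 : 0 < complex.Re e by rewrite -ltcR -eE.
  near=> s; rewrite sub0r normrN normCR eE lecR gtr0_norm; last by near: s; exact: nbhs_right_gt.
  by apply: ltW; near: s; exact: nbhs_right_lt.
have comp m n (f : C -> 'M[C]_(m, n)) X (g : R -> C) z : mtends (nbhs z) f X ->
    tends (0 : R)^'+ g z -> mtends (0 : R)^'+ (fun s => f (g s)) X.
  by move=> fX gz k l; apply: tends_comp gz (fX k l).
have Elim : mtends (0 : R)^'+ (fun s => E ((s%:C)%C * v1)) 1%:M.
  by rewrite -E0; apply: comp sv1; apply: mder_tends (dE 0).
have Elim' : mtends (0 : R)^'+ (fun s => E (- ((s%:C)%C * v1))) 1%:M.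
  rewrite -E0; apply: (comp _ _ E _ (fun s : R => - ((s%:C)%C * v1)) (- 0)); last exact: tendsN.
  by rewrite oppr0; apply: mder_tends (dE 0).
have blim i j : mtends (0 : R)^'+ (fun s => blk (r ((s%:C)%C * v1)) i j) (q v1 i j).
  apply: (@mtends_near _ _ _ _ _ _ (fun s => E ((s%:C)%C * v1) *m q v1 i j *m E (- ((s%:C)%C * v1)))).
    near=> s; rewrite blkE//; apply/andP; split; first by near: s; exact: nbhs_right_gt.
    by apply: ltW; near: s; exact: nbhs_right_lt.
  apply: (@mtends_eq _ _ _ _ _ _ (1%:M *m q v1 i j *m 1%:M)); last by rewrite mul1mx mulmx1.
  apply: mtendsM; last exact: Elim'.
  apply: mtendsM; first exact: Elim.
  exact: mtends_cst.
pose v : C := ((1 / 2)%:C)%C * v1.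
have half01 : 0 < (1 / 2 : R) <= 1 by apply/andP; split; lra.
have vb : 0 < `|v| < (eps%:C)%C by apply: ray.
apply: (nondeg_no_inner N0 (ball vb).2) => a b.
exists (\matrix_(k, l) q v1 a l k b) => i j.
have Slim : mtends (0 : R)^'+ (fun s => tsl (r ((s%:C)%C * v1)) a b) (\matrix_(k, l) q v1 a l k b).
  move=> k l; rewrite mxE.
  rewrite (_ : (fun=> _) = (fun s => blk (r ((s%:C)%C * v1)) a l k b)); first exact: blim.
  by apply/funext => s; rewrite !mxE.
have vlim : tends (0 : R)^'+ (fun s => v + (s%:C)%C * v1) v.
  apply: (@tends_eq _ _ _ _ (v + 0)); last by rewrite addr0.
  apply: tendsD sv1; exact: tends_cst.
have rv := regb vb.
have Q1 : mtends (0 : R)^'+ (fun s => quad (r v) (r (v + (s%:C)%C * v1)) a b i j)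
    (quad (r v) (r v) a b i j).
  apply: quad_tends => *; first exact: tends_cst.
  by apply: (tends_comp (f := fun s : R => v + (s%:C)%C * v1) (g := fun w => co (r w) _ _ _ _) vlim); apply: co_tends.
have Q2 : mtends (0 : R)^'+ (fun s => quad (r v) (r (v + (s%:C)%C * v1)) a b i j)
    ((\matrix_(k, l) q v1 a l k b) *m blk (r v) i j - blk (r v) i j *m (\matrix_(k, l) q v1 a l k b)).
  apply: (@mtends_near _ _ _ _ _ _ (fun s => tsl (r ((s%:C)%C * v1)) a b *m blk (r v) i j -
    blk (r (v + (s%:C)%C * v1)) i j *m tsl (r ((s%:C)%C * v1)) a b)).
    near=> s; have s0 : 0 < s by near: s; exact: nbhs_right_gt.
    have s1 : s < 1 / 2 by near: s; apply: nbhs_right_lt; lra.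
    apply: AYBE_coord; first exact: rv.
      by apply/regb/ray; apply/andP; split; lra.
    by rewrite /v -mulrDl -rmorphD; apply/regb/ray; apply/andP; split; lra.
  apply: mtendsB; apply: mtendsM; [exact: Slim | exact: mtends_cst | | exact: Slim].
  apply: (comp _ _ (fun w => blk (r w) i j) _ (fun s : R => v + (s%:C)%C * v1) v); last exact: vlim.
  exact: blk_tends.
exact: (mtends_unique Q2 Q1).
Unshelve. all: by end_near. Qed.

Lemma no_common_inner : exists v1 v2, [/\ 0 < `|v1| < (eps%:C)%C, 0 < `|v2| < (eps%:C)%C &
  forall al, inner_at al v1 -> inner_at al v2 -> False].
Proof.
apply: contrapT => Hno.
pose v1 : C := ((eps / 2)%:C)%C.
have v1b : 0 < `|v1| < (eps%:C)%C.
  rewrite normCR gtr0_norm ?divr_gt0// !ltcR divr_gt0//=.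
  by rewrite ltr_pdivrMr// ltr_pMr// ltr1n.
have ex v : 0 < `|v| < (eps%:C)%C -> exists al, inner_at al v1 /\ inner_at al v.
  move=> vb; apply: contrapT => Hal; apply: Hno; exists v1, v; split => // al a1 av.
  by apply: Hal; exists al.
have [al [al1 _]] := ex _ v1b.
apply: (@not_inner_ball al) => v vb; have [be [be1 bev]] := ex _ vb.
have comm i j : (be - al) *m blk (r v1) i j = blk (r v1) i j *m (be - al).
  have E : be *m blk (r v1) i j - blk (r v1) i j *m be = al *m blk (r v1) i j - blk (r v1) i j *m al.
    exact: etrans (esym (be1 i j)) (al1 i j).
  by rewrite mulmxBl mulmxBr; apply: subr_swap.
have /(nondeg_comm N0 (ball v1b).2) X := comm.
move=> i j; rewrite bev.
have -> : be = al + (be - al) by rewrite addrC subrK.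
rewrite X mulmxDl mulmxDr mul_scalar_mx mul_mx_scalar opprD addrACA subrr addr0 //.
Qed.

End RiccatiAtZero.

Section Riccati.
Variables (R : realType) (N : nat).
Hypothesis N0 : (0 < N)%N.
Local Notation C := (Cplx R).
Local Notation A := ('M[C]_N).
Local Notation AA := (tens2 R N).

Definition trn (X : A) : C := \tr X / N%:R.
Definition tf (X : A) : A := X - (trn X)%:M.

Lemma trn_lin c X Y : trn (c *: X + Y) = c * trn X + trn Y.
Proof. by rewrite /trn linearD linearZ/= mulrDl mulrA. Qed.

Lemma trn_scalar c : trn c%:M = c.
Proof. by rewrite /trn mxtrace_scalar -[X in X / _]mulr_natr mulfK// NC0. Qed.

Lemma tf_lin c X Y : tf (c *: X + Y) = c *: tf X + tf Y.
Proof.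
rewrite /tf trn_lin scalerBr -!addrA; congr (_ + _).
by rewrite raddfD/= opprD addrCA scale_scalar_mx.
Qed.

Lemma tf_scalar c : tf c%:M = 0.
Proof. by rewrite /tf trn_scalar subrr. Qed.

Lemma tr_tf X : \tr (tf X) = 0.
Proof.
rewrite /tf linearB/= mxtrace_scalar /trn -[X in _ - X]mulr_natr divfK ?subrr//.
exact: NC0.
Qed.

Lemma tfK X : tf X + (trn X)%:M = X. Proof. by rewrite subrK. Qed.

Lemma trn_tf X : trn (tf X) = 0. Proof. by rewrite /trn tr_tf mul0r. Qed.

Lemma trn_tends (T : Type) (F : set_system T) {FF : ProperFilter F} (f : T -> A) X :
  mtends F f X -> tends F (fun x => trn (f x)) (trn X).
Proof.
move=> fX; apply: tendsM; last exact: tends_cst.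
by apply: tends_sum => i; apply: fX.
Qed.

Lemma mtends_scalar (K : numFieldType) (T : Type) (F : set_system T) {FF : ProperFilter F} n (f : T -> K) x :
  tends F f x -> mtends F (fun t => (f t)%:M : 'M[K]_n) x%:M.
Proof.
move=> fx i j; rewrite mxE; under eq_fun do rewrite mxE.
case: (i == j); first exact: fx.
exact: tends_cst.
Qed.

Lemma tf_tends (T : Type) (F : set_system T) {FF : ProperFilter F} (f : T -> A) X :
  mtends F f X -> mtends F (fun x => tf (f x)) (tf X).
Proof.
by move=> fX; apply: mtendsB; [exact: fX | apply: mtends_scalar; exact: trn_tends].
Qed.

Lemma mder_quot (K : numFieldType) m n (f : K -> 'M[K]_(m, n)) z d : mder f z d ->
  mtends (0 : K)^' (fun h => h^-1 *: (f (z + h) - f z)) d.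
Proof.
move=> fd i j.
rewrite (_ : (fun=> _) = (fun h => (f (z + h) i j - f z i j) / h)); first exact: (hasder_quot (fd i j)).
by apply/funext => h; rewrite !mxE mulrC.
Qed.

Lemma mtends_shift (K : numFieldType) m n (f : K -> 'M[K]_(m, n)) z A : mtends (nbhs z) f A ->
  mtends (0 : K)^' (fun h => f (z + h)) A.
Proof. by move=> fA i j; apply: (@tends_shift _ (fun x => f x i j)) (fA i j). Qed.

Lemma tends_near_shift (z : C) (P : C -> Prop) : (\forall w \near z, P w) ->
  \forall h \near (0 : C)^', P (z + h).
Proof.
case/nearCP => e e0 H; apply/dnearCP; exists e => // h; rewrite subr0 => /andP[_ he].
by apply: H; rewrite addrAC subrr add0r.
Qed.

Variables (U : set C) (r : C -> AA).
Hypotheses (Uo : open U) (U0 : U 0) (hr : nondegenerate_unitary_AYBE_solution U r).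
Local Notation reg := (regular_pt U r).

(* [h * trn] isolates the residue of the slice, which is a multiple of the
   identity, and [tf] its regular part. *)
Definition regpart (a b : 'I_N) (h : C) : A :=
  tf (tsl (r h) a b) + (h * trn (tsl (r h) a b))%:M.

Definition regpart_op (v : C) i j (h : C) (X : A) : A :=
  tf X *m blk (r v) i j - blk (r (v + h)) i j *m tf X
    - trn X *: (h^-1 *: (blk (r (v + h)) i j - blk (r v) i j)).

Definition regpart_op0 (v : C) i j (X : A) : A :=
  tf X *m blk (r v) i j - blk (r v) i j *m tf X - trn X *: blk (rd r v) i j.

Lemma regpart_eq v a b i j : reg v -> \forall h \near (0 : C)^',
  regpart_op v i j h (regpart a b h) = quad (r v) (r (v + h)) a b i j.
Proof.
move=> rv.
have /dnearCP[e e0 H1] := reg_generic Uo (let: conj (And3 x _ _) _ := hr in x) U0.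
have /dnearCP[e' e'0 H2] := tends_near_shift (reg_open Uo rv).
apply/dnearCP; exists (Num.min e e'); first by rewrite lt_min e0.
move=> h /andP[h0 hh].
have h1 : reg h.
  by apply: H1; rewrite h0; apply: lt_le_trans hh _; rewrite lecR ge_min lexx.
have h2 : reg (v + h).
  by apply: H2; rewrite h0; apply: lt_le_trans hh _; rewrite lecR ge_min lexx orbT.
rewrite -(AYBE_coord hr a b i j rv h1 h2) /regpart_op /regpart.
set S := tsl (r h) a b.
have E1 : tf (tf S + (h * trn S)%:M) = tf S.
  rewrite -[tf S + _]addrC -[(h * _)%:M]scale1r tf_lin scale1r tf_scalar add0r.
  by rewrite /tf trn_tf raddf0 subr0.
have E2 : trn (tf S + (h * trn S)%:M) = h * trn S.
  by rewrite -[tf S]scale1r trn_lin trn_tf mulr0 add0r trn_scalar.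
have hn0 : h != 0 by rewrite -normr_gt0 -[h]subr0.
rewrite E1 E2 scalerA mulrAC mulfV// mul1r.
have SE : S = tf S + (trn S)%:M by rewrite tfK.
have -> : S *m blk (r v) i j = tf S *m blk (r v) i j + trn S *: blk (r v) i j.
  by rewrite {1}SE mulmxDl mul_scalar_mx.
have -> : blk (r (v + h)) i j *m S = blk (r (v + h)) i j *m tf S + trn S *: blk (r (v + h)) i j.
  by rewrite {1}SE mulmxDr mul_mx_scalar.
by rewrite scalerBr opprB opprD addrACA.
Qed.

Lemma regpart_op_tends v i j (F : C -> A) X : reg v -> mtends (0 : C)^' F X ->
  mtends (0 : C)^' (fun h => regpart_op v i j h (F h)) (regpart_op0 v i j X).
Proof.
move=> rv FX.
have yd := blk_der i j rv.
apply: mtendsB.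
  apply: mtendsB; apply: mtendsM.
  - exact: tf_tends.
  - exact: mtends_cst.
  - by apply: (@mtends_shift _ _ _ (fun w => blk (r w) i j)); apply: mder_tends yd.
  - exact: tf_tends.
apply: mtendsZ; first exact: trn_tends.
exact: (@mder_quot _ _ _ (fun w => blk (r w) i j)).
Qed.

Lemma quad_shift_tends v a b i j : reg v ->
  mtends (0 : C)^' (fun h => quad (r v) (r (v + h)) a b i j) (quad (r v) (r v) a b i j).
Proof.
move=> rv; apply: quad_tends => i' k' j' l'; first exact: tends_cst.
apply: (@tends_shift _ (fun w => co (r w) i' k' j' l')); apply: co_tends; exact: rv.
Qed.

Lemma regpart_limit v a b i j X : reg v -> mtends (0 : C)^' (regpart a b) X ->
  regpart_op0 v i j X = quad (r v) (r v) a b i j.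
Proof.
move=> rv HX.
have H1 : mtends (0 : C)^' (fun h => regpart_op v i j h (regpart a b h)) (regpart_op0 v i j X).
  exact: regpart_op_tends.
have H2 : mtends (0 : C)^' (fun h => quad (r v) (r (v + h)) a b i j) (quad (r v) (r v) a b i j).
  exact: quad_shift_tends.
have H3 : mtends (0 : C)^' (fun h => quad (r v) (r (v + h)) a b i j) (regpart_op0 v i j X).
  by apply: mtends_near H1; exact: regpart_eq.
exact: mtends_unique H3 H2.
Qed.

Lemma comm_lin (Y1 Y2 D : A) c X Y :
  tf (c *: X + Y) *m Y1 - Y2 *m tf (c *: X + Y) - trn (c *: X + Y) *: D =
  c *: (tf X *m Y1 - Y2 *m tf X - trn X *: D) + (tf Y *m Y1 - Y2 *m tf Y - trn Y *: D).
Proof.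
rewrite tf_lin trn_lin mulmxDl mulmxDr -scalemxAl -scalemxAr scalerDl -scalerA !scalerBr !opprD.
by rewrite [in RHS]addrACA [in RHS](addrACA (c *: _)) -!addrA.
Qed.

Lemma regpart_cvg a b : exists X, mtends (0 : C)^' (regpart a b) X.
Proof.
have [eps eps0 ball] := local_ball Uo U0 hr.
have [v1 [v2 [b1 b2 Hno]]] := no_common_inner N0 hr eps0 ball.
have [r1 n1] := ball _ b1; have [r2 n2] := ball _ b2.
pose vv (s : bool) := if s then v1 else v2.
have rv s : reg (vv s) by case: s; [exact: r1 | exact: r2].
apply: (@linsys_cvg_mx C C (0 : C)^' _ N (bool * 'I_N * 'I_N)%type
  (fun h s => regpart_op (vv s.1.1) s.1.2 s.2 h) (fun s => regpart_op0 (vv s.1.1) s.1.2 s.2)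
  (fun h s => quad (r (vv s.1.1)) (r (vv s.1.1 + h)) a b s.1.2 s.2)
  (fun s => quad (r (vv s.1.1)) (r (vv s.1.1)) a b s.1.2 s.2)).
- by move=> h s c X Y; apply: comm_lin.
- by move=> s c X Y; apply: comm_lin.
- by move=> s X; apply: regpart_op_tends; [exact: rv | exact: mtends_cst].
- by move=> s; apply: quad_shift_tends; exact: rv.
- move=> X HX.
  have HX' s i j : tf X *m blk (r (vv s)) i j - blk (r (vv s)) i j *m tf X =
      trn X *: blk (rd r (vv s)) i j.
    by apply/eqP; rewrite -subr_eq0; apply/eqP; apply: (HX (s, i, j)).
  have [t0|t0] := eqVneq (trn X) 0; last first.
    exfalso; apply: (Hno ((trn X)^-1 *: tf X)) => i j.
      by rewrite -scalemxAl -scalemxAr -scalerBr (HX' true) scalerA mulVf// scale1r.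
    by rewrite -scalemxAl -scalemxAr -scalerBr (HX' false) scalerA mulVf// scale1r.
  have := @nondeg_comm _ _ N0 _ (tf X) n1.
  rewrite tr_tf mul0r raddf0 => E.
  rewrite -(tfK X) t0 raddf0 addr0; apply: E => i j; apply/eqP; rewrite -subr_eq0.
  by rewrite (HX' true) t0 scale0r.
- have : \forall h \near (0 : C)^', forall s, forall q : 'I_N * 'I_N,
     regpart_op (vv s) q.1 q.2 h (regpart a b h) = quad (r (vv s)) (r (vv s + h)) a b q.1 q.2.
    refine (@filter_forall _ _ (fun s h => forall q : 'I_N * 'I_N, regpart_op (vv s) q.1 q.2 h (regpart a b h) = quad (r (vv s)) (r (vv s + h)) a b q.1 q.2) (0 : C)^' _ _) => s.
    refine (@filter_forall _ _ (fun q h => regpart_op (vv s) q.1 q.2 h (regpart a b h) = quad (r (vv s)) (r (vv s + h)) a b q.1 q.2) (0 : C)^' _ _) => q.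
    by apply: regpart_eq; exact: rv.
  by apply: filterS => h H [[s i] j]; apply: (H s (i, j)).
Qed.

Lemma regpart_tf a b h : tf (regpart a b h) = tf (tsl (r h) a b).
Proof.
rewrite /regpart -[tf _ + _]addrC -[(h * _)%:M]scale1r tf_lin scale1r tf_scalar add0r.
by rewrite /tf trn_tf raddf0 subr0.
Qed.

Lemma regpart_trn a b h : trn (regpart a b h) = h * trn (tsl (r h) a b).
Proof. by rewrite /regpart -[tf _]scale1r trn_lin trn_tf mulr0 add0r trn_scalar. Qed.

Lemma pole_tends a b X : mtends (0 : C)^' (regpart a b) X -> forall k l,
  tends (0 : C)^' (fun h => h * co (r h) a k l b) (trn X * (k == l)%:R).
Proof.
move=> HX k l.
have H1 : mtends (0 : C)^' (fun h => h *: tf (regpart a b h) + (trn (regpart a b h))%:M)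
    (0 *: tf X + (trn X)%:M).
  apply: mtendsD.
    apply: mtendsZ; last exact: tf_tends.
    by apply: tends_dnbhs; exact: cvg_id.
  by apply: mtends_scalar; exact: trn_tends.
apply: (@tends_eq _ _ _ _ ((0 *: tf X + (trn X)%:M) k l)); last first.
  by rewrite scale0r add0r mxE mulr_natr.
apply: tends_near (H1 k l); apply: nearW => h.
rewrite regpart_tf regpart_trn -scale_scalar_mx -scalerDr tfK mxE.
by congr (_ * _); rewrite mxE.
Qed.

Lemma tends_opp (f : C -> C) x : tends (0 : C)^' f x -> tends (0 : C)^' (fun h => f (- h)) x.
Proof.
move=> /tendsP fx; apply/tendsP => e e0.
have /dnearCP[d d0 H] := fx e e0.
by apply/dnearCP; exists d => // h; rewrite subr0 => hh; apply: H; rewrite subr0 normrN.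
Qed.

Theorem riccati : exists (c : C) (sg : 'I_N -> 'I_N -> A),
  [/\ c != 0, forall a b, \tr (sg a b) = 0,
    forall a k l b, tends (0 : C)^' (fun h => h * co (r h) a k l b) (c * (a == b)%:R * (k == l)%:R)
  & forall v, reg v -> forall a b i j,
      sg a b *m blk (r v) i j - blk (r v) i j *m sg a b - (c * (a == b)%:R) *: blk (rd r v) i j
        = quad (r v) (r v) a b i j].
Proof.
pose X a b := projT1 (cid (regpart_cvg a b)).
have HX a b : mtends (0 : C)^' (regpart a b) (X a b) by rewrite /X; case: cid.
pose n0 := Ordinal N0.
pose c := trn (X n0 n0).
have Hpole a k l b := @pole_tends a b (X a b) (HX a b) k l.
have Hun : \forall h \near (0 : C)^', forall i k j l, co (r (- h)) k i l j = - co (r h) i k j l.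
  have [[_ _ un] _] := hr.
  have /dnearCP[e e0 H1] := reg_generic Uo (let: conj (And3 x _ _) _ := hr in x) U0.
  apply/dnearCP; exists e => // h; rewrite subr0 => hh i k j l.
  have h1 : reg h by apply: H1; rewrite subr0.
  have h2 : reg (- h) by apply: H1; rewrite subr0 normrN.
  by rewrite -co_flip (un _ h1 h2) coN.
have tc a b : trn (X a b) = c * (a == b)%:R.
  have E i k j l : trn (X i l) * (k == j)%:R = trn (X k j) * (i == l)%:R.
    apply: (tends_unique (Hpole i k j l)).
    have := tends_opp (Hpole k i l j); apply: tends_near.
    by apply: filterS Hun => h ->; rewrite mulrNN.
  have := E a n0 n0 b; rewrite eqxx mulr1 => ->; by [].
have Ric v : reg v -> forall a b i j,
      tf (X a b) *m blk (r v) i j - blk (r v) i j *m tf (X a b) - (c * (a == b)%:R) *: blk (rd r v) i j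
        = quad (r v) (r v) a b i j.
  by move=> rv a b i j; rewrite -tc; apply: regpart_limit; [exact: rv | exact: HX].
exists c, (fun a b => tf (X a b)); split.
- have [eps eps0 ball] := local_ball Uo U0 hr.
  pose v1 : C := ((eps / 2)%:C)%C.
  have v1b : 0 < `|v1| < (eps%:C)%C.
    rewrite normCR gtr0_norm ?divr_gt0// !ltcR divr_gt0//=.
    by rewrite ltr_pdivrMr// ltr_pMr// ltr1n.
  apply/eqP => c0; apply: (nondeg_no_inner N0 (ball _ v1b).2) => a b.
  exists (tf (X a b)) => i j; rewrite -Ric; last exact: (ball _ v1b).1.
  by rewrite c0 mul0r scale0r subr0.
- by move=> a b; apply: tr_tf.
- by move=> a k l b; rewrite -tc; apply: Hpole.
- exact: Ric.
Qed.

End Riccati.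

Section TensorIdentities.
Variables (R : realType) (N : nat).
Hypothesis N0 : (0 < N)%N.
Local Notation C := (Cplx R).
Local Notation A := ('M[C]_N).
Local Notation AA := (tens2 R N).
Implicit Types (s t u : AA) (a b : A).

Lemma co_l1 a t i k j l : co ((a *t 1%:M) *m t) i k j l = \sum_p a i p * co t p k j l.
Proof.
rewrite coM; apply: eq_bigr => p _.
rewrite -(sumDr (fun q => a i p * co t p q j l) k); apply: eq_bigr => q _.
by rewrite co_tens mxE; ring.
Qed.

Lemma co_r1 a t i k j l : co (t *m (a *t 1%:M)) i k j l = \sum_p co t i k p l * a p j.
Proof.
rewrite coM; apply: eq_bigr => p _.
rewrite -(sumDl (fun q => co t i k p q * a p j) l); apply: eq_bigr => q _.
by rewrite co_tens mxE; ring.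
Qed.

Lemma co_l2 a t i k j l : co ((1%:M *t a) *m t) i k j l = \sum_p a k p * co t i p j l.
Proof.
rewrite coM -(sumDr (fun p => \sum_q a k q * co t p q j l) i); apply: eq_bigr => p _.
by rewrite mulr_suml; apply: eq_bigr => q _; rewrite co_tens mxE; ring.
Qed.

Lemma co_r2 a t i k j l : co (t *m (1%:M *t a)) i k j l = \sum_p co t i k j p * a p l.
Proof.
rewrite coM -(sumDl (fun p => \sum_q co t i k p q * a q l) j); apply: eq_bigr => p _.
by rewrite mulr_suml; apply: eq_bigr => q _; rewrite co_tens mxE; ring.
Qed.

Definition ptr1 t : A := \matrix_(k, l) \sum_i co t i k i l.
Definition ptr2 t : A := \matrix_(i, j) \sum_k co t i k j k.

(* Transposition of the second factor: it turns the product of A (x) A^op,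
   in which the Riccati equation is quadratic, into the matrix product. *)
Definition pt t : AA := mkt (fun i k j l => co t i l j k).

Lemma co_pt t i k j l : co (pt t) i k j l = co t i l j k.
Proof. exact: co_mkt. Qed.

Lemma ptK t : pt (pt t) = t.
Proof. by apply: coP => *; rewrite !co_pt. Qed.

Lemma pt_lin c s t : pt (c *: s + t) = c *: pt s + pt t.
Proof. by apply: coP => *; rewrite coD coZ !co_pt coD coZ. Qed.

Definition opmul s t : AA := pt (pt s *m pt t).

Lemma co_opmul s t i k j l : co (opmul s t) i k j l =
  \sum_p \sum_q co s i q p l * co t p k j q.
Proof.
by rewrite co_pt coM; apply: eq_bigr => p _; apply: eq_bigr => q _; rewrite !co_pt.
Qed.

Lemma flip_opmul t : flip (opmul (flip t) (flip t)) = opmul t t.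
Proof.
apply: coP => i k j l; rewrite co_flip !co_opmul exchange_big/=.
by apply: eq_bigr => p _; apply: eq_bigr => q _; rewrite !co_flip mulrC.
Qed.

Definition AYBEt s t u :=
  leg12 s *m leg13 t - leg23 u *m leg12 s + leg13 t *m leg23 u = 0.

Definition opAYBEt s t u :=
  leg13 t *m leg12 s - leg12 s *m leg23 u + leg23 u *m leg13 t = 0.

Lemma co3_sum3 (X Y Z : tens3 R N) i1 i2 i3 j1 j2 j3 : co3 (X - Y + Z) i1 i2 i3 j1 j2 j3 =
  co3 X i1 i2 i3 j1 j2 j3 - co3 Y i1 i2 i3 j1 j2 j3 + co3 Z i1 i2 i3 j1 j2 j3.
Proof. by rewrite co3D co3D co3N. Qed.

Lemma AYBEtP s t u : AYBEt s t u <-> forall i1 i2 i3 j1 j2 j3,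
  \sum_p co s i1 i2 p j2 * co t p i3 j1 j3 - \sum_p co u i2 i3 p j3 * co s i1 p j1 j2
  + \sum_p co t i1 i3 j1 p * co u i2 p j2 j3 = 0.
Proof.
have E i1 i2 i3 j1 j2 j3 :
    co3 (leg12 s *m leg13 t - leg23 u *m leg12 s + leg13 t *m leg23 u) i1 i2 i3 j1 j2 j3 =
    \sum_p co s i1 i2 p j2 * co t p i3 j1 j3 - \sum_p co u i2 i3 p j3 * co s i1 p j1 j2
    + \sum_p co t i1 i3 j1 p * co u i2 p j2 j3.
  apply: etrans (co3_sum3 _ _ _ _ _ _ _ _ _) _.
  apply: f_equal2; last exact: co3_13_23.
  by apply: f_equal2; [exact: co3_12_13 | apply: f_equal; exact: co3_23_12].
split=> [H i1 i2 i3 j1 j2 j3|H].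
  by apply: etrans (esym (E _ _ _ _ _ _)) _; rewrite H co30.
by apply: co3P => i1 i2 i3 j1 j2 j3; apply: etrans (E _ _ _ _ _ _) _; rewrite H co30.
Qed.

Lemma opAYBEtP s t u : opAYBEt s t u <-> forall i1 i2 i3 j1 j2 j3,
  \sum_p co t i1 i3 p j3 * co s p i2 j1 j2 - \sum_p co s i1 i2 j1 p * co u p i3 j2 j3
  + \sum_p co u i2 i3 j2 p * co t i1 p j1 j3 = 0.
Proof.
have E i1 i2 i3 j1 j2 j3 :
    co3 (leg13 t *m leg12 s - leg12 s *m leg23 u + leg23 u *m leg13 t) i1 i2 i3 j1 j2 j3 =
    \sum_p co t i1 i3 p j3 * co s p i2 j1 j2 - \sum_p co s i1 i2 j1 p * co u p i3 j2 j3
    + \sum_p co u i2 i3 j2 p * co t i1 p j1 j3.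
  apply: etrans (co3_sum3 _ _ _ _ _ _ _ _ _) _.
  apply: f_equal2; last exact: co3_23_13.
  by apply: f_equal2; [exact: co3_13_12 | apply: f_equal; exact: co3_12_23].
split=> [H i1 i2 i3 j1 j2 j3|H].
  by apply: etrans (esym (E _ _ _ _ _ _)) _; rewrite H co30.
by apply: co3P => i1 i2 i3 j1 j2 j3; apply: etrans (E _ _ _ _ _ _) _; rewrite H co30.
Qed.

(* Exchanging the outer factors and using unitarity. *)
Lemma AYBEt_flip s t u : AYBEt (- flip u) (- flip t) (- flip s) -> opAYBEt s t u.
Proof.
move=> /AYBEtP H; apply/opAYBEtP => i1 i2 i3 j1 j2 j3.
have aux (x y z X Y Z : C) : x - y + z = 0 -> Z = z -> Y = y -> X = x -> Z - Y + X = 0.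
  by move=> <- -> -> ->; rewrite addrC addrCA addrC.
apply: (aux _ _ _ _ _ _ (H i3 i2 i1 j3 j2 j1)).
- by apply: eq_bigr => p _; rewrite !coN !co_flip mulrNN.
- by apply: eq_bigr => p _; rewrite !coN !co_flip mulrNN.
- by apply: eq_bigr => p _; rewrite !coN !co_flip mulrNN.
Qed.

Definition CYBEt s t u :=
  mxcomm (leg12 s) (leg13 t) - mxcomm (leg23 u) (leg12 s) + mxcomm (leg13 t) (leg23 u) = 0.

Lemma sum3_sub (V : zmodType) (x y z x' y' z' : V) :
  x - y + z = 0 -> x' - y' + z' = 0 -> (x - x') - (y - y') + (z - z') = 0.
Proof.
move=> h1 h2; rewrite -[RHS](subrr 0) -{1}h1 -h2.
by rewrite !opprD !opprK !addrA; rewrite [LHS](ACl (1*3*5*2*4*6)).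
Qed.

Lemma CYBEtE s t u : AYBEt s t u -> opAYBEt s t u -> CYBEt s t u.
Proof. exact: sum3_sub. Qed.

Lemma sum3_eq (V : zmodType) (a b c : V) : a - b + c = 0 -> a = b - c.
Proof. by move/eqP; rewrite addr_eq0 subr_eq => /eqP ->; rewrite addrC. Qed.

Lemma triple_QYBE (n : nat) (x y z : 'M[C]_n) (f : C) :
  x *m y - z *m x + y *m z = 0 -> y *m x - x *m z + z *m y = 0 -> z *m z = f%:M ->
  x *m y *m z = z *m y *m x.
Proof.
move=> /sum3_eq h1 /sum3_eq h2 zz.
rewrite h1 -[RHS]mulmxA h2.
by rewrite mulmxBl -!mulmxA zz mulmxBr [z *m (z *m y)]mulmxA zz mul_mx_scalar mul_scalar_mx.
Qed.

Lemma one_plus_QYBE (n : nat) (x y z : 'M[C]_n) (c f : C) :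
  x *m y - z *m x + y *m z = 0 -> y *m x - x *m z + z *m y = 0 -> z *m z = f%:M ->
  (1%:M + c *: x) *m (1%:M + c *: y) *m (1%:M + c *: z) =
  (1%:M + c *: z) *m (1%:M + c *: y) *m (1%:M + c *: x).
Proof.
move=> h1 h2 zz; have h3 := triple_QYBE h1 h2 zz.
have E (p q s : 'M[C]_n) : (1%:M + c *: p) *m (1%:M + c *: q) *m (1%:M + c *: s) =
    1%:M + c *: (p + q + s) + c ^+ 2 *: (p *m q + p *m s + q *m s) + c ^+ 3 *: (p *m q *m s).
  have E2 : (1%:M + c *: p) *m (1%:M + c *: q) = 1%:M + c *: (p + q) + c ^+ 2 *: (p *m q).
    rewrite mulmxDl mul1mx mulmxDr mulmx1 -scalemxAl -scalemxAr scalerA -expr2 scalerDr.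
    by rewrite -!addrA; congr (_ + _); rewrite addrCA.
  rewrite E2 mulmxDr mulmx1 -scalemxAr !mulmxDl mul1mx -!scalemxAl mulmxDl.
  rewrite !scalerDr !scalerA -expr2 -exprS !addrA.
  by rewrite [LHS](ACl (1*2*3*5*4*6*7*8)).
rewrite !E h3 (_ : x + y + z = z + y + x); last by rewrite addrC (addrC x) addrA.
congr (_ + _); congr (_ + _); congr (_ *: _).
apply/eqP; rewrite -subr_eq0 -(sum3_sub h1 h2) !opprD !opprK !addrA; apply/eqP.
by rewrite [LHS](ACl (1*6*5*2*3*4)).
Qed.

End TensorIdentities.

(** * The solution near its pole *)

Section NearZero.
Variables (R : realType) (N : nat).
Hypothesis N0 : (0 < N)%N.
Local Notation C := (Cplx R).
Local Notation A := ('M[C]_N).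
Local Notation AA := (tens2 R N).
Variables (U : set C) (r : C -> AA).
Hypotheses (Uo : open U) (U0 : U 0) (hr : nondegenerate_unitary_AYBE_solution U r).
Local Notation reg := (regular_pt U r).
Variables (c : C) (sg : 'I_N -> 'I_N -> A).
Hypotheses (c0 : c != 0)
  (pole : forall a k l b, tends (0 : C)^' (fun h => h * co (r h) a k l b) (c * (a == b)%:R * (k == l)%:R))
  (Ric : forall v, reg v -> forall a b i j,
      sg a b *m blk (r v) i j - blk (r v) i j *m sg a b - (c * (a == b)%:R) *: blk (rd r v) i j
        = quad (r v) (r v) a b i j).

Definition al0 : A := \sum_a sg a a.

Lemma riccati_opmul v : reg v -> (c * N%:R) *: rd r v =
  (1%:M *t al0) *m r v - r v *m (1%:M *t al0) - opmul (r v) (r v).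
Proof.
move=> rv; apply: coP => i k j l.
rewrite coZ !coB co_l2 co_r2 co_opmul.
have H a : \sum_p sg a a k p * co (r v) i p j l - \sum_p co (r v) i k j p * sg a a p l
    - c * co (rd r v) i k j l = \sum_p co (r v) i a p l * co (r v) p k j a.
  have /matrixP/(_ k l) := Ric rv a a i j; rewrite eqxx mulr1 !mxE => H.
  rewrite -H; congr (_ - _ - _); first by apply: eq_bigr => p _; rewrite mxE.
  by apply: eq_bigr => p _; rewrite mxE.
rewrite [X in _ = _ - X]exchange_big/=.
rewrite -(eq_bigr _ (fun a _ => H a)) !sumrB.
rewrite sumr_const card_ord -[X in _ - (_ - _ - X)]mulr_natr.
have -> : \sum_p al0 k p * co (r v) i p j l = \sum_a \sum_p sg a a k p * co (r v) i p j l.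
  by rewrite exchange_big/=; apply: eq_bigr => p _; rewrite /al0 summxE mulr_suml.
have -> : \sum_p co (r v) i k j p * al0 p l = \sum_a \sum_p co (r v) i k j p * sg a a p l.
  by rewrite exchange_big/=; apply: eq_bigr => p _; rewrite /al0 summxE mulr_sumr.
ring.
Qed.

Lemma square_r v : reg v -> r v *m r v = (- c *: ptr2 (rd r v)) *t (1%:M : A).
Proof.
move=> rv; apply: coP => i a j b.
rewrite coM co_tens !mxE.
have H : \sum_k (sg a b *m blk (r v) i j - blk (r v) i j *m sg a b
    - (c * (a == b)%:R) *: blk (rd r v) i j) k k = \sum_k quad (r v) (r v) a b i j k k.
  by apply: eq_bigr => k _; rewrite Ric.
have HT : \sum_k (sg a b *m blk (r v) i j - blk (r v) i j *m sg a b
    - (c * (a == b)%:R) *: blk (rd r v) i j) k k =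
    - (c * (a == b)%:R * \sum_k co (rd r v) i k j k).
  rewrite -/(mxtrace _) !linearB/= linearZ/= mxtrace_mulC subrr sub0r; congr (- (_ * _)).
  by apply: eq_bigr => k _; rewrite mxE.
rewrite !mulNr mulrAC -HT H exchange_big/=; apply: eq_bigr => k _.
by rewrite mxE.
Qed.

Lemma tr_ptr2 (t : AA) : \tr t = \tr (ptr2 t).
Proof.
rewrite /mxtrace sum_mxtens; apply: eq_bigr => i _; rewrite mxE.
by apply: eq_bigr.
Qed.

Lemma ptr2_der v : reg v -> mder (fun w => ptr2 (r w)) v (ptr2 (rd r v)).
Proof.
move=> /reg_der rv i j; rewrite mxE.
rewrite (_ : (fun=> _) = (fun w => \sum_k r w (mxtens_index (i, k)) (mxtens_index (j, k)))).
  by apply: hasder_sum => k; apply: rv.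
by apply/funext => w; rewrite mxE.
Qed.

Lemma tr_der v : reg v -> hasder (fun w => \tr (r w)) v (\tr (rd r v)).
Proof. by move=> /reg_der rv; apply: hasder_sum => i; apply: rv. Qed.

Lemma nondeg_central t (z : A) : Defs.nondegenerate [set: A] t ->
  t *m (z *t 1%:M) = (z *t 1%:M) *m t -> z = (trn z)%:M.
Proof.
move=> nt H; apply: (central_scalar N0) => M.
suff E p q : (M *m z - z *m M) p q = 0.
  by apply/esym/eqP; rewrite -subr_eq0; apply/eqP/matrixP => p q; rewrite E mxE.
apply: (nondeg_inj nt (F := fun i j => (M *m z - z *m M) j i)) => k l.
have tr2 (X Y : A) : \sum_i \sum_j X j i * Y i j = \tr (X *m Y).
  rewrite /mxtrace exchange_big/=; apply: eq_bigr => j _; rewrite mxE.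
  by apply: eq_bigr.
pose x : A := \matrix_(i, j) co t i k j l.
have xz : x *m z = z *m x.
  apply/matrixP => i j; rewrite !mxE.
  have /(congr1 (fun T => co T i k j l)) := H; rewrite co_l1 co_r1 => E.
  apply: etrans; last first.
    apply: etrans E _.
    by apply: eq_bigr => m _; rewrite mxE.
  by apply: eq_bigr => m _; rewrite mxE.
transitivity (\tr ((M *m z - z *m M) *m x)).
  by rewrite -tr2; apply: eq_bigr => i _; apply: eq_bigr => j _; rewrite [x _ _]mxE.
by rewrite mulmxBl linearB/= -[z *m M *m x]mulmxA (mxtrace_mulC z) -!mulmxA xz subrr.
Qed.

Definition permt : AA := mkt (fun i k j l => (i == l)%:R * (k == j)%:R).

Lemma permt_sq : permt *m permt = 1%:M.
Proof.
apply: coP => i k j l; rewrite coM co1.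
rewrite -(sumDr (fun p => (i == j)%:R * (p == l)%:R) k); apply: eq_bigr => p _.
rewrite -(sumDr (fun q => (q == j)%:R * (p == l)%:R) i) mulr_suml; apply: eq_bigr => q _.
by rewrite !co_mkt; ring.
Qed.

Lemma permt_tr : \tr permt = N%:R.
Proof.
rewrite /mxtrace sum_mxtens.
transitivity (\sum_(i < N) (1 : C)); last by rewrite sumr_const card_ord.
apply: eq_bigr => i _; rewrite -(sumDr (fun=> 1) i); apply: eq_bigr => k _.
by rewrite -/(co permt i k i k) co_mkt (eq_sym k) -natrM mulnb andbb mul1r.
Qed.

Lemma pole_mtends : mtends (0 : C)^' (fun h => h *: r h) (c *: permt).
Proof.
move=> x y; case: (mxtens_indexP x) => a k; case: (mxtens_indexP y) => l b.
apply: (@tends_eq _ _ _ _ (c * (a == b)%:R * (k == l)%:R)).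
  apply: (@tends_near _ _ _ _ (fun h => h * co (r h) a k l b)); last exact: pole.
  by apply: nearW => h; rewrite mxE.
by rewrite mxE -/(co permt a k l b) co_mkt mulrA.
Qed.

Definition Sr v := \tr (r v).
Definition fr v := \tr (r v *m r v) / (N * N)%:R.

Lemma NN0 : ((N * N)%:R : C) != 0.
Proof. by rewrite pnatr_eq0 muln_eq0 negb_or -lt0n N0. Qed.

Lemma trM_tends (T : Type) (F : set_system T) {FF : ProperFilter F} (n : nat) (f : T -> 'M[C]_n) X :
  mtends F f X -> tends F (fun x => \tr (f x)) (\tr X).
Proof. by move=> fX; apply: tends_sum => i; apply: fX. Qed.

Lemma Sr_pole : tends (0 : C)^' (fun h => h * Sr h) (c * N%:R).
Proof.
apply: (@tends_eq _ _ _ _ (\tr (c *: permt))); last by rewrite linearZ/= permt_tr.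
apply: (@tends_near _ _ _ _ (fun h => \tr (h *: r h))); last exact: trM_tends pole_mtends.
by apply: nearW => h; rewrite linearZ.
Qed.

Lemma fr_pole : tends (0 : C)^' (fun h => h ^+ 2 * fr h) (c ^+ 2).
Proof.
apply: (@tends_eq _ _ _ _ (\tr ((c *: permt) *m (c *: permt)) / (N * N)%:R)); last first.
  rewrite -scalemxAl -scalemxAr permt_sq !linearZ/= mxtrace1 mulrA -expr2 mulfK//.
  exact: NN0.
apply: (@tends_near _ _ _ _ (fun h => \tr ((h *: r h) *m (h *: r h)) / (N * N)%:R)).
  apply: nearW => h; rewrite -scalemxAl -scalemxAr !linearZ/= /fr; ring.
apply: tendsM; last exact: tends_cst.
by apply: trM_tends; apply: mtendsM; exact: pole_mtends.
Qed.

Lemma square_scalar v : reg v -> Defs.nondegenerate [set: A] (r v) ->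
  r v *m r v = (fr v)%:M /\ ptr2 (rd r v) = (- fr v / c)%:M.
Proof.
move=> rv nv; have sq := square_r rv; set z := - c *: ptr2 (rd r v) in sq.
have zE : z = (trn z)%:M.
  by apply: (nondeg_central nv); rewrite -sq mulmxA.
have sq' : r v *m r v = (trn z)%:M.
  rewrite sq {1}zE; apply: coP => i k j l.
  rewrite co_tens /co !mxE mxtens_index_eq.
  by case: (i == j); rewrite /= ?mul0r// mulr_natr.
have fE : fr v = trn z.
  by rewrite /fr sq' mxtrace_scalar -[X in X / _]mulr_natr mulfK// NN0.
split; first by rewrite fE.
have -> : ptr2 (rd r v) = - c^-1 *: z by rewrite scalerA mulrNN mulVf// scale1r.
by rewrite zE -fE scale_scalar_mx mulNr mulNr mulrC.
Qed.

End NearZero.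

Section ScalarPart.
Variables (R : realType) (N : nat).
Hypothesis N0 : (0 < N)%N.
Local Notation C := (Cplx R).
Local Notation A := ('M[C]_N).
Local Notation AA := (tens2 R N).
Variables (U : set C) (r : C -> AA).
Hypotheses (Uo : open U) (U0 : U 0) (hr : nondegenerate_unitary_AYBE_solution U r).
Local Notation reg := (regular_pt U r).
Variables (c : C) (sg : 'I_N -> 'I_N -> A).
Hypotheses (c0 : c != 0)
  (pole : forall a k l b, tends (0 : C)^' (fun h => h * co (r h) a k l b) (c * (a == b)%:R * (k == l)%:R))
  (Ric : forall v, reg v -> forall a b i j,
      sg a b *m blk (r v) i j - blk (r v) i j *m sg a b - (c * (a == b)%:R) *: blk (rd r v) i j
        = quad (r v) (r v) a b i j).
Local Notation S := (Sr r).
Local Notation f := (fr r).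

Let S' v := \tr (rd r v).
Let f' v := \tr (rd r v *m r v + r v *m rd r v) / (N * N)%:R.

Let f_der v : reg v -> hasder f v (f' v).
Proof.
move=> rv; have rd := reg_der rv.
apply: hasder_eq.
  apply: hasderM; last exact: hasder_cst.
  by apply: hasder_sum => i; exact: (mderM rd rd i i).
by rewrite mulr0 addr0.
Qed.

Let S'E v : reg v -> Defs.nondegenerate [set: A] (r v) -> S' v = - (N%:R * f v / c).
Proof.
move=> rv nv; rewrite /S' tr_ptr2 (square_scalar N0 c0 Ric rv nv).2 mxtrace_scalar.
by rewrite -[LHS]mulr_natl; ring.
Qed.

Let f'E v : reg v -> (\forall w \near v, Defs.nondegenerate [set: A] (r w)) ->
  2 * f v * S' v = f' v * S v.
Proof.
move=> rv nv; have rdv := reg_der rv.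
have fM : rd r v *m r v + r v *m rd r v = (f' v)%:M.
  have H1 : mder (fun w => r w *m r w) v (rd r v *m r v + r v *m rd r v) by apply: mderM.
  have H2 : mder (fun w => r w *m r w) v (f' v)%:M.
    apply: (@mder_near _ _ _ (fun w => (f w)%:M)).
      have H3 := reg_open Uo rv.
      by apply: filterS2 H3 nv => w rw nw; rewrite (square_scalar N0 c0 Ric rw nw).1.
    move=> x y; rewrite mxE.
    rewrite (_ : (fun=> _) = (fun w => f w * (x == y)%:R)); last first.
      by apply/funext => w; rewrite mxE mulr_natr.
    apply: hasder_eq; first exact: (hasderM (f_der rv) (hasder_cst _ _)).
    by rewrite mulr0 addr0 mulr_natr.
  exact: mder_unique H1 H2.
have sq := (square_scalar N0 c0 Ric rv (nbhs_singleton nv)).1.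
have := congr1 (fun X => \tr (X *m r v)) fM; rewrite mulmxDl mul_scalar_mx linearZ/= => <-.
rewrite linearD/= -mulmxA sq mul_mx_scalar linearZ/= -mulmxA mxtrace_mulC -mulmxA sq.
by rewrite mul_mx_scalar linearZ/=; rewrite /S'; ring.
Qed.

Lemma near_form : exists2 eps : R, 0 < eps & exists2 b : A, \tr b = 0 &
  forall v, 0 < `|v| < (eps%:C)%C -> [/\ reg v, Defs.nondegenerate [set: A] (r v),
    r v *m r v = ((c / v) ^+ 2)%:M & ptr2 (r v) = N%:R *: b + (c / v)%:M].
Proof.
have [e1 e10 H1] := local_ball Uo U0 hr.
have c2 : c ^+ 2 != 0 by rewrite expf_neq0.
have : \forall h \near (0 : C)^', h ^+ 2 * f h != 0.
  exact: (tends_neq0 c2 (fr_pole N0 pole)).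
case/dnearCP => e2 e20 H2.
pose eps := Num.min e1 e2; have eps0 : 0 < eps by rewrite lt_min e10.
have bE v : 0 < `|v| < (eps%:C)%C -> [/\ reg v, Defs.nondegenerate [set: A] (r v), f v != 0 & v != 0].
  move=> /andP[v0 ve].
  have [h1 h2] : `|v| < (e1%:C)%C /\ `|v| < (e2%:C)%C.
    by split; apply: lt_le_trans ve _; rewrite lecR ge_min lexx ?orbT.
  have [rv nv] : reg v /\ Defs.nondegenerate [set: A] (r v) by apply: H1; rewrite v0.
  have := H2 v; rewrite subr0 v0 h2 mulf_eq0 negb_or => /(_ isT)/andP[_ fv].
  by split; [exact: rv | exact: nv | exact: fv | rewrite -normr_gt0].
have nnear v : 0 < `|v| < (eps%:C)%C -> \forall w \near v, Defs.nondegenerate [set: A] (r w).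
  rewrite -{1 2}[v]subr0 => /dball_open; apply: filterS => w.
  by rewrite subr0 => /bE[].
pose a : C := ((eps / 2)%:C)%C.
have ab : 0 < `|a| < (eps%:C)%C.
  rewrite normCR gtr0_norm ?divr_gt0// !ltcR divr_gt0//=.
  by rewrite ltr_pdivrMr// ltr_pMr// ltr1n.
have nearball (P : C -> Prop) : (forall v, 0 < `|v| < (eps%:C)%C -> P v) -> \forall v \near (0 : C)^', P v.
  by move=> HP; apply/dnearCP; exists eps => // v; rewrite subr0; apply: HP.
have Sd v : reg v -> hasder S v (S' v) by apply: tr_der.
have hconst v : 0 < `|v| < (eps%:C)%C -> S v ^+ 2 / f v = N%:R ^+ 2.
  pose h w := S w * S w * (f w)^-1.
  have hd w : 0 < `|w| < (eps%:C)%C -> hasder h w 0.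
    move=> wb; have [rw nw fw w0] := bE _ wb.
    apply: hasder_eq.
      exact: (hasderM (hasderM (Sd _ rw) (Sd _ rw)) (hasderV fw (f_der rw))).
    have E := f'E rw (nnear _ wb).
    transitivity (S w * (2 * f w * S' w - f' w * S w) / f w ^+ 2); first by field.
    by rewrite E subrr mulr0 mul0r.
  move=> vb; have hv : h v = h a by apply: der0_punctured ab vb.
  have ha : h a = N%:R ^+ 2.
    have T1 : tends (0 : C)^' h (h a).
      apply: (@tends_near _ _ _ _ (fun=> h a)); last exact: tends_cst.
      by apply: nearball => w wb; apply: esym; apply: der0_punctured ab wb.
    have T2 : tends (0 : C)^' h (N%:R ^+ 2).
      apply: (@tends_near _ _ _ _ (fun w => (w * S w) * (w * S w) * (w ^+ 2 * f w)^-1)).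
        apply: nearball => w /bE[_ _ fw w0]; rewrite /h invfM.
        by rewrite -[RHS]mulr1 -(mulfV (expf_neq0 2 w0)); ring.
      apply: (@tends_eq _ _ _ _ ((c * N%:R) * (c * N%:R) * (c ^+ 2)^-1)).
        apply: tendsM; last by apply: tendsV; [exact: c2 | exact: (fr_pole N0 pole)].
        by apply: tendsM; exact: (Sr_pole pole).
      by rewrite -[RHS]mulr1 -(mulfV c2); ring.
    exact: tends_unique T1 T2.
  by rewrite -ha -hv /h expr2.
have SE v : 0 < `|v| < (eps%:C)%C -> S v = N%:R * c / v.
  pose h w := (S w)^-1 - w / (N%:R * c).
  have S0 w : 0 < `|w| < (eps%:C)%C -> S w != 0.
    move=> wb; have := hconst _ wb; apply: contra_eq_neq => ->.
    by rewrite expr0n/= mul0r eq_sym expf_neq0// NC0.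
  have S2 w : 0 < `|w| < (eps%:C)%C -> S w ^+ 2 = N%:R ^+ 2 * f w.
    by move=> wb; have [_ _ fw _] := bE _ wb; rewrite -(hconst _ wb) divfK.
  have Nc : N%:R * c != 0 by rewrite mulf_neq0// NC0.
  have hd w : 0 < `|w| < (eps%:C)%C -> hasder h w 0.
    move=> wb; have [rw nw fw w0] := bE _ wb.
    apply: hasder_eq.
      apply: hasderB; first exact: (hasderV (S0 _ wb) (Sd _ rw)).
      exact: (hasderM (hasder_id _) (hasder_cst _ _)).
    rewrite S2// S'E// mulr0 addr0 mul1r.
    by field; rewrite fw c0 NC0.
  move=> vb.
  have T1 : tends (0 : C)^' h (h a).
    apply: (@tends_near _ _ _ _ (fun=> h a)); last exact: tends_cst.
    by apply: nearball => w wb; apply: esym; apply: der0_punctured ab wb.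
  have T2 : tends (0 : C)^' h 0.
    apply: (@tends_near _ _ _ _ (fun w => w * (w * S w)^-1 - w / (N%:R * c))).
      apply: nearball => w /bE[_ _ fw w0]; rewrite /h invfM mulrA mulfV// mul1r.
      by [].
    apply: (@tends_eq _ _ _ _ (0 * (c * N%:R)^-1 - 0 / (N%:R * c))); last first.
      by rewrite !mul0r subrr.
    have T0 : tends (0 : C)^' id 0 by apply: tends_dnbhs; exact: cvg_id.
    apply: tendsB; apply: tendsM; [exact: T0 | | exact: T0 | exact: tends_cst].
    by apply: tendsV; [rewrite mulrC; exact: Nc | exact: (Sr_pole pole)].
  have h0 : h v = 0.
    by rewrite -(tends_unique T1 T2); apply: der0_punctured ab vb.
  move/eqP: h0; rewrite subr_eq0 => /eqP h0.
  by rewrite -[LHS]invrK h0 invf_div.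
have fE v : 0 < `|v| < (eps%:C)%C -> f v = (c / v) ^+ 2.
  move=> vb; have [_ _ fw v0] := bE _ vb; have := hconst _ vb; rewrite SE// => E.
  have N20 : (N%:R : C) ^+ 2 != 0 by rewrite expf_neq0// NC0.
  apply: (mulfI N20); move/eqP: E; rewrite (can2_eq (divfK fw) (mulfK fw)) => /eqP <-.
  ring.
pose X v := ptr2 (r v) - (c / v)%:M.
have Xd v : 0 < `|v| < (eps%:C)%C -> mder X v 0.
  move=> vb; have [rv nv fv v0] := bE _ vb.
  apply: mder_eq.
    apply: mderB; first by apply: ptr2_der; exact: rv.
    move=> i j; rewrite (_ : (fun=> _) = (fun w => c * w^-1 * (i == j)%:R)); last first.
      by apply/funext => w; rewrite mxE mulr_natr.
    instantiate (1 := (- c / v ^+ 2)%:M); rewrite mxE -mulr_natr.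
    apply: hasder_eq.
      exact: (hasderM (hasderM (hasder_cst _ _) (hasderV v0 (hasder_id _))) (hasder_cst _ _)).
    by rewrite mul0r add0r mulr0 addr0; ring.
  rewrite (square_scalar N0 c0 Ric rv nv).2 fE// -raddfB/=.
  rewrite (_ : _ - _ = 0) ?raddf0//; field.
  by rewrite v0 c0.
have XE v : 0 < `|v| < (eps%:C)%C -> X v = X a.
  move=> vb; apply/matrixP => i j; apply: (@der0_punctured R (fun w => X w i j)) ab vb.
  by move=> w wb; have := Xd _ wb i j; rewrite mxE.
exists eps => //; exists (N%:R^-1 *: X a).
  rewrite linearZ/= /X linearB/= -tr_ptr2 mxtrace_scalar -/(S a) SE//.
  by rewrite -[X in _ - X]mulr_natl mulrA subrr mulr0.
move=> v vb; have [rv nv fv v0] := bE _ vb; split; [exact: rv | exact: nv | |].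
  by rewrite (square_scalar N0 c0 Ric rv nv).1 fE.
by rewrite scalerA mulfV ?NC0// scale1r -(XE v)// subrK.
Qed.

End ScalarPart.

Section Symmetries.
Variables (R : realType) (N : nat).
Hypothesis N0 : (0 < N)%N.
Local Notation C := (Cplx R).
Local Notation A := ('M[C]_N).
Local Notation AA := (tens2 R N).
Implicit Types (s t u : AA) (a b : A).

Lemma tr3_YBE s t u : AYBEt s t u -> opAYBEt s t u ->
  s *m (ptr2 t *t 1%:M) - (1%:M *t ptr2 u) *m s = (ptr2 t *t 1%:M) *m s - s *m (1%:M *t ptr2 u).
Proof.
move=> /AYBEtP H /opAYBEtP H'; apply: coP => i a j l.
rewrite !coB co_r1 co_l2 co_l1 co_r2.
pose Z := \sum_k \sum_p co t i k j p * co u a p l k.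
have E1 : \sum_p co s i a p l * ptr2 t p j - \sum_p ptr2 u a p * co s i p j l + Z = 0.
  transitivity (\sum_k (\sum_p co s i a p l * co t p k j k - \sum_p co u a k p k * co s i p j l
     + \sum_p co t i k j p * co u a p l k)); last by apply: big1 => k _; apply: H.
  rewrite big_split/= sumrB; congr (_ - _ + _); rewrite exchange_big/=; apply: eq_bigr => p _.
    by rewrite mxE mulr_sumr.
  by rewrite mxE mulr_suml.
have E2 : \sum_p ptr2 t i p * co s p a j l - \sum_p co s i a j p * ptr2 u p l + Z = 0.
  transitivity (\sum_k (\sum_p co t i k p k * co s p a j l - \sum_p co s i a j p * co u p k l k
     + \sum_p co u a k l p * co t i p j k)); last by apply: big1 => k _; apply: H'.
  rewrite big_split/= sumrB; congr (_ - _ + _); rewrite exchange_big/=; apply: eq_bigr => p _.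
  - by rewrite mxE mulr_suml.
  - by rewrite mxE mulr_sumr.
  - by apply: eq_bigr => k _; rewrite mulrC.
by apply: (addIr Z); rewrite E1 E2.
Qed.

Definition inv_by (a : A) t := (a *t 1%:M + 1%:M *t a) *m t = t *m (a *t 1%:M + 1%:M *t a).

Lemma tens_D1 a b : (a + b) *t (1%:M : A) = a *t 1%:M + b *t 1%:M :> AA.
Proof. by apply: coP => *; rewrite coD !co_tens mxE mulrDl. Qed.
Lemma tens_D2 a b : (1%:M : A) *t (a + b) = 1%:M *t a + 1%:M *t b :> AA.
Proof. by apply: coP => *; rewrite coD !co_tens [X in _ * X]mxE mulrDr. Qed.
Lemma tens_Z1 c a : (c *: a) *t (1%:M : A) = c *: (a *t 1%:M) :> AA.
Proof. by apply: coP => *; rewrite coZ !co_tens mxE mulrA. Qed.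
Lemma tens_Z2 c a : (1%:M : A) *t (c *: a) = c *: (1%:M *t a) :> AA.
Proof. by apply: coP => *; rewrite coZ !co_tens [X in _ * X]mxE mulrCA. Qed.
Lemma tens_11 : (1%:M : A) *t (1%:M : A) = 1%:M :> AA.
Proof. by apply: coP => *; rewrite co_tens co1 !mxE. Qed.
Lemma tens_c1 c : (c%:M : A) *t (1%:M : A) = c%:M :> AA.
Proof.
have -> : (c%:M : A) = c *: 1%:M by rewrite scalemx1.
by rewrite tens_Z1 tens_11 scalemx1. Qed.
Lemma tens_1c c : (1%:M : A) *t (c%:M : A) = c%:M :> AA.
Proof.
have -> : (c%:M : A) = c *: 1%:M by rewrite scalemx1.
by rewrite tens_Z2 tens_11 scalemx1. Qed.

Lemma cancel_sum (V : zmodType) (x y z w l m : V) :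
  x + l - (y + m) = z + l - (w + m) -> x + w = z + y.
Proof.
rewrite !opprD !addrA => /addIr; rewrite addrAC (addrAC z) => /addIr H.
by rewrite -[x](subrK y) H addrAC subrK.
Qed.

Lemma inv_by_trace (b : A) (lam mu : C) s t u : AYBEt s t u -> opAYBEt s t u ->
  ptr2 t = N%:R *: b + lam%:M -> ptr2 u = N%:R *: b + mu%:M -> inv_by b s.
Proof.
move=> h1 h2 tE uE; have := tr3_YBE h1 h2; rewrite tE uE.
rewrite tens_D1 tens_D2 tens_Z1 tens_Z2 tens_c1 tens_1c !mulmxDr !mulmxDl.
rewrite !mul_scalar_mx !mul_mx_scalar -!scalemxAl -!scalemxAr => H.
have : N%:R *: (s *m (b *t 1%:M) + s *m (1%:M *t b)) =
       N%:R *: ((b *t 1%:M) *m s + (1%:M *t b) *m s).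
  by rewrite !scalerDr; exact: (cancel_sum H).
by move/(scalerI (NC0 R N0)) => E; rewrite /inv_by mulmxDl mulmxDr E.
Qed.

End Symmetries.

Section NearZeroSymmetries.
Variables (R : realType) (N : nat).
Hypothesis N0 : (0 < N)%N.
Local Notation C := (Cplx R).
Local Notation A := ('M[C]_N).
Local Notation AA := (tens2 R N).
Variables (U : set C) (r : C -> AA).
Hypotheses (Uo : open U) (U0 : U 0) (hr : nondegenerate_unitary_AYBE_solution U r).
Local Notation reg := (regular_pt U r).
Variables (c : C) (al0 b : A) (eps : R).
Hypotheses (c0 : c != 0) (eps0 : 0 < eps)
  (Ric : forall v, reg v -> (c * N%:R) *: rd r v =
    (1%:M *t al0) *m r v - r v *m (1%:M *t al0) - opmul (r v) (r v))
  (ball : forall v, 0 < `|v| < (eps%:C)%C -> [/\ reg v, Defs.nondegenerate [set: A] (r v),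
    r v *m r v = ((c / v) ^+ 2)%:M & ptr2 (r v) = N%:R *: b + (c / v)%:M]).
Local Notation inb v := (0 < `|v| < (eps%:C)%C).

Implicit Types (v w : C) (s t : AA).

Lemma inb_opp v : inb v -> inb (- v). Proof. by rewrite normrN. Qed.

Lemma inb_reg v : inb v -> reg v. Proof. by case/ball. Qed.

Lemma unit_ball v : inb v -> r (- v) = - flip (r v).
Proof.
move=> vb; have [[_ _ un] _] := hr.
have := un _ (inb_reg vb) (inb_reg (inb_opp vb)) => H.
apply: coP => i k j l; rewrite coN co_flip.
by rewrite -[RHS]coN -H co_flip.
Qed.

Lemma AYBE_reg v v' : reg v -> reg v' -> reg (v + v') ->
  AYBEt (r v) (r (v + v')) (r v').
Proof. by move=> h1 h2 h3; have [[_ AY _] _] := hr; exact: (AY _ _ h1 h2 h3). Qed.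

Lemma opAYBE_ball v v' : inb v -> inb v' -> inb (v + v') ->
  opAYBEt (r v) (r (v + v')) (r v').
Proof.
move=> h1 h2 h3; apply: AYBEt_flip; rewrite -!unit_ball//.
have -> : - (v + v') = - v' + - v by rewrite opprD addrC.
apply: AYBE_reg; apply: inb_reg; try exact: inb_opp.
by rewrite -opprD addrC; apply: inb_opp.
Qed.

Lemma inb_half v : inb v -> inb (v / 2).
Proof.
rewrite normrM normfV normr_nat => /andP[v0 ve].
rewrite divr_gt0//=; apply: le_lt_trans ve.
by rewrite ler_pdivrMr// ler_peMr ?normr_ge0// ler1n.
Qed.

Lemma b_inv v : inb v -> inv_by b (r v).
Proof.
move=> vb; have hb := inb_half vb; have hb' := inb_opp hb.
have E : v + - (v / 2) = v / 2 by field.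
have Eb : inb (v + - (v / 2)) by rewrite E.
have [_ _ _ p1] := ball hb; have [_ _ _ p2] := ball hb'.
apply: (inv_by_trace N0 (lam := c / (v / 2)) (mu := c / (- (v / 2))) (s := r v)
  (t := r (v + - (v / 2))) (u := r (- (v / 2)))).
- by apply: AYBE_reg; exact: inb_reg.
- exact: opAYBE_ball.
- by rewrite E p1.
- exact: p2.
Qed.

Lemma rd_opp v : inb v -> rd r (- v) = flip (rd r v).
Proof.
move=> vb; have H1 := mder_opp (reg_der (inb_reg (inb_opp vb))).
have H2 : mder (fun w => - flip (r w)) v (- flip (rd r v)).
  apply: mderN => x y; case: (mxtens_indexP x) => i k; case: (mxtens_indexP y) => j l.
  rewrite -/(co (flip (rd r v)) i k j l) co_flip.
  rewrite (_ : (fun=> _) = (fun w => co (r w) k i l j)); first exact: (reg_der (inb_reg vb)).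
  by apply/funext => w; rewrite -co_flip.
have H3 : mder (fun w => r (- w)) v (- flip (rd r v)).
  apply: mder_near H2.
  have : 0 < `|v - 0| < (eps%:C)%C by rewrite subr0.
  by move/dball_open; apply: filterS => w; rewrite subr0 => wb; rewrite unit_ball.
exact: oppr_inj (mder_unique H1 H3).
Qed.

Lemma flipN t : flip (- t : AA) = - flip t.
Proof. by apply: coP => *; rewrite coN !co_flip coN. Qed.

Lemma flipB (s t : AA) : flip (s - t) = flip s - flip t.
Proof. by apply: coP => *; rewrite coB !co_flip coB. Qed.

Lemma al_inv v : inb v -> inv_by al0 (r v).
Proof.
move=> vb; have H1 := Ric (inb_reg vb).
have := Ric (inb_reg (inb_opp vb)); rewrite rd_opp// unit_ball//.
move/(congr1 (@flip R N)); rewrite !flipB !flipM !flipN !flip_tens !flipK.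
have -> : flip ((c * N%:R) *: flip (rd r v)) = (c * N%:R) *: rd r v.
  by apply: coP => *; rewrite coZ co_flip coZ co_flip.
have -> : flip (opmul (- flip (r v)) (- flip (r v))) = opmul (r v) (r v).
  rewrite -[RHS]flip_opmul; congr flip; apply: coP => i k j l; rewrite !co_opmul.
  by apply: eq_bigr => p _; apply: eq_bigr => q _; rewrite !coN mulrNN.
rewrite H1 !mulmxN !mulNmx opprK => /addIr H.
rewrite /inv_by mulmxDl mulmxDr.
rewrite -[(_ *t al0) *m r v](subrK (r v *m (1%:M *t al0))) H.
by rewrite addrA addrA subrr add0r.
Qed.

Lemma ptr2_l1 (a : A) t : ptr2 ((a *t 1%:M) *m t : AA) = a *m ptr2 t.
Proof.
apply/matrixP => i j; rewrite !mxE.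
under eq_bigr do rewrite co_l1; rewrite exchange_big/=; apply: eq_bigr => p _.
by rewrite mxE mulr_sumr.
Qed.

Lemma ptr2_r1 (a : A) t : ptr2 (t *m (a *t 1%:M) : AA) = ptr2 t *m a.
Proof.
apply/matrixP => i j; rewrite !mxE.
under eq_bigr do rewrite co_r1; rewrite exchange_big/=; apply: eq_bigr => p _.
by rewrite mxE mulr_suml.
Qed.

Lemma ptr2_swap2 (a : A) t : ptr2 ((1%:M *t a) *m t : AA) = ptr2 (t *m (1%:M *t a)).
Proof.
apply/matrixP => i j; rewrite !mxE.
under eq_bigr do rewrite co_l2; under [RHS]eq_bigr do rewrite co_r2.
by rewrite exchange_big/=; apply: eq_bigr => p _; apply: eq_bigr => q _; rewrite mulrC.
Qed.

Lemma ptr2D (s t : AA) : ptr2 (s + t) = ptr2 s + ptr2 t.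
Proof.
by apply/matrixP => i j; rewrite !mxE -big_split; apply: eq_bigr => k _; rewrite coD.
Qed.

Lemma al_b : al0 *m b = b *m al0.
Proof.
pose v : C := ((eps / 2)%:C)%C.
have vb : inb v.
  rewrite normCR gtr0_norm ?divr_gt0// !ltcR divr_gt0//=.
  by rewrite ltr_pdivrMr// ltr_pMr// ltr1n.
have := al_inv vb; rewrite /inv_by mulmxDl mulmxDr => /(congr1 (@ptr2 R N)).
rewrite !ptr2D ptr2_l1 ptr2_r1 ptr2_swap2 => /addIr.
have [_ _ _ ->] := ball vb.
rewrite mulmxDr mulmxDl mul_mx_scalar mul_scalar_mx => /addIr.
by rewrite -scalemxAr -scalemxAl => /(scalerI (NC0 R N0)).
Qed.

End NearZeroSymmetries.

Section Gauge.
Variables (R : realType) (N : nat).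
Hypothesis N0 : (0 < N)%N.
Local Notation C := (Cplx R).
Local Notation A := ('M[C]_N).
Local Notation AA := (tens2 R N).

Lemma pt_conj (a b : A) (t : AA) :
  pt ((1%:M *t a) *m t *m (1%:M *t b)) = (1%:M *t b^T) *m pt t *m (1%:M *t a^T).
Proof.
apply: coP => i k j l; rewrite co_pt !co_r2.
under eq_bigr do rewrite co_l2 mulr_suml.
under [RHS]eq_bigr do rewrite co_l2 mulr_suml.
rewrite exchange_big/=; apply: eq_bigr => p _; apply: eq_bigr => q _.
by rewrite co_pt !mxE; ring.
Qed.

Lemma tens_1M (a b : A) : ((1%:M : A) *t a) *m ((1%:M : A) *t b) = (1%:M : A) *t (a *m b) :> AA.
Proof. by rewrite tensmx_mul mul1mx. Qed.

Lemma opmul_conj (a b : A) (s t : AA) : b *m a = 1%:M ->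
  opmul ((1%:M *t a) *m s *m (1%:M *t b)) ((1%:M *t a) *m t *m (1%:M *t b)) =
  (1%:M *t a) *m opmul s t *m (1%:M *t b).
Proof.
move=> ba; rewrite /opmul !pt_conj.
have E : (1%:M *t a^T) *m (1%:M *t b^T) = 1%:M :> AA.
  by rewrite tens_1M -trmx_mul ba trmx1 tens_11.
rewrite -!mulmxA (mulmxA (1%:M *t a^T) (1%:M *t b^T)) E mul1mx !mulmxA.
by rewrite -(mulmxA _ (pt s)) pt_conj !trmxK.
Qed.

Lemma mder_tens1 (F : C -> A) v D : mder F v D ->
  mder (fun w => (1%:M : A) *t F w) v ((1%:M : A) *t D).
Proof.
move=> FD x y; case: (mxtens_indexP x) => i k; case: (mxtens_indexP y) => j l.
rewrite tensmxE (_ : (fun=> _) = (fun w => (1%:M : A) i j * F w k l)); last first.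
  by apply/funext => w; rewrite tensmxE.
by apply: hasder_eq; [exact: (hasderM (hasder_cst _ _) (FD k l)) | rewrite mul0r add0r].
Qed.

Lemma mder_pt (F : C -> AA) v D : mder F v D -> mder (fun w => pt (F w)) v (pt D).
Proof.
move=> FD x y; case: (mxtens_indexP x) => i k; case: (mxtens_indexP y) => j l.
rewrite -/(co (pt D) i k j l) co_pt.
rewrite (_ : (fun=> _) = (fun w => co (F w) i l j k)); first exact: FD.
by apply/funext => w; rewrite -co_pt.
Qed.

Lemma mtends_tens1 (T : Type) (F : set_system T) {FF : ProperFilter F} (f : T -> A) X :
  mtends F f X -> mtends F (fun w => (1%:M : A) *t f w) ((1%:M : A) *t X).
Proof.
move=> fX x y; case: (mxtens_indexP x) => i k; case: (mxtens_indexP y) => j l.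
rewrite tensmxE (_ : (fun=> _) = (fun w => (1%:M : A) i j * f w k l)); last first.
  by apply/funext => w; rewrite tensmxE.
by apply: tendsM; [exact: tends_cst | exact: fX].
Qed.

Lemma mtends_pt (T : Type) (F : set_system T) (f : T -> AA) X :
  mtends F f X -> mtends F (fun w => pt (f w)) (pt X).
Proof.
move=> fX x y; case: (mxtens_indexP x) => i k; case: (mxtens_indexP y) => j l.
rewrite -/(co (pt X) i k j l) co_pt.
rewrite (_ : (fun=> _) = (fun w => co (f w) i l j k)); first exact: fX.
by apply/funext => w; rewrite -co_pt.
Qed.

End Gauge.

(** * The resolvent formula *)

Section QuadraticODE.
Variable R : realType.
Local Notation C := (Cplx R).

Lemma mtends_bounded (T : Type) (F : set_system T) {FF : ProperFilter F} m n
    (f : T -> 'M[C]_(m, n)) X : mtends F f X ->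
  exists2 M : R, 0 <= M & \forall x \near F, forall i j, `|f x i j| <= (M%:C)%C.
Proof.
move=> fX; have [B B0 hB] := mx_bounded X; exists (B + 1); first by rewrite addr_ge0.
refine (@filter_forall _ _ (fun i w => forall j, `|f w i j| <= ((B + 1)%:C)%C) F _ _) => i.
refine (@filter_forall _ _ (fun j w => `|f w i j| <= ((B + 1)%:C)%C) F _ _) => j.
have h : \forall x \near F, `|X i j - f x i j| <= 1.
  exact: ((tendsP (fun x => f x i j) (X i j)).1 (fX i j) 1 ltr01).
apply: filterS h => x hx; rewrite -(subrK (X i j) (f x i j)).
apply: le_trans (ler_normD _ _) _; rewrite distrC rmorphD addrC.
exact: lerD.
Qed.

(* The resolvent [q w = (1 + k (w - v0) Q)^-1 Q] solves [q' = - k q^2];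
   the error of this formula satisfies a linear equation. *)
Lemma quadratic_ode n (q : C -> 'M[C]_n) (k z : C) (p : nat) (e M : R) :
  (forall w, 0 < `|w - z| < (e%:C)%C -> mder q w (- k *: (q w *m q w))) ->
  (forall w, 0 < `|w - z| < (e%:C)%C -> forall i j, `|((w - z) ^+ p *: q w) i j| <= (M%:C)%C) ->
  0 <= M -> forall (Q : 'M[C]_n) v0 a, 0 < `|a - z| < (e%:C)%C ->
  q a *m (1%:M + (k * (a - v0)) *: Q) = Q ->
  forall w, 0 < `|w - z| < (e%:C)%C -> q w *m (1%:M + (k * (w - v0)) *: Q) = Q.
Proof.
move=> dq bq M0 Q v0 a az qa.
pose Err w := q w *m (1%:M + (k * (w - v0)) *: Q) - Q.
pose Er x := Err (x + z); pose Er' x := - k *: (q (x + z) *m Er x).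
have sh x : x + z - z = x by rewrite addrK.
have [b1 b10 hb1] := mx_bounded (1%:M + (k * (z - v0)) *: Q).
have [b2 b20 hb2] := mx_bounded (k *: Q).
have [b3 b30 hb3] := mx_bounded Q.
have [nk nk0 hk] := normC_real k.
have qb (eta : R) (x : C) : 0 < eta -> (eta%:C)%C <= `|x| < (e%:C)%C ->
    forall i j, `|q (x + z) i j| <= ((M / eta ^+ p)%:C)%C.
  move=> eta0 /andP[ex xe] i j.
  have x0 : 0 < `|x| by apply: lt_le_trans ex; rewrite ltcR.
  have := bq (x + z); rewrite sh x0 xe => /(_ isT i j); rewrite mxE normrM normrX => h.
  have -> : ((M / eta ^+ p)%:C)%C = (M%:C)%C / ((eta%:C)%C) ^+ p :> C.
    by rewrite rmorphM fmorphV rmorphXn.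
  rewrite ler_pdivlMr ?exprn_gt0// ?ltcR//; apply: le_trans h; rewrite mulrC.
  by apply: ler_wpM2r => //; apply: lerXn2r => //; rewrite nnegrE ?lecR// ltW.
have qb0 (eta : R) : 0 < eta -> 0 <= M / eta ^+ p.
  by move=> eta0; rewrite divr_ge0// exprn_ge0// ltW.
have dE x : 0 < `|x| < (e%:C)%C -> mder Er x (Er' x).
  move=> xI; apply: mder_shift.
  apply: mder_eq.
    apply: mderB; last exact: mder_cst.
    apply: mderM; first by apply: dq; rewrite sh.
    apply: mderD; first exact: mder_cst.
    apply: mderZ; last exact: mder_cst.
    exact: (hasderM (hasder_cst _ _) (hasderB (hasder_id _) (hasder_cst _ _))).
  rewrite /Er' /Er /Err subr0 add0r mul0r add0r subr0 mulr1 scaler0 addr0.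
  rewrite mulmxBr scalerBr mulmxA -scalemxAr !scaleNr opprK.
  by rewrite mulNmx -scalemxAl.
have Ea : Er (a - z) = 0 by rewrite /Er /Err subrK qa subrr.
have b4 : exists B : R, 0 <= B /\ forall x i j, `|x| < (e%:C)%C ->
    `|(1%:M + (k * (x + z - v0)) *: Q) i j| <= (B%:C)%C.
  exists (b1 + `|e| * b2); split; first by rewrite addr_ge0// mulr_ge0.
  move=> x i j xe.
  have -> : 1%:M + (k * (x + z - v0)) *: Q =
      (1%:M + (k * (z - v0)) *: Q) + x *: (k *: Q).
    rewrite -[RHS]addrA scalerA -scalerDl; congr (_ + _ *: _); ring.
  rewrite mxE [in X in _ + X]mxE; apply: le_trans (ler_normD _ _) _.
  rewrite rmorphD; apply: lerD; first exact: hb1.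
  rewrite normrM rmorphM; apply: ler_pM => //.
  by apply: le_trans (ltW xe) _; rewrite lecR ler_norm.
case: b4 => B4 [B40 hB4].
move=> w wz; suff : Er (w - z) = 0 by rewrite /Er /Err subrK => /subr0_eq.
apply: (@gronwall_punctured R n n Er Er' e (a - z)) => //.
  move=> eta eta0; exists (nk * (n%:R * (M / eta ^+ p)) + 1).
    by rewrite ltr_wpDl// mulr_ge0// mulr_ge0// qb0.
  move=> x m xI hE i j; rewrite mxE normrM normrN hk.
  have m0 : 0 <= m.
    by have : 0 <= (m%:C)%C :> C by [apply: le_trans (hE i j)]; rewrite lecR.
  have := mulmx_bounded (qb _ _ eta0 xI) hE i j => h.
  apply: le_trans (ler_wpM2l _ h) _; first by rewrite lecR.
  by rewrite -rmorphM lecR mulrDl mul1r !mulrA ler_wpDr.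
move=> eta eta0; exists (n%:R * (M / eta ^+ p * B4) + b3) => x i j xI.
rewrite /Er /Err mxE [in X in _ + X]mxE; apply: le_trans (ler_normD _ _) _.
rewrite normrN rmorphD; apply: lerD; last exact: hb3.
apply: (mulmx_bounded (qb _ _ eta0 xI)) => i' j'.
by apply: hB4; case/andP: xI.
Qed.

End QuadraticODE.

Section ResolventIdentity.
Variables (R : realType) (N : nat).
Hypothesis N0 : (0 < N)%N.
Local Notation C := (Cplx R).
Local Notation A := ('M[C]_N).
Local Notation AA := (tens2 R N).
Variables (U : set C) (r : C -> AA).
Hypotheses (Uo : open U) (U0 : U 0) (hr : nondegenerate_unitary_AYBE_solution U r).
Local Notation reg := (regular_pt U r).
Variables (c : C) (al0 b : A) (eps : R) (E : C -> A).
Hypotheses (c0 : c != 0) (eps0 : 0 < eps)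
  (Ric : forall v, reg v -> (c * N%:R) *: rd r v =
    (1%:M *t al0) *m r v - r v *m (1%:M *t al0) - opmul (r v) (r v))
  (ball : forall v, 0 < `|v| < (eps%:C)%C -> reg v)
  (pole : mtends (0 : C)^' (fun h => h *: r h) (c *: permt R N))
  (EP : is_mexp ((c * N%:R)^-1 *: al0) E).

Definition kap := (c * N%:R)^-1.

Lemma cN0 : c * N%:R != 0. Proof. by rewrite mulf_neq0// NC0. Qed.

Definition qt v : AA := ((1%:M : A) *t E (- v)) *m r v *m ((1%:M : A) *t E v).
Definition qh v : AA := pt (qt v).

Lemma rdE v : reg v -> rd r v =
  (1%:M *t (kap *: al0)) *m r v - r v *m (1%:M *t (kap *: al0)) - kap *: opmul (r v) (r v).
Proof.
move=> rv; apply: (scalerI cN0); rewrite (Ric rv) !tens_Z2 -scalemxAl -scalemxAr -!scalerBr.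
by rewrite scalerA divff ?scale1r// cN0.
Qed.

Lemma conj_der n (a e l x o : 'M[C]_n) (k : C) :
  (- (a *m l) *m x + a *m (l *m x - x *m l - k *: o)) *m e + a *m x *m (l *m e) =
  - k *: (a *m o *m e).
Proof.
rewrite !mulmxBr -scalemxAr !mulNmx !mulmxA addrA addrA addNr sub0r.
by rewrite mulmxBl mulNmx -scalemxAl scaleNr addrAC addNr add0r.
Qed.

Lemma qt_der v : reg v -> mder qt v (- kap *: opmul (qt v) (qt v)).
Proof.
move=> rv; have [E0 dE Eal] := EP; rewrite -/kap in dE Eal.
apply: mder_eq.
  apply: mderM; last exact: (mder_tens1 (dE v)).
  apply: mderM; last exact: (reg_der rv).
  exact: (mder_tens1 (mder_opp (dE (- v)))).
rewrite /qt opmul_conj; last exact: (mexp_opp EP).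
have -> : (1%:M : A) *t (- (kap *: al0 *m E (- v))) =
    - (((1%:M : A) *t E (- v)) *m ((1%:M : A) *t (kap *: al0))) :> AA.
  by rewrite -Eal -scaleN1r tens_Z2 scaleN1r tens_1M.
have -> : (1%:M : A) *t (kap *: al0 *m E v) =
    ((1%:M : A) *t (kap *: al0)) *m ((1%:M : A) *t E v) :> AA by rewrite tens_1M.
rewrite (rdE rv); exact: conj_der.
Qed.

Lemma ptZ k (t : AA) : pt (k *: t) = k *: pt t.
Proof. by apply/coP => i i' j j'; rewrite !(co_pt, coZ). Qed.

Lemma qh_der v : reg v -> mder qh v (- kap *: (qh v *m qh v)).
Proof.
by move=> rv; apply: mder_eq (mder_pt (qt_der rv)) _; rewrite ptZ ptK.
Qed.

Lemma E_tends v : mtends (nbhs v) E (E v).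
Proof. by have [_ dE _] := EP; exact: (mder_tends (dE v)). Qed.

Lemma EN_tends v : mtends (nbhs v) (fun w => E (- w)) (E (- v)).
Proof. by have [_ dE _] := EP; exact: (mder_tends (mder_opp (dE (- v)))). Qed.

Lemma qh_tends v :
  forall (F : set_system C) (FF : ProperFilter F) (f : C -> C) X,
  (forall (P : C -> Prop), (\forall w \near v, P w) -> \forall w \near F, P w) ->
  mtends F (fun w => f w *: r w) X ->
  mtends F (fun w => f w *: qh w) (pt (((1%:M : A) *t E (- v)) *m X *m ((1%:M : A) *t E v))).
Proof.
move=> F FF f X sub rX.
have EF m n (g : C -> 'M[C]_(m, n)) Y : mtends (nbhs v) g Y -> mtends F g Y.
  by move=> gY i j P; exact: (fun h => sub _ (gY i j P h)).
have h : mtends F (fun w => pt (((1%:M : A) *t E (- w)) *m (f w *: r w) *m ((1%:M : A) *t E w)))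
    (pt (((1%:M : A) *t E (- v)) *m X *m ((1%:M : A) *t E v))).
  apply: mtends_pt; apply: mtendsM; last by apply: mtends_tens1; apply: EF; exact: E_tends.
  by apply: mtendsM; [apply: mtends_tens1; apply: EF; exact: EN_tends | exact: rX].
apply: mtends_near h; apply: nearW => w.
by rewrite /qh -ptZ /qt -scalemxAr -scalemxAl.
Qed.

Lemma open_ball (V : set C) : (forall z, V z -> exists2 e : R, 0 < e &
  forall w, `|w - z| < (e%:C)%C -> V w) -> open V.
Proof. by move=> hV; rewrite openE => z Vz; apply/nearCP; exact: hV. Qed.

Definition local_data (z : C) (e : R) :=
  0 < e /\ (forall w, 0 < `|w - z| < (e%:C)%C -> reg w) /\
  exists p, exists2 M : R, 0 <= M &
    forall w, 0 < `|w - z| < (e%:C)%C -> forall i j, `|((w - z) ^+ p *: qh w) i j| <= (M%:C)%C.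

Lemma local_dataP z : U z -> exists e, local_data z e.
Proof.
move=> Uz; have [[rm _ _] _] := hr.
have /dnearCP[e1 e10 H1] := reg_generic Uo rm Uz.
have [p [g [hg gz]]] := rm z Uz.
have [D gD] : exists D, mder g z D by exact: (nbhs_singleton (holo_der hg)).
have rX : mtends z^' (fun w => (w - z) ^+ p *: r w) (g z).
  apply: (@mtends_near _ _ _ _ _ _ g).
    by apply: filterS gz => w; exact: esym.
  have gt : mtends (nbhs z) g (g z) by exact: mder_tends gD.
  by move=> i j; have := @tends_dnbhs _ (fun x => g x i j) z (g z i j) (gt i j).
have h : mtends z^' (fun w => (w - z) ^+ p *: qh w)
    (pt (((1%:M : A) *t E (- z)) *m g z *m ((1%:M : A) *t E z))).
  have sub (P : C -> Prop) : (\forall w \near z, P w) -> \forall w \near z^', P w.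
    by case/nearCP => e e0 hP; apply/dnearCP; exists e => // w /andP[_]; exact: hP.
  exact: (@qh_tends z z^' _ (fun w => (w - z) ^+ p) (g z) sub rX).
have [M M0 /dnearCP[e2 e20 H2]] := mtends_bounded h.
exists (Num.min e1 e2); split; first by rewrite lt_min e10.
have lte w : `|w - z| < ((Num.min e1 e2)%:C)%C ->
    `|w - z| < (e1%:C)%C /\ `|w - z| < (e2%:C)%C.
  by move=> h'; split; apply: lt_le_trans h' _; rewrite lecR ge_min lexx ?orbT.
split=> [w /andP[w0 /lte[w1 _]]|]; first by apply: H1; rewrite w0.
by exists p, M => // w /andP[w0 /lte[_ w2]]; apply: H2; rewrite w0.
Qed.

Section Error.
Variables (Q : AA) (v0 : C).
Let err0 w := qh w *m (1%:M + (kap * (w - v0)) *: Q) = Q.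

Lemma err_dichotomy z e a : local_data z e -> 0 < `|a - z| < (e%:C)%C -> err0 a ->
  forall w, 0 < `|w - z| < (e%:C)%C -> err0 w.
Proof.
case=> e0 [he [p [M M0 hM]]]; apply: (quadratic_ode _ hM M0).
by move=> w wI; apply: qh_der; exact: he.
Qed.

Hypothesis Uc : connected U.

Lemma err_global a e : local_data 0 e -> 0 < `|a| < (e%:C)%C -> err0 a ->
  forall z, U z -> \forall w \near z^', err0 w.
Proof.
move=> e0 aI ea; pose V := [set z | U z /\ \forall w \near z^', err0 w].
suff VU : V = U by move=> z; rewrite -{1}VU => -[].
have Un z : U z -> \forall w \near z, U w by move=> Uz; apply: open_nbhs_nbhs.
apply: Uc.
- exists 0; split; first exact: U0.
  apply/dnearCP; case: (e0) => e00 _; exists e => // w.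
  by apply: (err_dichotomy e0 (a := a)); rewrite ?subr0.
- exists V; last by apply/seteqP; split=> [z Vz|z []//]; split=> //; case: Vz.
  apply: open_ball => z [Uz /dnearCP[d d0 hd]].
  have /nearCP[d1 d10 h1] := Un z Uz.
  exists (Num.min d d1) => [|w wI]; first by rewrite lt_min d0.
  have w1 : `|w - z| < (d%:C)%C by apply: lt_le_trans wI _; rewrite lecR ge_min lexx.
  have w2 : `|w - z| < (d1%:C)%C by apply: lt_le_trans wI _; rewrite lecR ge_min lexx orbT.
  split; first exact: h1.
  have [wz|wz] := eqVneq w z; first by rewrite wz; apply/dnearCP; exists d.
  have wz0 : 0 < `|w - z| < (d%:C)%C by rewrite normr_gt0 subr_eq0 wz.
  have /nearCP[d2 d20 h2] := dball_open wz0.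
  by apply/dnearCP; exists d2 => // x /andP[_ /h2]; exact: hd.
- exists (~` (U `\` V)); last first.
    apply/seteqP; split=> [z Vz|z [Uz]]; first by split; [case: Vz | case].
    by move=> nV; apply: contrapT => nVz; apply: nV.
  apply: open_closedC; apply: open_ball => z [Uz nV].
  have [d dd] := local_dataP Uz; have [d0 _] := dd.
  have /nearCP[d1 d10 h1] := Un z Uz.
  exists (Num.min d d1) => [|w wI]; first by rewrite lt_min d0.
  have w1 : `|w - z| < (d%:C)%C by apply: lt_le_trans wI _; rewrite lecR ge_min lexx.
  have w2 : `|w - z| < (d1%:C)%C by apply: lt_le_trans wI _; rewrite lecR ge_min lexx orbT.
  split; first exact: h1.
  have [-> //|wz] := eqVneq w z.
  have wz0 : 0 < `|w - z| < (d%:C)%C by rewrite normr_gt0 subr_eq0 wz.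
  case=> _ Vw; apply: nV; split; first exact: Uz.
  have nx : \forall x \near w^', 0 < `|x - z| < (d%:C)%C.
    have /nearCP[d2 d20 h2] := dball_open wz0.
    by apply/dnearCP; exists d2 => // x /andP[_ /h2].
  have [x [x1 x2]] := filter_ex (filterI nx Vw).
  apply/dnearCP; exists d; first exact: d0.
  exact: (err_dichotomy dd x1 x2).
Qed.
End Error.

Theorem resolvent_formula : connected U -> exists2 v0, 0 < `|v0| < (eps%:C)%C &
  forall v, reg v -> qh v *m (1%:M + (kap * (v - v0)) *: qh v0) = qh v0.
Proof.
move=> Uc; have [e he] := local_dataP U0; have [e0 _] := he.
have m0 : 0 < Num.min e eps by rewrite lt_min e0.
pose v0 : C := ((Num.min e eps / 2)%:C)%C.
have lt2 : Num.min e eps / 2 < Num.min e eps by rewrite ltr_pdivrMr// ltr_pMr// ltr1n.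
have nv0 : `|v0| = v0 by rewrite normCR gtr0_norm// divr_gt0.
have v0e : 0 < `|v0| < (e%:C)%C.
  by rewrite nv0 !ltcR divr_gt0//=; apply: lt_le_trans lt2 _; rewrite ge_min lexx.
exists v0.
  by rewrite nv0 !ltcR divr_gt0//=; apply: lt_le_trans lt2 _; rewrite ge_min lexx orbT.
have h0 : qh v0 *m (1%:M + (kap * (v0 - v0)) *: qh v0) = qh v0.
  by rewrite subrr mulr0 scale0r addr0 mulmx1.
move=> v rv; have [Uv _] := rv.
have near_v := err_global Uc he v0e h0 Uv.
have qv : mtends (nbhs v) qh (qh v) by exact: (mder_tends (qh_der rv)).
have dv : mtends (nbhs v) (fun w => 1%:M + (kap * (w - v0)) *: qh v0)
    (1%:M + (kap * (v - v0)) *: qh v0).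
  apply: mtendsD; first exact: mtends_cst.
  apply: mtendsZ; last exact: mtends_cst.
  apply: tendsM; first exact: tends_cst.
  by apply: tendsB; [exact: (hasder_tends (hasder_id v)) | exact: tends_cst].
have h : mtends (nbhs v) (fun w => qh w *m (1%:M + (kap * (w - v0)) *: qh v0))
    (qh v *m (1%:M + (kap * (v - v0)) *: qh v0)) by exact: mtendsM.
have h' : mtends v^' (fun w => qh w *m (1%:M + (kap * (w - v0)) *: qh v0))
    (qh v *m (1%:M + (kap * (v - v0)) *: qh v0)).
  by move=> i j; have := @tends_dnbhs _ (fun w => (qh w *m (1%:M + (kap * (w - v0)) *: qh v0)) i j) v _ (h i j).
apply: mtends_unique h' _.
have hc : mtends v^' (fun=> qh v0) (qh v0) by exact: mtends_cst.
by apply: mtends_near hc; apply: filterS near_v => w; exact: esym.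
Qed.

End ResolventIdentity.
Section LinearExpansion.
Variable K : numFieldType.

Lemma linear_expand m n p q (L : 'M[K]_(m, n) -> 'M[K]_(p, q)) X : linear L ->
  L X = \sum_i \sum_j X i j *: L (delta_mx i j).
Proof.
move=> linL; pose LL := GRing.isLinear.Build K _ _ *:%R L linL.
pose F : {linear 'M[K]_(m, n) -> 'M[K]_(p, q)} := HB.pack L LL.
rewrite -[L]/(F : _ -> _) {1}(matrix_sum_delta X) linear_sum; apply: eq_bigr => i _.
by rewrite linear_sum; apply: eq_bigr => j _; rewrite linearZ.
Qed.

Lemma mtends_linear (T : Type) (F : set_system T) {FF : ProperFilter F} m n p q
    (L : 'M[K]_(m, n) -> 'M[K]_(p, q)) (f : T -> 'M[K]_(m, n)) X :
  linear L -> mtends F f X -> mtends F (fun x => L (f x)) (L X).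
Proof.
move=> linL fX i j; rewrite (linear_expand X linL) !summxE.
rewrite (_ : (fun=> _) = fun x => \sum_i0 \sum_j0 f x i0 j0 * L (delta_mx i0 j0) i j).
  apply: tends_eq; first apply: tends_sum => i'.
    apply: tends_sum => j'.
    by apply: tendsM; [exact: fX | exact: tends_cst].
  by apply: eq_bigr => i' _; rewrite summxE; apply: eq_bigr => j' _; rewrite mxE.
apply/funext => x; rewrite (linear_expand (f x) linL) summxE; apply: eq_bigr => i' _.
by rewrite summxE; apply: eq_bigr => j' _; rewrite mxE.
Qed.
End LinearExpansion.

Section RationalMatrices.
Variable R : realType.
Local Notation C := (Cplx R).

Definition mpoly m n (f : C -> 'M[C]_(m, n)) := forall i j, polyfun (fun v => f v i j).

Lemma polyfun_eq (f g : C -> C) : (forall v, f v = g v) -> polyfun f -> polyfun g.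
Proof. by move=> fg [p hp]; exists p => x; rewrite -fg. Qed.

Lemma polyfunX f k : polyfun f -> polyfun (fun v : C => f v ^+ k).
Proof.
move=> hf; elim: k => [|k ih]; first by apply: polyfun_eq (polyfun_cst 1) => v; rewrite expr0.
by apply: polyfun_eq (polyfunM hf ih) => v; rewrite exprS.
Qed.

Lemma mpoly_cst m n (X : 'M[C]_(m, n)) : mpoly (fun=> X).
Proof. by move=> i j; exact: polyfun_cst. Qed.

Lemma mpolyD m n (f g : C -> 'M[C]_(m, n)) : mpoly f -> mpoly g -> mpoly (fun v => f v + g v).
Proof.
by move=> hf hg i j; apply: polyfun_eq (polyfunD (hf i j) (hg i j)) => v; rewrite mxE.
Qed.

Lemma mpolyZ m n (a : C -> C) (f : C -> 'M[C]_(m, n)) : polyfun a -> mpoly f ->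
  mpoly (fun v => a v *: f v).
Proof. by move=> ha hf i j; apply: polyfun_eq (polyfunM ha (hf i j)) => v; rewrite mxE. Qed.

Lemma mpolyM m n p (f : C -> 'M[C]_(m, n)) (g : C -> 'M[C]_(n, p)) : mpoly f -> mpoly g ->
  mpoly (fun v => f v *m g v).
Proof.
move=> hf hg i j.
by apply: polyfun_eq (polyfun_sum _ (fun k => polyfunM (hf i k) (hg k j))) => v; rewrite mxE.
Qed.

Lemma mpoly_comp m n (f : C -> 'M[C]_(m, n)) g : mpoly f -> polyfun g -> mpoly (fun v => f (g v)).
Proof. by move=> hf hg i j; exact: (polyfun_comp (hf i j) hg). Qed.

Lemma det_poly n (f : C -> 'M[C]_n) : mpoly f -> polyfun (fun v => \det (f v)).
Proof.
move=> hf; apply: polyfun_sum => s; apply: polyfunM; first exact: polyfun_cst.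
by apply: polyfun_prod => i.
Qed.

Lemma adj_poly n (f : C -> 'M[C]_n) : mpoly f -> mpoly (fun v => \adj (f v)).
Proof.
move=> hf i j; rewrite (_ : (fun=> _) = fun v => (-1) ^+ (j + i) * \det (row' j (col' i (f v)))).
  apply: polyfunM; first exact: polyfun_cst.
  by apply: det_poly => k l; apply: polyfun_eq (hf (lift j k) (lift i l)) => v; rewrite !mxE.
by apply/funext => v; rewrite mxE.
Qed.

Lemma mpoly_linear m n p q (L : 'M[C]_(m, n) -> 'M[C]_(p, q)) (f : C -> 'M[C]_(m, n)) :
  linear L -> mpoly f -> mpoly (fun x => L (f x)).
Proof.
move=> linL hf i j.
apply: polyfun_eq (polyfun_sum _ (fun i' => polyfun_sum _ (fun j' =>
  polyfunM (hf i' j') (polyfun_cst (L (delta_mx i' j') i j))))) => v.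
rewrite (linear_expand (f v) linL) summxE; apply: eq_bigr => i' _.
by rewrite summxE; apply: eq_bigr => j' _; rewrite mxE.
Qed.

(* Rational functions whose poles are among the zeros of [d]. *)
Definition rat (d : C -> C) m n (f : C -> 'M[C]_(m, n)) := exists k, exists2 P, mpoly P &
  forall v, d v != 0 -> d v ^+ k *: f v = P v.

Section Fixed.
Variable d : C -> C.
Hypothesis dp : polyfun d.

Lemma rat_cst m n (X : 'M[C]_(m, n)) : rat d (fun=> X).
Proof. by exists 0, (fun=> X); [exact: mpoly_cst | move=> v _; rewrite expr0 scale1r]. Qed.

Lemma ratD m n (f g : C -> 'M[C]_(m, n)) : rat d f -> rat d g -> rat d (fun v => f v + g v).
Proof.
move=> [k [P hP fP]] [l [Q hQ gQ]].
exists (k + l)%N, (fun v => d v ^+ l *: P v + d v ^+ k *: Q v).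
  by apply: mpolyD; apply: mpolyZ => //; exact: polyfunX.
move=> v dv; rewrite -fP// -gQ// !scalerA scalerDr -exprD addnC.
by rewrite -exprD (addnC l).
Qed.

Lemma ratM m n p (f : C -> 'M[C]_(m, n)) (g : C -> 'M[C]_(n, p)) : rat d f -> rat d g ->
  rat d (fun v => f v *m g v).
Proof.
move=> [k [P hP fP]] [l [Q hQ gQ]]; exists (k + l)%N, (fun v => P v *m Q v).
  exact: mpolyM.
by move=> v dv; rewrite -fP// -gQ// -scalemxAl -scalemxAr scalerA exprD.
Qed.

Lemma ratZ m n (a : C -> C) (f : C -> 'M[C]_(m, n)) : polyfun a -> rat d f ->
  rat d (fun v => a v *: f v).
Proof.
move=> ha [k [P hP fP]]; exists k, (fun v => a v *: P v); first exact: mpolyZ.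
by move=> v dv; rewrite -fP// !scalerA mulrC.
Qed.

Lemma ratN m n (f : C -> 'M[C]_(m, n)) : rat d f -> rat d (fun v => - f v).
Proof.
move=> /(ratZ (polyfun_cst (-1))) [k [P hP fP]]; exists k, P => // v dv.
by rewrite -fP// scaleN1r.
Qed.

Lemma ratB m n (f g : C -> 'M[C]_(m, n)) : rat d f -> rat d g -> rat d (fun v => f v - g v).
Proof. by move=> hf /ratN; exact: ratD. Qed.

Lemma rat_linear m n p q (L : 'M[C]_(m, n) -> 'M[C]_(p, q)) (f : C -> 'M[C]_(m, n)) :
  linear L -> rat d f -> rat d (fun x => L (f x)).
Proof.
move=> linL [k [P hP fP]]; exists k, (fun v => L (P v)); first exact: mpoly_linear.
move=> v dv; rewrite -fP//; pose LL := GRing.isLinear.Build C _ _ *:%R L linL.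
pose F : {linear 'M[C]_(m, n) -> 'M[C]_(p, q)} := HB.pack L LL.
by rewrite -[L]/(F : _ -> _) linearZ.
Qed.

Lemma rat_eq0 m n (f : C -> 'M[C]_(m, n)) (e : R) : rat d f -> 0 < e ->
  (forall v, 0 < `|v| < (e%:C)%C -> d v != 0 -> f v = 0) -> forall v, d v != 0 -> f v = 0.
Proof.
move=> [k [P hP fP]] e0 f0 v dv; apply/matrixP => i j; rewrite [RHS]mxE.
have := @polyfun_eq0 _ _ e (polyfunM dp (hP i j)) e0; move/(_ _ v).
have small x : 0 < `|x| < (e%:C)%C -> d x * P x i j = 0.
  move=> xI; have [->|dx] := eqVneq (d x) 0; first by rewrite mul0r.
  by rewrite -fP// f0// scaler0 mxE mulr0.
move=> /(_ small)/eqP; rewrite mulf_eq0 (negPf dv)/= -fP// mxE mulf_eq0.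
by rewrite expf_eq0 (negPf dv) andbF/= => /eqP.
Qed.
End Fixed.

Lemma rat_weaken d d' m n (f : C -> 'M[C]_(m, n)) : polyfun d -> polyfun d' ->
  rat d f -> rat (fun v => d v * d' v) f.
Proof.
move=> dp dp' [k [P hP fP]]; exists k, (fun v => d' v ^+ k *: P v).
  by apply: mpolyZ => //; exact: polyfunX.
by move=> v; rewrite mulf_eq0 => /norP[dv dv']; rewrite -fP// scalerA exprMn mulrC.
Qed.

Lemma rat_comp d m n (f : C -> 'M[C]_(m, n)) g : polyfun g -> rat d f ->
  rat (fun v => d (g v)) (fun v => f (g v)).
Proof.
move=> hg [k [P hP fP]]; exists k, (fun v => P (g v)); first exact: mpoly_comp.
by move=> v; exact: fP.
Qed.
End RationalMatrices.

(** * Gauge transformations *)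

Section TripleGauge.
Variables (R : realType) (N : nat).
Local Notation C := (Cplx R).
Local Notation A := ('M[C]_N).
Local Notation AA := (tens2 R N).
Local Notation AAA := (tens3 R N).
Implicit Types (s t u : AA) (a b x y z : A).

Lemma tensmx_1 m n : (1%:M : 'M[C]_m) *t (1%:M : 'M[C]_n) = 1%:M.
Proof.
apply/matrixP => p q; case: (mxtens_indexP p) => i k; case: (mxtens_indexP q) => j l.
by rewrite tensmxE !mxE mxtens_index_eq -natrM mulnb.
Qed.

Lemma mder_tens (F G : C -> A) v D D' : mder F v D -> mder G v D' ->
  mder (fun w => F w *t G w) v (D *t G v + F v *t D').
Proof.
move=> hF hG p q; case: (mxtens_indexP p) => i k; case: (mxtens_indexP q) => j l.
rewrite mxE !tensmxE (_ : (fun=> _) = (fun w => F w i j * G w k l)); last first.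
  by apply/funext => w; rewrite tensmxE.
exact: (hasderM (hF i j) (hG k l)).
Qed.

Lemma tens_mexp al (E : C -> A) : is_mexp al E ->
  is_mexp (al *t (1%:M : A) + (1%:M : A) *t al) (fun v => E v *t E v).
Proof.
case=> E0 dE Eal; split.
- by rewrite E0; exact: tens_11.
- move=> v; apply: mder_eq; first exact: (mder_tens (dE v) (dE v)).
  by rewrite mulmxDl !tensmx_mul !mul1mx.
- by move=> v; rewrite mulmxDl mulmxDr !tensmx_mul !mul1mx !mulmx1 Eal.
Qed.

Lemma leg13_comm s x : ((1%:M : A) *t x *t (1%:M : A)) *m leg13 s =
  leg13 s *m ((1%:M : A) *t x *t (1%:M : A)).
Proof.
rewrite /leg13 /tens_lift; do 4! [rewrite mulmx_sumr mulmx_suml; apply: eq_bigr => ? _].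
by rewrite -scalemxAl -scalemxAr !tensmx_mul !mulmx1 !mul1mx.
Qed.

Lemma leg12_comm s x : ((1%:M : A) *t (1%:M : A) *t x) *m leg12 s =
  leg12 s *m ((1%:M : A) *t (1%:M : A) *t x).
Proof.
rewrite /leg12 /tens_lift; do 4! [rewrite mulmx_sumr mulmx_suml; apply: eq_bigr => ? _].
by rewrite -scalemxAl -scalemxAr !tensmx_mul !mulmx1 !mul1mx.
Qed.

Lemma conj_split n (g h hi gi x : 'M[C]_n) : h *m x = x *m h -> h *m hi = 1%:M ->
  g *m x *m gi = (g *m h) *m x *m (hi *m gi).
Proof.
move=> hx hhi; rewrite -!mulmxA [h *m _]mulmxA hx -!mulmxA.
by rewrite [h *m (hi *m _)]mulmxA hhi mul1mx.
Qed.

Lemma conj_mul n (g gi x y : 'M[C]_n) : gi *m g = 1%:M ->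
  (g *m x *m gi) *m (g *m y *m gi) = g *m (x *m y) *m gi.
Proof.
by move=> h; rewrite -!mulmxA [gi *m (g *m _)]mulmxA h mul1mx.
Qed.

Lemma conj_comm n (a x t y : 'M[C]_n) : a *m x = x *m a -> a *m t = t *m a ->
  a *m y = y *m a -> a *m (x *m t *m y) = (x *m t *m y) *m a.
Proof. by move=> ax at_ ay; rewrite !mulmxA ax -(mulmxA x) at_ -!mulmxA ay. Qed.

Lemma conj_eq0 n (g gi x : 'M[C]_n) : gi *m g = 1%:M -> g *m x *m gi = 0 -> x = 0.
Proof.
move=> h h0; have h' : g *m gi = 1%:M by exact: mulmx1C.
have := congr1 (fun y : 'M[C]_n => gi *m y *m g) h0.
by rewrite mulmx0 mul0mx !mulmxA h mul1mx -mulmxA h mulmx1.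
Qed.

Lemma conj_AYBE n (g gi x y z x' y' z' : 'M[C]_n) : gi *m g = 1%:M ->
  x' = g *m x *m gi -> y' = g *m y *m gi -> z' = g *m z *m gi ->
  x' *m y' - z' *m x' + y' *m z' = g *m (x *m y - z *m x + y *m z) *m gi.
Proof.
by move=> h -> -> ->; rewrite !conj_mul// !(mulmxDr, mulmxDl) mulmxN mulNmx.
Qed.

Lemma conj_CYBE n (g gi x y z x' y' z' : 'M[C]_n) : gi *m g = 1%:M ->
  x' = g *m x *m gi -> y' = g *m y *m gi -> z' = g *m z *m gi ->
  mxcomm x y - mxcomm z x + mxcomm y z = 0 -> mxcomm x' y' - mxcomm z' x' + mxcomm y' z' = 0.
Proof.
move=> h -> -> -> e.
have cm (a a' : 'M[C]_n) : mxcomm (g *m a *m gi) (g *m a' *m gi) = g *m mxcomm a a' *m gi.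
  by rewrite /mxcomm (conj_mul a a' h) (conj_mul a' a h) mulmxBr mulmxBl.
by rewrite (cm x y) (cm z x) (cm y z) -mulmxBl -mulmxBr -mulmxDl -mulmxDr e mulmx0 mul0mx.
Qed.

Lemma conj_opAYBE n (g gi x y z x' y' z' : 'M[C]_n) : gi *m g = 1%:M ->
  x' = g *m x *m gi -> y' = g *m y *m gi -> z' = g *m z *m gi ->
  y *m x - x *m z + z *m y = 0 -> y' *m x' - x' *m z' + z' *m y' = 0.
Proof.
move=> h -> -> -> e; rewrite (conj_mul y x h) (conj_mul x z h) (conj_mul z y h).
by rewrite -mulmxBl -mulmxBr -mulmxDl -mulmxDr e mulmx0 mul0mx.
Qed.

Section Exp.
Variables (al : A) (E : C -> A).
Hypothesis EP : is_mexp al E.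

Definition Ad v t : AA := ((1%:M : A) *t E v) *m t *m ((1%:M : A) *t E (- v)).

Lemma AdK v t : Ad v (Ad (- v) t) = t.
Proof.
rewrite /Ad opprK -!mulmxA tens_1M (mexp_opp EP) tens_11 mulmx1 !mulmxA.
by rewrite tens_1M (mexp_opp EP) tens_11 mul1mx.
Qed.

Lemma AdM v s t : Ad v (s *m t) = Ad v s *m Ad v t.
Proof. by rewrite /Ad conj_mul// tens_1M (mexpN EP) tens_11. Qed.

Lemma inv_EE t v : inv_by al t -> (E v *t E v) *m t = t *m (E v *t E v).
Proof. by move=> h; apply/esym; apply: (mexp_comm (tens_mexp EP)); exact: esym. Qed.

Lemma triple_gauge v w s t u : inv_by al u -> exists g gi : AAA, [/\ gi *m g = 1%:M,
  leg12 (Ad v s) = g *m leg12 s *m gi,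
  leg13 (Ad (v + w) t) = g *m leg13 t *m gi &
  leg23 (Ad w u) = g *m leg23 u *m gi].
Proof.
move=> hu; exists ((1%:M : A) *t E v *t E (v + w)), ((1%:M : A) *t E (- v) *t E (- (v + w))).
have Evv (x : C) : E (- x) *m E x = 1%:M by exact: (mexpN EP).
have Ev (x : C) : E x *m E (- x) = 1%:M by exact: (mexp_opp EP).
have one3 : (1%:M : A) *t (1%:M : A) *t (1%:M : A) = 1%:M :> AAA.
  by rewrite !tensmx_1.
split.
- by rewrite !tensmx_mul !Evv mulmx1; exact: one3.
- rewrite /Ad !leg12M !leg12_tens.
  rewrite (conj_split _ _ (leg12_comm s (E (v + w))) (hi := (1%:M : A) *t (1%:M : A) *t E (- (v + w)))).
    by rewrite !tensmx_mul !mulmx1 !mul1mx.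
  by rewrite !tensmx_mul !Ev mulmx1; exact: one3.
- rewrite /Ad !leg13M !leg13_tens.
  rewrite (conj_split _ _ (leg13_comm t (E v)) (hi := (1%:M : A) *t E (- v) *t (1%:M : A))).
    by rewrite !tensmx_mul !mulmx1 !mul1mx.
  by rewrite !tensmx_mul !Ev mulmx1; exact: one3.
- rewrite -!leg23_tens -!leg23M /Ad.
  rewrite [in LHS](conj_split _ _ (inv_EE v hu) (hi := E (- v) *t E (- v))).
    rewrite !tensmx_mul !mul1mx -!(mexp_add EP).
    by rewrite [w + v]addrC opprD ?mulmx1.
  by rewrite tensmx_mul !Ev; exact: tens_11.
Qed.

End Exp.
End TripleGauge.

Section Model.
Variables (R : realType) (N : nat).
Local Notation C := (Cplx R).
Local Notation A := ('M[C]_N).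
Local Notation AA := (tens2 R N).
Local Notation AAA := (tens3 R N).
Implicit Types (s t u : AA) (v w : C).
Variables (al b : A) (E : C -> A) (c : C) (eps : R) (r Q : C -> AA) (d : C -> C).
Hypotheses (EP : is_mexp al E) (eps0 : 0 < eps) (dp : polyfun d) (Qrat : rat d Q)
  (alb : al *m b = b *m al).
Local Notation inb v := (0 < `|v| < (eps%:C)%C).
Local Notation Ad := (Ad E).

Lemma Ad_inv a v t : a *m al = al *m a -> inv_by a t -> inv_by a (Ad v t).
Proof.
move=> aal at_; have aE w := mexp_comm EP w aal.
have com w : (a *t (1%:M : A) + (1%:M : A) *t a) *m ((1%:M : A) *t E w) =
    ((1%:M : A) *t E w) *m (a *t (1%:M : A) + (1%:M : A) *t a).
  by rewrite mulmxDl mulmxDr !tensmx_mul !mul1mx !mulmx1 aE.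
exact: conj_comm.
Qed.

Lemma Ad_ptr2 v t : ptr2 (Ad v t) = ptr2 t.
Proof.
by rewrite /Ad -mulmxA ptr2_swap2 -mulmxA tens_1M (mexpN EP) tens_11 mulmx1.
Qed.

Lemma Ad_scalar v k : Ad v k%:M = k%:M.
Proof.
by rewrite /Ad mul_mx_scalar -scalemxAl tens_1M (mexp_opp EP) tens_11 scalemx1.
Qed.

Lemma AdD v s t : Ad v (s + t) = Ad v s + Ad v t.
Proof. by rewrite /Ad mulmxDr mulmxDl. Qed.

Lemma AdZ v k t : Ad v (k *: t) = k *: Ad v t.
Proof. by rewrite /Ad -scalemxAr -scalemxAl. Qed.

Lemma AdNK v t : Ad (- v) (Ad v t) = t.
Proof. by have := AdK EP (- v) t; rewrite opprK. Qed.

(* The two legs can be interchanged because [t] commutes with [E v (x) E v]. *)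
Lemma Ad_flip v t : inv_by al t -> flip (Ad v t) = Ad (- v) (flip t).
Proof.
move=> alt; rewrite /Ad !flipM !flip_tens opprK.
have ft : flip (E v *t E v) *m flip t = flip t *m flip (E v *t E v).
  by rewrite -!flipM (inv_EE EP v alt).
rewrite flip_tens in ft.
rewrite [in RHS](conj_split _ _ ft (hi := E (- v) *t E (- v))).
  by rewrite !tensmx_mul !mul1mx !mulmx1 !(mexpN EP).
by rewrite tensmx_mul !(mexp_opp EP) tens_11.
Qed.

Hypotheses (ball : forall v, inb v -> [/\ d v != 0, r v = Ad v (Q v),
    r v *m r v = ((c / v) ^+ 2)%:M & ptr2 (r v) = N%:R *: b + (c / v)%:M])
  (ball_al : forall v, inb v -> inv_by al (r v))
  (ball_b : forall v, inb v -> inv_by b (r v))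
  (ball_flip : forall v, inb v -> r (- v) = - flip (r v))
  (ball_AYBE : forall v w, inb v -> inb w -> inb (v + w) -> AYBEt (r v) (r (v + w)) (r w)).

Lemma inb_Q v : inb v -> Q v = Ad (- v) (r v).
Proof. by move=> vI; have [_ -> _ _] := ball vI; rewrite AdNK. Qed.

Lemma inbN v : inb v -> inb (- v). Proof. by rewrite normrN. Qed.

Lemma rat_inv_by a : rat d (fun v => (a *t (1%:M : A) + (1%:M : A) *t a) *m Q v -
   Q v *m (a *t (1%:M : A) + (1%:M : A) *t a)).
Proof. by apply: (ratB dp); apply: ratM => //; exact: rat_cst. Qed.

Lemma Q_inv a : a *m al = al *m a -> (forall v, inb v -> inv_by a (r v)) ->
  forall v, d v != 0 -> inv_by a (Q v).
Proof.
move=> aal ra v dv; apply/subr0_eq; apply: (rat_eq0 dp (rat_inv_by a) eps0) dv.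
move=> w wI _; rewrite (inb_Q wI); apply/eqP; rewrite subr_eq0; apply/eqP.
exact: (Ad_inv _ aal (ra w wI)).
Qed.

Lemma Q_al v : d v != 0 -> inv_by al (Q v). Proof. exact: Q_inv. Qed.
Lemma Q_b v : d v != 0 -> inv_by b (Q v). Proof. exact: Q_inv. Qed.

Lemma Q_flip v : d v != 0 -> d (- v) != 0 -> Q (- v) = - flip (Q v).
Proof.
move=> dv dNv; have Np : polyfun (fun v : C => - v) by apply: polyfunN; exact: polyfun_id.
have d'p := polyfun_comp dp Np.
have fl : linear (@flip R N) by move=> k s t; exact: flip_lin.
have h : rat (fun v => d v * d (- v)) (fun v => Q (- v) + flip (Q v)).
  apply: (ratD (polyfunM dp d'p)); last exact: (rat_linear fl (rat_weaken dp d'p Qrat)).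
  rewrite (_ : (fun v => d v * d (- v)) = (fun v => d (- v) * d v)).
    exact: (rat_weaken d'p dp (rat_comp Np Qrat)).
  by apply/funext => w; rewrite mulrC.
have dd : d v * d (- v) != 0 by rewrite mulf_neq0.
apply/eqP; rewrite -addr_eq0; apply/eqP.
apply: (rat_eq0 (polyfunM dp d'p) h eps0) dd => w wI _.
rewrite (inb_Q wI) (inb_Q (inbN wI)) (ball_flip wI) Ad_flip; last exact: ball_al.
have -> : - flip (r w) = (-1) *: flip (r w) by rewrite scaleN1r.
by rewrite AdZ scaleN1r addNr.
Qed.

Lemma Q_sq v : v != 0 -> d v != 0 -> Q v *m Q v = ((c / v) ^+ 2)%:M.
Proof.
move=> v0 dv.
have h : rat d (fun v => v ^+ 2 *: (Q v *m Q v) - (c ^+ 2)%:M).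
  apply: (ratB dp); last exact: rat_cst.
  by apply: ratZ; [apply: polyfunX; exact: polyfun_id | exact: ratM].
have := rat_eq0 dp h eps0 _ dv; move/(_ _)/subr0_eq => h'.
apply: (scalerI (expf_neq0 2 v0)); rewrite h'; first by rewrite scale_scalar_mx -exprMn [v * _]mulrC divfK.
move=> w /[dup] wI /andP[w0 _] _; rewrite normr_gt0 in w0; have [_ _ sq _] := ball wI.
rewrite (inb_Q wI) -(AdM EP) sq Ad_scalar scale_scalar_mx -exprMn [w * _]mulrC divfK//.
by rewrite subrr.
Qed.

Lemma ptr2_linear : linear (@ptr2 R N).
Proof.
move=> k s t; apply/matrixP => i j; rewrite !mxE mulr_sumr -big_split/=.
by apply: eq_bigr => l _; rewrite coD coZ.
Qed.

Lemma Q_ptr2 v : v != 0 -> d v != 0 -> ptr2 (Q v) = N%:R *: b + (c / v)%:M.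
Proof.
move=> v0 dv.
have h : rat d (fun v => v *: (ptr2 (Q v) - N%:R *: b) - c%:M).
  apply: (ratB dp); last exact: rat_cst.
  apply: ratZ; first exact: polyfun_id.
  by apply: (ratB dp); [exact: (rat_linear ptr2_linear) | exact: rat_cst].
have := rat_eq0 dp h eps0 _ dv; move/(_ _)/subr0_eq => h'.
apply/eqP; rewrite addrC -subr_eq; apply/eqP; apply: (scalerI v0); rewrite h'; first by rewrite scale_scalar_mx [v * _]mulrC divfK.
move=> w /[dup] wI /andP[w0 _] _; rewrite normr_gt0 in w0; have [_ _ _ pq] := ball wI.
rewrite (inb_Q wI) Ad_ptr2 pq [_ + (c / w)%:M]addrC addrK scale_scalar_mx [w * _]mulrC divfK//.
by rewrite subrr.
Qed.

Lemma leg_linear : [/\ linear (@leg12 R N), linear (@leg13 R N) & linear (@leg23 R N)].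
Proof.
by split=> k s t; [exact: leg12_lin | exact: leg13_lin | exact: leg23_lin].
Qed.

Definition ayexpr s t u : AAA := leg12 s *m leg13 t - leg23 u *m leg12 s + leg13 t *m leg23 u.

Lemma rat_ayexpr (D : C -> C) (F G H : C -> AA) : polyfun D ->
  rat D F -> rat D G -> rat D H -> rat D (fun x => ayexpr (F x) (G x) (H x)).
Proof.
move=> Dp hF hG hH; have [l12 l13 l23] := leg_linear.
have F12 := rat_linear l12 hF; have G13 := rat_linear l13 hG; have H23 := rat_linear l23 hH.
apply: (ratD Dp); last exact: ratM.
by apply: (ratB Dp); exact: ratM.
Qed.

Lemma ball_QAYBE v w : inb v -> inb w -> inb (v + w) -> ayexpr (Q v) (Q (v + w)) (Q w) = 0.
Proof.
move=> vI wI vwI; have h := ball_AYBE vI wI vwI.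
have [dv rv _ _] := ball vI; have [dw rw _ _] := ball wI; have [dvw rvw _ _] := ball vwI.
have [g [gi [gg g12 g13 g23]]] := triple_gauge EP v w (Q v) (Q (v + w)) (Q_al dw).
rewrite -rv -rvw -rw in g12 g13 g23.
have e := conj_AYBE gg g12 g13 g23.
apply: (conj_eq0 gg); apply: etrans (esym e) _; exact: h.
Qed.

Lemma Q_AYBE v w : d v != 0 -> d w != 0 -> d (v + w) != 0 -> ayexpr (Q v) (Q (v + w)) (Q w) = 0.
Proof.
move=> dv dw dvw.
have Dp (a : C) : polyfun (fun x : C => x + a).
  by apply: polyfunD; [exact: polyfun_id | exact: polyfun_cst].
have Dp' (a : C) : polyfun (fun x : C => a + x).
  by apply: polyfunD; [exact: polyfun_cst | exact: polyfun_id].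
have step1 y : 0 < `|y| < ((eps / 2)%:C)%C -> forall x, d x * d (x + y) != 0 ->
    ayexpr (Q x) (Q (x + y)) (Q y) = 0.
  move=> /andP[y0 ye]; have dyp := polyfun_comp dp (Dp y).
  have h : rat (fun x => d x * d (x + y)) (fun x => ayexpr (Q x) (Q (x + y)) (Q y)).
    apply: rat_ayexpr.
    - exact: polyfunM.
    - exact: (rat_weaken dp dyp Qrat).
    - rewrite (_ : (fun x => d x * d (x + y)) = (fun x => d (x + y) * d x)).
        exact: (rat_weaken dyp dp (rat_comp (Dp y) Qrat)).
      by apply/funext => x; rewrite mulrC.
    - exact: rat_cst.
  have [e e0 ey] := normC_real y.
  have e0' : 0 < e by move: y0; rewrite ey ltcR.
  apply: (rat_eq0 (polyfunM dp dyp) h e0') => x /andP[x0 xe] _.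
  rewrite -ey in xe.
  have halves : ((eps / 2)%:C)%C + ((eps / 2)%:C)%C = (eps%:C)%C :> C.
    by rewrite -rmorphD -splitr.
  have he2 : ((eps / 2)%:C)%C < (eps%:C)%C :> C.
    by rewrite ltcR ltr_pdivrMr// ltr_pMr// ltr1n.
  have yI : inb y by rewrite y0 (lt_trans ye he2).
  have xI : inb x by rewrite x0 (lt_trans xe (lt_trans ye he2)).
  apply: ball_QAYBE => //; apply/andP; split.
    rewrite normr_gt0 addr_eq0; apply/eqP => xy; move: xe.
    by rewrite xy normrN ltxx.
  apply: le_lt_trans (ler_normD _ _) _; rewrite -halves; apply: ltrD => //.
  exact: lt_trans xe ye.
have dvp := polyfun_comp dp (Dp' v).
have h : rat (fun y => d y * d (v + y)) (fun y => ayexpr (Q v) (Q (v + y)) (Q y)).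
  apply: rat_ayexpr.
  - exact: polyfunM.
  - exact: rat_cst.
  - rewrite (_ : (fun x => d x * d (v + x)) = (fun x => d (v + x) * d x)).
      exact: (rat_weaken dvp dp (rat_comp (Dp' v) Qrat)).
    by apply/funext => x; rewrite mulrC.
  - exact: (rat_weaken dp dvp Qrat).
have e20 : 0 < eps / 2 by rewrite divr_gt0.
have dd : d w * d (v + w) != 0 by rewrite mulf_neq0.
apply: (rat_eq0 (polyfunM dp dvp) h e20) dd => y yI dd'.
apply: step1 => //; apply: mulf_neq0 => //.
by apply: contraNneq dd' => ->; rewrite mulr0.
Qed.

Lemma Q_opAYBE v w : d v != 0 -> d w != 0 -> d (v + w) != 0 ->
  d (- v) != 0 -> d (- w) != 0 -> d (- (v + w)) != 0 -> opAYBEt (Q v) (Q (v + w)) (Q w).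
Proof.
move=> dv dw dvw dNv dNw dNvw; apply: AYBEt_flip.
rewrite -(Q_flip dw dNw) -(Q_flip dvw dNvw) -(Q_flip dv dNv) opprD addrC.
by apply: Q_AYBE => //; rewrite -opprD addrC.
Qed.
End Model.

(** * Meromorphic functions *)

Section Meromorphic.
Variable R : realType.
Local Notation C := (Cplx R).

Lemma entire_holo m n (f : C -> 'M[C]_(m, n)) : (forall v, exists D, mder f v D) ->
  forall z, holomorphic_at f z.
Proof. by move=> hf z; apply: der_holo; apply/nearCP; exists 1 => // w _; exact: hf. Qed.

Lemma holoM m n p (f : C -> 'M[C]_(m, n)) (g : C -> 'M[C]_(n, p)) z :
  holomorphic_at f z -> holomorphic_at g z -> holomorphic_at (fun w => f w *m g w) z.
Proof.
move=> /holo_der hf /holo_der hg; apply: der_holo; apply: filterS2 hf hg => w [D hD] [D' hD'].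
by exists (D *m g w + f w *m D'); exact: (mderM hD hD').
Qed.

Lemma holoD m n (f g : C -> 'M[C]_(m, n)) z :
  holomorphic_at f z -> holomorphic_at g z -> holomorphic_at (fun w => f w + g w) z.
Proof.
move=> /holo_der hf /holo_der hg; apply: der_holo; apply: filterS2 hf hg => w [D hD] [D' hD'].
by exists (D + D'); exact: (mderD hD hD').
Qed.

Lemma poly_holoZ m n (p : C -> C) (f : C -> 'M[C]_(m, n)) z : polyfun p ->
  holomorphic_at f z -> holomorphic_at (fun w => p w *: f w) z.
Proof.
move=> pp /holo_der hf; apply: der_holo; apply: filterS hf => w [D hD].
have [d hd] := hasder_polyfun w pp.
by exists (d *: f w + p w *: D); exact: (mderZ hd hD).
Qed.

Lemma powsub_poly (z : C) k : polyfun (fun w : C => (w - z) ^+ k).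
Proof. by apply: polyfunX; apply: polyfunB; [exact: polyfun_id | exact: polyfun_cst]. Qed.

Variable U : set C.

Lemma mero_holo m n (f : C -> 'M[C]_(m, n)) : (forall z, U z -> holomorphic_at f z) ->
  meromorphic_on U f.
Proof.
move=> hf z Uz; exists 0, f; split; first exact: hf.
by apply/dnearCP; exists 1 => // w _; rewrite expr0 scale1r.
Qed.

Lemma meroM m n p (f : C -> 'M[C]_(m, n)) (g : C -> 'M[C]_(n, p)) :
  meromorphic_on U f -> meromorphic_on U g -> meromorphic_on U (fun w => f w *m g w).
Proof.
move=> hf hg z Uz; have [k [f' [ff fE]]] := hf z Uz; have [l [g' [gg gE]]] := hg z Uz.
exists (k + l)%N, (fun w => f' w *m g' w); split; first exact: holoM.
by apply: filterS2 fE gE => w <- <-; rewrite -scalemxAl -scalemxAr scalerA exprD.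
Qed.

Lemma meroD m n (f g : C -> 'M[C]_(m, n)) :
  meromorphic_on U f -> meromorphic_on U g -> meromorphic_on U (fun w => f w + g w).
Proof.
move=> hf hg z Uz; have [k [f' [ff fE]]] := hf z Uz; have [l [g' [gg gE]]] := hg z Uz.
exists (k + l)%N, (fun w => (w - z) ^+ l *: f' w + (w - z) ^+ k *: g' w); split.
  by apply: holoD; apply: poly_holoZ => //; exact: powsub_poly.
apply: filterS2 fE gE => w <- <-; rewrite !scalerA -!exprD scalerDr.
by rewrite (addnC l).
Qed.

Lemma mero_near m n (f g : C -> 'M[C]_(m, n)) : (forall z, U z -> \forall w \near z^', f w = g w) ->
  meromorphic_on U f -> meromorphic_on U g.
Proof.
move=> fg hf z Uz; have [k [f' [ff fE]]] := hf z Uz; exists k, f'; split => //.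
by apply: filterS2 fE (fg z Uz) => w <- ->.
Qed.

Definition gen_poly (d : C -> C) := exists2 p : {poly C}, p != 0 & forall v, d v = p.[v].

Lemma gen_polyP d v : polyfun d -> d v != 0 -> gen_poly d.
Proof.
by case=> p hp dv; exists p => //; apply: contraNneq dv => p0; rewrite hp p0 horner0.
Qed.

Lemma gen_polyM d d' : gen_poly d -> gen_poly d' -> gen_poly (fun v => d v * d' v).
Proof.
move=> [p p0 hp] [q q0 hq]; exists (p * q); first exact: mulf_neq0.
by move=> v; rewrite hornerM hp hq.
Qed.

Lemma gen_near d z : gen_poly d -> \forall w \near z^', d w != 0.
Proof.
by case=> p p0 hp; apply: filterS (poly_near_neq0 z p0) => w; rewrite hp.
Qed.

Lemma rat_mero d m n (f : C -> 'M[C]_(m, n)) : gen_poly d -> rat d f -> meromorphic_on U f.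
Proof.
move=> dg [k [P Pp fP]] z Uz; have [p p0 hp] := dg.
have [l [q]] := multiplicity_XsubC p z; rewrite p0/= => qz pE.
have qp : polyfun (horner q) by exists q.
exists (l * k)%N, (fun w => (q.[w] ^+ k)^-1 *: P w); split.
  have qw : \forall x \near z, q.[x] != 0.
    exact: (tends_neq0 qz (hasder_tends (hasder_poly q z))).
  apply: der_holo; apply: filterS qw => w qw.
  have [a ha] := hasder_polyfun w (polyfunX k qp).
  have [D hD] : exists D, mder P w D.
    exists (\matrix_(i, j) 'D_1 (fun v => P v i j : C^o) w) => i j; rewrite mxE.
    by have [x [dx _]] := hasder_polyfun w (Pp i j); split.
  by eexists; exact: (mderZ (@hasderV _ (fun x => q.[x] ^+ k) _ _ (expf_neq0 k qw) ha) hD).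
apply: filterS (gen_near z dg) => w dw; rewrite -fP// scalerA; congr (_ *: _).
have qw0 : q.[w] != 0 by move: dw; rewrite hp pE hornerM mulf_eq0 negb_or => /andP[].
rewrite hp pE hornerM horner_exp hornerXsubC exprMn mulKf ?expf_neq0//.
by rewrite exprM.
Qed.

Lemma rat_rational d m n (f : C -> 'M[C]_(m, n)) : gen_poly d -> rat d f -> rational_function f.
Proof.
move=> [q q0 hq] [k [P Pp fP]].
have rowP i : exists f : 'I_n -> {poly C}, forall j v, P v i j = (f j).[v].
  have [a ha] := @boolp.choice _ _ (fun j (x : {poly C}) => forall v, P v i j = x.[v]) (Pp i).
  by exists a.
have [p pP] := @boolp.choice _ _ _ rowP.
exists (\matrix_(i, j) (q * p i j)), (q ^+ k.+1); split; first exact: expf_neq0.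
move=> v; rewrite horner_exp expf_eq0/= => qv.
have dv : d v != 0 by rewrite hq.
apply: (scalerI (expf_neq0 k.+1 qv)); rewrite scalerA mulfV ?expf_neq0// scale1r.
by apply/matrixP => i j; rewrite !mxE hornerM -pP -(fP v dv) mxE -hq mulrA exprS.
Qed.
End Meromorphic.

Section Extension.
Variable R : realType.
Local Notation C := (Cplx R).
Variables (m n p q : nat) (U : set C) (f : C -> 'M[C]_(m, n)) (G : C -> Prop).
Hypothesis Gg : forall z, U z -> \forall w \near z^', G w.
Local Notation reg := (regular_pt U f).

Lemma dnear_shift (z a : C) (P : C -> Prop) : a != 0 -> (\forall w \near z^', P w) ->
  \forall t \near (0 : C)^', P (z + a * t).
Proof.
move=> a0 /dnearCP[e e0 H]; have [x x0 ax] := normC_real a.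
have x1 : 0 < x by move: a0; rewrite -normr_gt0 ax ltcR.
apply/dnearCP; exists (e / x) => [|t]; first by rewrite divr_gt0.
rewrite subr0 => /andP[t0 te]; apply: H; rewrite addrAC subrr add0r normrM ax.
have xC : 0 < (x%:C)%C :> C by rewrite ltcR.
apply/andP; split; first by rewrite mulr_gt0.
have -> : (e%:C)%C = (x%:C)%C * ((e / x)%:C)%C :> C.
  by rewrite -rmorphM mulrC divfK// gt_eqF.
by rewrite ltr_pM2l.
Qed.

Lemma reg_tends v a : reg v -> mtends (0 : C)^' (fun t => f (v + a * t)) (f v).
Proof.
case=> Uv /holo_der/nbhs_singleton[D hD] i j.
have fD : mtends (nbhs v) f (f v) by exact: mder_tends hD.
have ft : tends (nbhs v) (fun x => f x i j) (f v i j) by exact: (fD i j).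
apply/tendsP => e e0.
have : \forall w \near v, `|f v i j - f w i j| <= e 
  by exact: ((tendsP (fun x => f x i j) (f v i j)).1 ft e e0).
case/nearCP => d d0 H.
have [x x0 ax] := normC_real a.
apply/dnearCP; exists (d / (x + 1)) => [|t]; first by rewrite divr_gt0// ltr_wpDl.
rewrite subr0 => /andP[t0 td]; apply: H; rewrite addrAC subrr add0r normrM ax.
have x1 : 0 < x + 1 by rewrite ltr_wpDl.
apply: le_lt_trans (_ : ((x + 1)%:C)%C * `|t| < _).
  by apply: ler_wpM2r => //; rewrite lecR lerDl.
rewrite -ltr_pdivlMl ?ltcR//; apply: lt_le_trans td _.
by rewrite rmorphM fmorphV mulrC.
Qed.

Lemma extend1 (Phi : 'M[C]_(m, n) -> 'M[C]_(p, q)) :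
  (forall (F : C -> 'M[C]_(m, n)) X, mtends (0 : C)^' F X ->
     mtends (0 : C)^' (fun x => Phi (F x)) (Phi X)) ->
  (forall v, G v -> Phi (f v) = 0) -> forall v, reg v -> Phi (f v) = 0.
Proof.
move=> cP h v rv; have [Uv _] := rv.
have h1 := cP _ _ (reg_tends 1 rv).
have h0 : mtends (0 : C)^' (fun=> 0 : 'M[C]_(p, q)) 0 by exact: mtends_cst.
apply: mtends_unique h1 _; apply: mtends_near h0.
by apply: filterS (dnear_shift (oner_neq0 _) (Gg Uv)) => t /h ->.
Qed.

Lemma extend2 (Phi : 'M[C]_(m, n) -> 'M[C]_(m, n) -> 'M[C]_(p, q)) :
  (forall (F F' : C -> 'M[C]_(m, n)) X X', mtends (0 : C)^' F X -> mtends (0 : C)^' F' X' ->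
     mtends (0 : C)^' (fun x => Phi (F x) (F' x)) (Phi X X')) ->
  (forall v, G v -> G (- v) -> Phi (f v) (f (- v)) = 0) ->
  forall v, reg v -> reg (- v) -> Phi (f v) (f (- v)) = 0.
Proof.
move=> cP h v rv rNv; have [Uv _] := rv; have [UNv _] := rNv.
have h1 := cP _ _ _ _ (reg_tends 1 rv) (reg_tends (-1) rNv).
have h0 : mtends (0 : C)^' (fun=> 0 : 'M[C]_(p, q)) 0 by exact: mtends_cst.
apply: mtends_unique h1 _; apply: mtends_near h0.
have N1 : (-1 : C) != 0 by rewrite oppr_eq0 oner_neq0.
apply: filterS2 (dnear_shift (oner_neq0 _) (Gg Uv)) (dnear_shift N1 (Gg UNv)) => t g1 g2.
have e : - v + -1 * t = - (v + 1 * t) by rewrite mulN1r mul1r opprD.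
by rewrite e h// -e.
Qed.

Lemma extend3 (Phi : 'M[C]_(m, n) -> 'M[C]_(m, n) -> 'M[C]_(m, n) -> 'M[C]_(p, q)) :
  (forall (F F' F'' : C -> 'M[C]_(m, n)) X X' X'', mtends (0 : C)^' F X ->
     mtends (0 : C)^' F' X' -> mtends (0 : C)^' F'' X'' ->
     mtends (0 : C)^' (fun x => Phi (F x) (F' x) (F'' x)) (Phi X X' X'')) ->
  (forall v w, G v -> G w -> G (v + w) -> Phi (f v) (f (v + w)) (f w) = 0) ->
  forall v w, reg v -> reg w -> reg (v + w) -> Phi (f v) (f (v + w)) (f w) = 0.
Proof.
move=> cP h v w rv rw rvw; have [Uv _] := rv; have [Uw _] := rw; have [Uvw _] := rvw.
have h1 := cP _ _ _ _ _ _ (reg_tends 1 rv) (reg_tends 2 rvw) (reg_tends 1 rw).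
have h0 : mtends (0 : C)^' (fun=> 0 : 'M[C]_(p, q)) 0 by exact: mtends_cst.
apply: mtends_unique h1 _; apply: mtends_near h0.
have N2 : (2 : C) != 0 by rewrite pnatr_eq0.
apply: filterS3 (dnear_shift (oner_neq0 _) (Gg Uv)) (dnear_shift (oner_neq0 _) (Gg Uw))
  (dnear_shift N2 (Gg Uvw)) => t g1 g2 g3.
have e : v + w + 2 * t = (v + 1 * t) + (w + 1 * t) by ring.
by rewrite e h// -e.
Qed.
End Extension.

(** * Traceless tensors *)

Section TracelessTensors.
Variables (R : realType) (N : nat).
Hypothesis N0 : (0 < N)%N.
Local Notation C := (Cplx R).
Local Notation A := ('M[C]_N).
Local Notation AA := (tens2 R N).
Implicit Types (s t u : AA) (a b x y : A).

Lemma tens_expand t : t = \sum_i \sum_j \sum_k \sum_l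
  t (mxtens_index (i, k)) (mxtens_index (j, l)) *: (delta_mx i j *t delta_mx k l).
Proof.
apply: coP => i k j l; rewrite [in RHS]/co summxE -[LHS]mulr1.
rewrite -(sum4 (fun i j k l => co t i k j l) i j k l 1).
apply: eq_bigr => i' _; rewrite summxE; apply: eq_bigr => j' _.
rewrite summxE; apply: eq_bigr => k' _; rewrite summxE; apply: eq_bigr => l' _.
by rewrite mxE tensmxE !mxE -!mulnb !natrM mulr1.
Qed.

Lemma tens_map_conj a a' b b' t :
  tens_map (fun x => a *m x *m a') (fun x => b *m x *m b') t = (a *t b) *m t *m (a' *t b').
Proof.
rewrite {2}(tens_expand t) /tens_map /tens_lift.
do 4! [rewrite mulmx_sumr mulmx_suml; apply: eq_bigr => ? _].
by rewrite -scalemxAr -scalemxAl !tensmx_mul.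
Qed.

Lemma scalar0 n : (0 : C)%:M = 0 :> 'M[C]_n.
Proof. by rewrite -scalemx1 scale0r. Qed.

Definition tl x : A := x - (\tr x / N%:R)%:M.

Lemma tr_tl x : \tr (tl x) = 0.
Proof. by rewrite linearB/= mxtrace_scalar -[X in _ - X]mulr_natr divfK ?subrr// NC0. Qed.

Lemma tl_sl x : sl x -> tl x = x.
Proof. by rewrite /sl/= /tl => ->; rewrite mul0r scalar0 subr0. Qed.

Lemma tr_blk t i j : \tr (blk t i j) = ptr2 t i j.
Proof. by rewrite mxE; apply: eq_bigr => k _; rewrite mxE. Qed.

Lemma in_tens_sl t : ptr1 t = 0 -> ptr2 t = 0 -> in_tens (@sl R N) t.
Proof.
move=> t1 t2; exists (N * N)%N, (fun x : 'I_(N * N) => tl (delta_mx (mxtens_unindex x).1 (mxtens_unindex x).2)),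
  (fun x : 'I_(N * N) => blk t (mxtens_unindex x).1 (mxtens_unindex x).2); split.
  by move=> x; split; [exact: tr_tl | rewrite /sl/= tr_blk t2 mxE].
apply: coP => i k j l; rewrite [in RHS]/co summxE.
rewrite (eq_bigr (fun x : 'I_(N * N) => tl (delta_mx (mxtens_unindex x).1 (mxtens_unindex x).2) i j *
    co t (mxtens_unindex x).1 k (mxtens_unindex x).2 l)); last by move=> x _; rewrite tensmxE [blk _ _ _ _ _]mxE.
rewrite sum_mxtens.
have -> : \sum_i' \sum_j' tl (delta_mx (mxtens_unindex (mxtens_index (i', j'))).1
      (mxtens_unindex (mxtens_index (i', j'))).2) i j *
    co t (mxtens_unindex (mxtens_index (i', j'))).1 k (mxtens_unindex (mxtens_index (i', j'))).2 l =
    \sum_i' \sum_j' (co t i' k j' l * ((i == i')%:R * (j == j')%:R) -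
      (i' == j')%:R * co t i' k j' l * ((i == j)%:R / N%:R)).
  apply: eq_bigr => i' _; apply: eq_bigr => j' _; rewrite mxtens_indexK/= !mxE.
  have -> : \tr (delta_mx i' j' : A) = (i' == j')%:R.
    rewrite /mxtrace -[RHS](sumD'l (fun p => (p == j')%:R) i').
    by apply: eq_bigr => p _; rewrite mxE -mulnb natrM.
  by rewrite -mulnb natrM -mulr_natr; ring.
under eq_bigr => i' _ do rewrite sumrB.
rewrite sumrB.
have -> : \sum_i' \sum_j' (i' == j')%:R * co t i' k j' l * ((i == j)%:R / N%:R) = 0.
  transitivity (ptr1 t k l * ((i == j)%:R / N%:R)); last by rewrite t1 mxE mul0r.
  rewrite mxE mulr_suml; apply: eq_bigr => i' _.
  by rewrite -mulr_suml (sumD'r (fun j' => co t i' k j' l)).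
rewrite subr0 -[LHS](sumDr (fun i' => co t i' k j l) i); apply: eq_bigr => i' _.
rewrite -(sumDr (fun j' => co t i' k j' l) j) mulr_suml.
by apply: eq_bigr => j' _; rewrite mulrA mulrAC.
Qed.

Definition flat t : 'M[C]_(N * N) := \matrix_(x, y)
  co t (mxtens_unindex x).1 (mxtens_unindex y).1 (mxtens_unindex x).2 (mxtens_unindex y).2.

Lemma flat_linear : linear flat.
Proof. by move=> k s t; apply/matrixP => x y; rewrite !mxE /co !mxE. Qed.

Lemma flat_contract (f : A -> C) t k l : Defs.contract f t k l =
  ((\row_(x < N * N) f (delta_mx (mxtens_unindex x).1 (mxtens_unindex x).2)) *m flat t) 0 (mxtens_index (k, l)).
Proof.
rewrite contractE mxE sum_mxtens; apply: eq_bigr => i _; apply: eq_bigr => j _.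
by rewrite !mxE !mxtens_indexK/= mulrC.
Qed.

Lemma flat_permt : flat (permt R N) *m flat (permt R N) = 1%:M.
Proof.
apply/matrixP => x y; case: (mxtens_indexP x) => i j; case: (mxtens_indexP y) => k l.
rewrite mxE sum_mxtens [RHS]mxE mxtens_index_eq -mulnb natrM.
transitivity (\sum_p \sum_q ((j == p)%:R * (p == l)%:R) * ((i == q)%:R * (q == k)%:R) : C).
  apply: eq_bigr => p _; apply: eq_bigr => q _.
  rewrite !mxE !mxtens_indexK/= !co_mkt [p == j]eq_sym [k == q]eq_sym; ring.
under eq_bigr => p _ do rewrite -mulr_sumr (sumD'r (fun q => (q == k)%:R)).
by rewrite -mulr_suml (sumD'r (fun p => (p == l)%:R)) mulrC.
Qed.

Definition lform (F : 'rV[C]_(N * N)) (x : A) : C^o := \sum_i \sum_j F 0 (mxtens_index (i, j)) * x i j.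

Lemma lform_linear F : linear (lform F).
Proof.
move=> c X Y; rewrite /lform /GRing.scale/= mulr_sumr -big_split/=; apply: eq_bigr => p _.
by rewrite mulr_sumr -big_split/=; apply: eq_bigr => q _; rewrite !mxE; ring.
Qed.

Lemma lform_delta F p q : lform F (delta_mx p q) = F 0 (mxtens_index (p, q)).
Proof.
rewrite /lform -(sumDl (fun i => F 0 (mxtens_index (i, q))) p); apply: eq_bigr => i' _.
rewrite -(sumDl (fun j => F 0 (mxtens_index (i', j))) q) mulr_suml; apply: eq_bigr => j' _.
by rewrite mxE -mulnb natrM; ring.
Qed.

Lemma lin_form F : exists f : {linear A -> C^o}, forall x, f x = lform F x.
Proof.
pose f0 := GRing.isLinear.Build C A C^o *:%R (lform F) (lform_linear F).
by exists (HB.pack (lform F) f0 : {linear A -> C^o}).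
Qed.

Lemma contract_one (f : {linear A -> C^o}) : Defs.contract f 1%:M = (f 1%:M)%:M.
Proof.
rewrite (matrix_sum_delta (1%:M : A)) linear_sum.
apply/matrixP => k l; rewrite contractE !mxE -sumrMnl; apply: eq_bigr => i _.
rewrite linear_sum -sumrMnl; apply: eq_bigr => j _.
by rewrite linearZ/= co1 mxE /GRing.scale/= -mulr_natr; ring.
Qed.

Lemma contractD (f : A -> C) s t : Defs.contract f (s + t) = Defs.contract f s + Defs.contract f t.
Proof.
apply/matrixP => k l; rewrite mxE !contractE -big_split/=; apply: eq_bigr => i _.
by rewrite -big_split/=; apply: eq_bigr => j _; rewrite coD mulrDl.
Qed.

Lemma contractZ (f : A -> C) k t : Defs.contract f (k *: t) = k *: Defs.contract f t.
Proof.
apply/matrixP => p l; rewrite mxE !contractE mulr_sumr; apply: eq_bigr => i _.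
by rewrite mulr_sumr; apply: eq_bigr => j _; rewrite coZ mulrA.
Qed.

Lemma tr_contract (f : A -> C) t : ptr2 t = 0 -> \tr (Defs.contract f t) = 0.
Proof.
move=> t2; rewrite /mxtrace; under eq_bigr => k _ do rewrite contractE.
rewrite exchange_big big1// => i _; rewrite exchange_big big1//= => j _.
have e : \sum_k co t i k j k = ptr2 t i j by rewrite mxE.
by rewrite -mulr_suml e t2 mxE mul0r.
Qed.

Lemma contract_trace t : ptr1 t = 0 -> Defs.contract (fun x => \tr x) t = 0.
Proof.
move=> t1; apply/matrixP => k l; rewrite contractE -[in RHS]t1 [RHS]mxE; apply: eq_bigr => i _.
rewrite -[RHS](sumD'r (fun j => co t i k j l) i); apply: eq_bigr => j _.
rewrite mulrC; congr (_ * _).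
rewrite /mxtrace -[RHS](sumD'l (fun p => (p == j)%:R) i).
by apply: eq_bigr => p _; rewrite mxE -mulnb natrM.
Qed.

(* [A = sl + C 1], so adding a multiple of [1 (x) 1] turns nondegeneracy in
   [sl (x) sl] into nondegeneracy in [A (x) A]. *)
Lemma nondegenerate_sl t (k : C) : ptr1 t = 0 -> ptr2 t = 0 -> k != 0 ->
  \det (flat (t + k *: tens_one R N)) != 0 -> Defs.nondegenerate (@sl R N) t.
Proof.
move=> t1 t2 k0 dt.
have ut : flat (t + k *: tens_one R N) \in unitmx by rewrite unitmxE unitfE.
split; first exact: in_tens_sl.
- move=> f ft x sx; pose F : 'rV[C]_(N * N) :=
    \row_(y < N * N) f (tl (delta_mx (mxtens_unindex y).1 (mxtens_unindex y).2)).
  have [g gE] : exists g : {linear A -> C^o}, forall y, g y = f (tl y).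
    have lg : linear (fun y => f (tl y)).
      move=> h y z; rewrite -linearP/=; congr (f _).
      rewrite /tl linearP/= mulrDl raddfD/= scalerBr scale_scalar_mx mulrA.
      by rewrite opprD addrACA.
    pose f0 := GRing.isLinear.Build C A C^o *:%R (fun y => f (tl y)) lg.
    by exists (HB.pack (fun y => f (tl y)) f0 : {linear A -> C^o}).
  have g1 : g 1%:M = 0.
    rewrite gE /tl mxtrace1 divff ?NC0// subrr; exact: linear0.
  have gt : Defs.contract g (t + k *: tens_one R N) = 0.
    rewrite contractD contractZ contract_one g1 scalar0 scaler0 addr0.
    have e : Defs.contract g t = Defs.contract f t - (f 1%:M / N%:R) *: Defs.contract (fun x => \tr x) t.
      apply/matrixP => p q; rewrite !mxE !contractE mulr_sumr -sumrB; apply: eq_bigr => i _.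
      rewrite mulr_sumr -sumrB; apply: eq_bigr => j _; rewrite gE /tl linearB/=.
      rewrite -scalemx1.
      by rewrite linearZ/= /GRing.scale/=; ring.
    by rewrite e ft contract_trace// scaler0 subr0.
  have gF : (\row_(y < N * N) g (delta_mx (mxtens_unindex y).1 (mxtens_unindex y).2)) = 0.
    rewrite -[LHS](mulmxK ut) -[RHS](mul0mx _ (invmx (flat (t + k *: tens_one R N)))).
    congr (_ *m _); apply/matrixP => i y; rewrite (ord1 i); case: (mxtens_indexP y) => p q.
    by rewrite -flat_contract gt !mxE.
  rewrite -(tl_sl sx) -gE (matrix_sum_delta x) linear_sum big1// => i _.
  rewrite linear_sum big1// => j _; rewrite linearZ/=.
  have := congr1 (fun M : 'rV[C]_(N * N) => M 0 (mxtens_index (i, j))) gF.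
  by rewrite !mxE mxtens_indexK/= => ->; rewrite scaler0.
- move=> y sy.
  pose Y : 'rV[C]_(N * N) := \row_(x < N * N) y (mxtens_unindex x).1 (mxtens_unindex x).2.
  have [f fE] := lin_form (Y *m invmx (flat (t + k *: tens_one R N))).
  have fy : Defs.contract f (t + k *: tens_one R N) = y.
    apply/matrixP => p q; rewrite flat_contract.
    rewrite (_ : \row_(x < N * N) _ = Y *m invmx (flat (t + k *: tens_one R N))).
      by rewrite mulmxKV// mxE mxtens_indexK.
    apply/matrixP => i x; rewrite (ord1 i) mxE fE lform_delta; congr (_ 0 _).
    by case: (mxtens_indexP x) => p' q'; rewrite mxtens_indexK.
  exists f; move: (fy); rewrite contractD contractZ contract_one => fy'.
  have f1 : f 1%:M = 0.
    have := congr1 (fun M : A => \tr M) fy'; rewrite linearD/= (tr_contract _ t2) linearZ/= add0r.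
    move: sy; rewrite /sl/= => ->; rewrite mxtrace_scalar -mulr_natr => /eqP.
    by rewrite !mulf_eq0 (negPf k0) (negPf (NC0 _ N0)) orbF/= => /eqP.
  by move: fy'; rewrite f1 scalar0 scaler0 addr0.
Qed.
End TracelessTensors.

(** * The rational solution *)

Section LinearMaps.
Variables (K : numFieldType) (m n p q : nat) (L : 'M[K]_(m, n) -> 'M[K]_(p, q)).
Hypothesis linL : linear L.

Lemma lin0 : L 0 = 0.
Proof. by have := linL (-1) 0 0; rewrite scaler0 addr0 scaleN1r addNr. Qed.

Lemma linD x y : L (x + y) = L x + L y.
Proof. by have := linL 1 x y; rewrite !scale1r. Qed.

Lemma linZ k x : L (k *: x) = k *: L x.
Proof. by have := linL k x 0; rewrite lin0 !addr0. Qed.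

Lemma linN x : L (- x) = - L x.
Proof. by rewrite -scaleN1r linZ scaleN1r. Qed.

Lemma linB x y : L (x - y) = L x - L y.
Proof. by rewrite linD linN. Qed.
End LinearMaps.

Section Shift.
Variables (R : realType) (N : nat).
Local Notation C := (Cplx R).
Local Notation A := ('M[C]_N).
Local Notation AA := (tens2 R N).

Lemma CYBE_shift n (x y z p q w : 'M[C]_n) :
  mxcomm x y - mxcomm z x + mxcomm y z = 0 ->
  w *m x = x *m w -> q *m y = y *m q -> p *m z = z *m p ->
  q *m x = x *m p + x *m q - p *m x -> w *m y = y *m p + y *m w - p *m y ->
  w *m z = z *m q + z *m w - q *m z ->
  q *m p = p *m q -> w *m p = p *m w -> w *m q = q *m w ->
  mxcomm (x + (q - p)) (y + (w - p)) - mxcomm (z + (w - q)) (x + (q - p))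
   + mxcomm (y + (w - p)) (z + (w - q)) = 0.
Proof.
rewrite /mxcomm => e wx qy pz qx wy wz qp wp wq.
rewrite -[RHS]e !(mulmxBl, mulmxDl, mulmxBr, mulmxDr) wx qy pz qx wy wz qp wp wq.
move: (x *m y) (y *m x) (z *m x) (x *m z) (y *m z) (z *m y) (x *m p) (p *m x) (x *m q)
  (x *m w) (y *m p) (p *m y) (y *m w) (y *m q) (z *m q) (q *m z) (z *m w) (z *m p)
  (p *m p) (q *m q) (w *m w) (p *m q) (p *m w) (q *m w).
move=> a1 a2 a3 a4 a5 a6 a7 a8 a9 a10 a11 a12 a13 a14 a15 a16 a17 a18 a19 a20 a21 a22 a23 a24.
by apply/matrixP => i j; rewrite !mxE; ring.
Qed.

Lemma mxcomm_scalar n (x y : 'M[C]_n) k l : mxcomm (x + k%:M) (y + l%:M) = mxcomm x y.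
Proof.
rewrite /mxcomm !(mulmxDl, mulmxDr) !mul_scalar_mx !mul_mx_scalar.
move: (x *m y) (y *m x) => a1 a2; apply/matrixP => i j; rewrite !mxE; ring.
Qed.

Lemma CYBE_scalar n (x y z : 'M[C]_n) k l h :
  mxcomm (x + k%:M) (y + l%:M) - mxcomm (z + h%:M) (x + k%:M) + mxcomm (y + l%:M) (z + h%:M) =
  mxcomm x y - mxcomm z x + mxcomm y z.
Proof. by rewrite (mxcomm_scalar x y) (mxcomm_scalar z x) (mxcomm_scalar y z). Qed.

Lemma leg23_comm (s : AA) (x : A) : (x *t (1%:M : A) *t (1%:M : A)) *m leg23 s =
  leg23 s *m (x *t (1%:M : A) *t (1%:M : A)).
Proof.
rewrite /leg23 /tens_lift; do 4! [rewrite mulmx_sumr mulmx_suml; apply: eq_bigr => ? _].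
by rewrite -scalemxAl -scalemxAr !tensmx_mul !mulmx1 !mul1mx.
Qed.

Lemma leg_one : [/\ leg12 (tens_one R N) = 1%:M, leg13 (tens_one R N) = 1%:M &
  leg23 (tens_one R N) = 1%:M].
Proof.
rewrite /tens_one -tens_11 leg12_tens leg13_tens leg23_tens.
by split; rewrite !tensmx_1.
Qed.

Definition bshift (b : A) (k : C) : AA :=
  (1%:M : A) *t b - b *t (1%:M : A) - k *: tens_one R N.

Lemma inv_move n (x p q : 'M[C]_n) : (p + q) *m x = x *m (p + q) ->
  q *m x = x *m p + x *m q - p *m x.
Proof. by rewrite mulmxDl mulmxDr => <-; rewrite addrAC subrr add0r. Qed.

Lemma CYBEt_shift (b : A) k l h (s t u : AA) : CYBEt s t u ->
  inv_by b s -> inv_by b t -> inv_by b u ->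
  CYBEt (s + bshift b k) (t + bshift b l) (u + bshift b h).
Proof.
move=> e bs bt bu; have [l12 l13 l23] := leg_linear R N.
have [ one12 one13 one23] := leg_one.
pose p := b *t (1%:M : A) *t (1%:M : A); pose q := (1%:M : A) *t b *t (1%:M : A).
pose w := (1%:M : A) *t (1%:M : A) *t b.
have E12 : leg12 (s + bshift b k) = (leg12 s + (q - p)) + (- k)%:M.
  rewrite /bshift (linD l12) (linB l12) (linB l12) (linZ l12) !leg12_tens one12.
  by rewrite scalemx1 raddfN addrA.
have E13 : leg13 (t + bshift b l) = (leg13 t + (w - p)) + (- l)%:M.
  rewrite /bshift (linD l13) (linB l13) (linB l13) (linZ l13) !leg13_tens one13.
  by rewrite scalemx1 raddfN addrA.
have E23 : leg23 (u + bshift b h) = (leg23 u + (w - q)) + (- h)%:M.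
  rewrite /bshift (linD l23) (linB l23) (linB l23) (linZ l23) !leg23_tens one23.
  by rewrite scalemx1 raddfN addrA.
have B12 := congr1 (@leg12 R N) bs; have B13 := congr1 (@leg13 R N) bt.
have B23 := congr1 (@leg23 R N) bu.
rewrite !leg12M (linD l12) !leg12_tens in B12; rewrite !leg13M (linD l13) !leg13_tens in B13.
rewrite !leg23M (linD l23) !leg23_tens in B23.
have x1 := inv_move B12; have x2 := inv_move B13; have x3 := inv_move B23.
have qp : q *m p = p *m q by rewrite !tensmx_mul !mul1mx !mulmx1.
have wp : w *m p = p *m w by rewrite !tensmx_mul !mul1mx !mulmx1.
have wq : w *m q = q *m w by rewrite !tensmx_mul !mul1mx !mulmx1.
have := @CYBE_shift _ (leg12 s) (leg13 t) (leg23 u) p q w e (leg12_comm s b) (leg13_comm t b) (leg23_comm u b) x1 x2 x3 qp wp wq.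
rewrite /CYBEt E12 E13 E23; clearbody p q w => h0.
exact: (etrans (@CYBE_scalar _ (leg12 s + (q - p)) (leg13 t + (w - p)) (leg23 u + (w - q))
  (- k) (- l) (- h)) h0).
Qed.

Lemma inv_by_linear (a : A) : linear (fun t : AA =>
  (a *t (1%:M : A) + (1%:M : A) *t a) *m t - t *m (a *t (1%:M : A) + (1%:M : A) *t a)).
Proof.
move: (a *t _ + _) => S k s t.
by rewrite mulmxDr mulmxDl -scalemxAr -scalemxAl scalerBr opprD addrACA.
Qed.

Lemma inv_by_bshift (a b : A) k : a *m b = b *m a -> inv_by a (bshift b k).
Proof.
move=> ab; rewrite /inv_by /bshift /tens_one scalemx1 mulmxBr mulmxBl.
rewrite mul_mx_scalar mul_scalar_mx; congr (_ - _).
rewrite mulmxBl mulmxBr !(mulmxDl, mulmxDr) !tensmx_mul !mul1mx !mulmx1 ab.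
move: (a *t b) (_ *t (b *m a)) (b *t a) ((b *m a) *t _) => x y z w.
by apply/matrixP => i j; rewrite !mxE; ring.
Qed.

Lemma inv_byD (a : A) (s t : AA) : inv_by a s -> inv_by a t -> inv_by a (s + t).
Proof. by rewrite /inv_by; move: (a *t _ + _) => S hs ht; rewrite mulmxDl mulmxDr hs ht. Qed.

Lemma ptr2_tens (a b : A) : ptr2 (a *t b) = \tr b *: a.
Proof.
apply/matrixP => i j; rewrite !mxE mulrC mulr_sumr.
by apply: eq_bigr => k _; rewrite co_tens.
Qed.

Lemma ptr1_flip (t : AA) : ptr1 t = ptr2 (flip t).
Proof. by apply/matrixP => i j; rewrite !mxE; apply: eq_bigr => k _; rewrite co_flip. Qed.

Lemma ptr2_bshift (b : A) k : \tr b = 0 -> ptr2 (bshift b k) = - (N%:R *: b) - (N%:R * k)%:M.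
Proof.
move=> tb; have p2 := @ptr2_linear R N.
rewrite /bshift /tens_one -tens_11 (linB p2) (linB p2) (linZ p2) !ptr2_tens tb scale0r.
by rewrite mxtrace1 sub0r scalerA scalemx1 [k * _]mulrC.
Qed.

Lemma flip_bshift (b : A) k : flip (bshift b k) = bshift (- b) k.
Proof.
have fl : linear (@flip R N) by move=> h s t; exact: flip_lin.
rewrite /bshift (linB fl) (linB fl) (linZ fl) !flip_tens /tens_one -tens_11 flip_tens.
have -> : - b = (-1) *: b by rewrite scaleN1r.
by rewrite tens_Z1 tens_Z2 !scaleN1r opprK [- _ + _]addrC.
Qed.
End Shift.

Section RationalSolution.
Variables (R : realType) (N : nat).
Hypothesis N0 : (0 < N)%N.
Local Notation C := (Cplx R).
Local Notation A := ('M[C]_N).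
Local Notation AA := (tens2 R N).
Variables (al b : A) (E : C -> A) (c : C) (Q : C -> AA) (d : C -> C).
Hypotheses (EP : is_mexp al E) (c0 : c != 0) (alb : al *m b = b *m al) (trb : \tr b = 0)
  (dp : polyfun d) (dg : gen_poly d) (Qrat : rat d Q)
  (Qal : forall v, d v != 0 -> inv_by al (Q v)) (Qb : forall v, d v != 0 -> inv_by b (Q v))
  (Qflip : forall v, d v != 0 -> d (- v) != 0 -> Q (- v) = - flip (Q v))
  (Qptr2 : forall v, v != 0 -> d v != 0 -> ptr2 (Q v) = N%:R *: b + (c / v)%:M)
  (QAYBE : forall v w, d v != 0 -> d w != 0 -> d (v + w) != 0 -> AYBEt (Q v) (Q (v + w)) (Q w))
  (QopAYBE : forall v w, d v != 0 -> d w != 0 -> d (v + w) != 0 ->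
     d (- v) != 0 -> d (- w) != 0 -> d (- (v + w)) != 0 -> opAYBEt (Q v) (Q (v + w)) (Q w))
  (Qpole : mtends (0 : C)^' (fun v => v *: Q v) (c *: permt R N)).
Local Notation Ad := (Ad E).

Definition rho v : AA := Q v + bshift b (c / (N%:R * v)).
Definition rbar v : AA := Ad v (rho v).
Definition good v := v * (d v * d (- v)) != 0.

Lemma goodP v : good v -> [/\ v != 0, d v != 0 & d (- v) != 0].
Proof. by rewrite /good !mulf_eq0 !negb_or => /and3P[]. Qed.

Lemma id_gen : gen_poly (id : C -> C).
Proof. by exists 'X; [rewrite polyX_eq0 | move=> v; rewrite hornerX]. Qed.

Lemma opp_gen : gen_poly (fun v => d (- v)).
Proof.
have [p p0 hp] := dg; have Np : polyfun (fun v : C => - v) by apply: polyfunN; exact: polyfun_id.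
have [w dw] : exists w, d w != 0 by exact: filter_ex (gen_near 0 dg).
by apply: (@gen_polyP _ _ (- w)); [exact: (polyfun_comp dp Np) | rewrite opprK].
Qed.

Lemma good_near z : \forall w \near z^', good w.
Proof. exact: (gen_near z (gen_polyM id_gen (gen_polyM dg opp_gen))). Qed.

Lemma bal : b *m al = al *m b. Proof. exact: esym. Qed.

Lemma rho_al v : good v -> inv_by al (rho v).
Proof.
by case/goodP => _ dv _; apply: inv_byD; [exact: Qal | exact: inv_by_bshift].
Qed.

Lemma rho_b v : good v -> inv_by b (rho v).
Proof. by case/goodP => _ dv _; apply: inv_byD; [exact: Qb | exact: inv_by_bshift]. Qed.

Lemma rho_ptr2 v : good v -> ptr2 (rho v) = 0.
Proof.
case/goodP => v0 dv _; rewrite /rho (linD (@ptr2_linear R N)) Qptr2// ptr2_bshift//.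
have -> : N%:R * (c / (N%:R * v)) = c / v.
  by field; rewrite v0 NC0.
by rewrite addrACA subrr add0r subrr.
Qed.

Lemma rho_ptr1 v : good v -> ptr1 (rho v) = 0.
Proof.
move=> gv; have [v0 dv dNv] := goodP gv.
have fl : linear (@flip R N) by move=> h s t; exact: flip_lin.
have fQ : flip (Q v) = - Q (- v) by rewrite Qflip// opprK.
rewrite ptr1_flip /rho (linD fl) fQ flip_bshift (linD (@ptr2_linear R N)) (linN (@ptr2_linear R N)).
rewrite Qptr2 ?oppr_eq0// ptr2_bshift ?raddfN/= ?trb ?oppr0//.
have -> : N%:R * (c / (N%:R * v)) = c / v by field; rewrite v0 NC0.
have -> : c / - v = - (c / v) by rewrite invrN mulrN.
by apply/matrixP => i j; rewrite !mxE; ring.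
Qed.

Lemma good_add v w : good v -> good w -> good (v + w) -> CYBEt (Q v) (Q (v + w)) (Q w).
Proof.
move=> /goodP[v0 dv dNv] /goodP[w0 dw dNw] /goodP[vw0 dvw dNvw].
by apply: CYBEtE; [exact: QAYBE | exact: QopAYBE].
Qed.

Lemma rho_CYBE v w : good v -> good w -> good (v + w) -> CYBEt (rho v) (rho (v + w)) (rho w).
Proof.
move=> gv gw gvw; have h := good_add gv gw gvw.
have [_ dv _] := goodP gv; have [_ dw _] := goodP gw; have [_ dvw _] := goodP gvw.
exact: (CYBEt_shift _ _ _ h (Qb dv) (Qb dvw) (Qb dw)).
Qed.

Lemma rho_rat : rat (fun v => v * d v) rho.
Proof.
have Qr : rat (fun v => v * d v) Q.
  rewrite (_ : (fun v => v * d v) = (fun v => d v * v)); last by apply/funext => v; rewrite mulrC.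
  exact: (rat_weaken dp (@polyfun_id R) Qrat).
have xdp := polyfunM (@polyfun_id R) dp.
apply: (ratD xdp Qr); apply: (ratB xdp); first exact: rat_cst.
exists 1%N, (fun v => (d v * (c / N%:R)) *: tens_one R N).
  by apply: mpolyZ; [exact: (polyfunM dp (polyfun_cst _)) | exact: mpoly_cst].
move=> v; rewrite mulf_eq0 negb_or => /andP[v0 dv]; rewrite expr1 scalerA; congr (_ *: _).
by field; rewrite v0 NC0.
Qed.

Lemma rho_gen : gen_poly (fun v => v * d v).
Proof. exact: gen_polyM id_gen dg. Qed.

Lemma rho_mero U : meromorphic_on U rho.
Proof. exact: (rat_mero rho_gen rho_rat). Qed.

Lemma E_entire : forall v, exists D, mder (fun v => (1%:M : A) *t E v) v D.
Proof. by move=> v; have [_ dE _] := EP; eexists; exact: (mder_tens1 (dE v)). Qed.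

Lemma EN_entire : forall v, exists D, mder (fun v => (1%:M : A) *t E (- v)) v D.
Proof. by move=> v; have [_ dE _] := EP; eexists; exact: (mder_tens1 (mder_opp (dE (- v)))). Qed.

Lemma rbar_mero U : meromorphic_on U rbar.
Proof.
apply: meroM; first apply: meroM; last first.
- by apply: mero_holo => z _; apply: entire_holo; exact: EN_entire.
- exact: rho_mero.
- by apply: mero_holo => z _; apply: entire_holo; exact: E_entire.
Qed.

Lemma rbar_CYBE v w : good v -> good w -> good (v + w) -> CYBEt (rbar v) (rbar (v + w)) (rbar w).
Proof.
move=> gv gw gvw; have h := rho_CYBE gv gw gvw.
have [g [gi [gg g12 g13 g23]]] := triple_gauge EP v w (rho v) (rho (v + w)) (rho_al gw).
exact: (conj_CYBE gg g12 g13 g23 h).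
Qed.

Lemma Ad_ptr1 v t : ptr1 t = 0 -> ptr1 (Ad v t) = 0.
Proof.
move=> t1; apply/matrixP => k l; rewrite [RHS]mxE mxE.
have e i : co (Ad v t) i k i l = \sum_q (\sum_p E v k p * co t i p i q) * E (- v) q l.
  by rewrite /Ad co_r2; apply: eq_bigr => q _; rewrite co_l2.
under eq_bigr => i _ do rewrite e.
rewrite exchange_big big1// => q _; rewrite -mulr_suml exchange_big big1 ?mul0r//= => p _.
have e' : \sum_i co t i p i q = ptr1 t p q by rewrite mxE.
by rewrite -mulr_sumr e' t1 mxE mulr0.
Qed.

Lemma good_mtends_linear m n (L : AA -> 'M[C]_(m, n)) : linear L ->
  forall (F : C -> AA) X, mtends (0 : C)^' F X -> mtends (0 : C)^' (fun x => L (F x)) (L X).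
Proof. by move=> linL F X; exact: mtends_linear. Qed.

Lemma reg_linear0 m n (U : set C) (f : C -> AA) (L : AA -> 'M[C]_(m, n)) : linear L ->
  (forall v, good v -> L (f v) = 0) -> forall v, regular_pt U f v -> L (f v) = 0.
Proof.
move=> linL h; apply: (@extend1 _ _ _ _ _ U f good) => //.
  by move=> z _; exact: good_near.
exact: good_mtends_linear.
Qed.

Lemma cyexpr_tends (F F' F'' : C -> AA) X X' X'' : mtends (0 : C)^' F X ->
  mtends (0 : C)^' F' X' -> mtends (0 : C)^' F'' X'' ->
  mtends (0 : C)^' (fun x => mxcomm (leg12 (F x)) (leg13 (F' x))
    - mxcomm (leg23 (F'' x)) (leg12 (F x)) + mxcomm (leg13 (F' x)) (leg23 (F'' x)))
   (mxcomm (leg12 X) (leg13 X') - mxcomm (leg23 X'') (leg12 X) + mxcomm (leg13 X') (leg23 X'')).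
Proof.
move=> hX hX' hX''; have [l12 l13 l23] := leg_linear R N.
have h12 : mtends (0 : C)^' (fun x => leg12 (F x)) (leg12 X) by exact: mtends_linear.
have h13 : mtends (0 : C)^' (fun x => leg13 (F' x)) (leg13 X') by exact: mtends_linear.
have h23 : mtends (0 : C)^' (fun x => leg23 (F'' x)) (leg23 X'') by exact: mtends_linear.
have cm (f g : C -> tens3 R N) x y : mtends (0 : C)^' f x -> mtends (0 : C)^' g y ->
    mtends (0 : C)^' (fun t => mxcomm (f t) (g t)) (mxcomm x y).
  by move=> hf hg; apply: mtendsB; apply: mtendsM.
apply: mtendsD; last by apply: cm; [exact: h13 | exact: h23].
by apply: mtendsB; apply: cm; [exact: h12 | exact: h13 | exact: h23 | exact: h12].
Qed.

Lemma ptr1_linear : linear (@ptr1 R N).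
Proof.
move=> k s t; apply/matrixP => i j; rewrite !mxE mulr_sumr -big_split/=.
by apply: eq_bigr => l _; rewrite coD coZ.
Qed.

Lemma CYBE_good U (f : C -> AA) : meromorphic_on U f -> (forall v, good v -> ptr1 (f v) = 0) ->
  (forall v, good v -> ptr2 (f v) = 0) ->
  (forall v w, good v -> good w -> good (v + w) -> CYBEt (f v) (f (v + w)) (f w)) ->
  CYBE_solution U f.
Proof.
move=> mf f1 f2 fC; split=> //.
  move=> v rv; apply: (in_tens_sl N0); [exact: (reg_linear0 ptr1_linear f1 rv)|].
  exact: (reg_linear0 (@ptr2_linear R N) f2 rv).
apply: (@extend3 _ _ _ _ _ U f good _ (fun s t u => mxcomm (leg12 s) (leg13 t)
  - mxcomm (leg23 u) (leg12 s) + mxcomm (leg13 t) (leg23 u))).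
- by move=> z _; exact: good_near.
- exact: cyexpr_tends.
- exact: fC.
Qed.

Lemma rho_solution : CYBE_solution setT rho.
Proof.
by apply: CYBE_good; [exact: rho_mero | exact: rho_ptr1 | exact: rho_ptr2 | exact: rho_CYBE].
Qed.

Lemma rbar_solution U : CYBE_solution U rbar.
Proof.
apply: CYBE_good; [exact: rbar_mero | | | exact: rbar_CYBE] => v gv.
  by apply: Ad_ptr1; exact: rho_ptr1.
by rewrite (Ad_ptr2 EP) rho_ptr2.
Qed.

Lemma rbar_symmetry U : infinitesimal_symmetry U rbar b.
Proof.
move=> v rv; apply: (reg_linear0 (inv_by_linear b) _ rv) => w gw.
by apply/eqP; rewrite subr_eq0; apply/eqP; exact: (Ad_inv EP w bal (rho_b gw)).
Qed.

Lemma rho_al_reg v : regular_pt setT rho v -> inv_by al (rho v).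
Proof.
move=> rv; apply/subr0_eq; apply: (reg_linear0 (inv_by_linear al) _ rv) => w gw.
by apply/eqP; rewrite subr_eq0; apply/eqP; exact: rho_al.
Qed.
Lemma rho_unshift v : rho v + (c / (N%:R * v)) *: tens_one R N =
  Q v + ((1%:M : A) *t b - b *t (1%:M : A)).
Proof. by rewrite /rho /bshift addrA subrK. Qed.

Lemma rho_nondegenerate : for_generic setT (fun v => Defs.nondegenerate (@sl R N) (rho v)).
Proof.
pose B : AA := (1%:M : A) *t b - b *t (1%:M : A).
pose F v := v *: (Q v + B).
have [k [P Pp FP]] : rat d F.
  by apply: ratZ; [exact: polyfun_id | apply: (ratD dp Qrat); exact: rat_cst].
have Flim : mtends (0 : C)^' (fun v => flat (F v)) (flat (c *: permt R N)).
  apply: (mtends_linear (@flat_linear R N)).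
  have h : mtends (0 : C)^' (fun v => v *: Q v + v *: B) (c *: permt R N + 0 *: B).
    apply: mtendsD; first exact: Qpole.
    apply: mtendsZ; last exact: mtends_cst.
    by apply: (@tends_dnbhs _ (fun v => v) 0); exact: (hasder_tends (hasder_id (0 : C))).
  rewrite scale0r addr0 in h.
  by apply: mtends_near h; apply/dnearCP; exists 1 => // v _; rewrite -scalerDr.
have detP : \det (flat (c *: permt R N)) != 0.
  have [u _] := mulmx1_unit (flat_permt R N).
  rewrite unitmxE unitfE in u.
  by rewrite (linZ (@flat_linear R N)) detZ mulf_neq0 ?expf_neq0.
pose e v := \det (flat (P v)).
have eF v : d v != 0 -> e v = (d v ^+ k) ^+ (N * N) * \det (flat (F v)).
  by move=> dv; rewrite /e -FP// (linZ (@flat_linear R N)) detZ.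
have ep : polyfun e by apply: det_poly; exact: (mpoly_linear (@flat_linear R N) Pp).
have eg : gen_poly e.
  have n1 : \forall v \near (0 : C)^', \det (flat (F v)) != 0.
    exact: (tends_neq0 detP (det_tends Flim)).
  have [w [w1 w2]] := filter_ex (filterI n1 (gen_near 0 dg)).
  by apply: (gen_polyP ep (v := w)); rewrite eF// mulf_neq0// !expf_neq0.
move=> z _; apply: filterS2 (good_near z) (gen_near z eg) => w gw ew.
have [w0 dw _] := goodP gw.
apply: (nondegenerate_sl N0 (k := c / (N%:R * w)) (rho_ptr1 gw) (rho_ptr2 gw)).
  by rewrite mulf_neq0// invr_neq0// mulf_neq0// NC0.
rewrite rho_unshift -/B; move: ew; rewrite eF// /F (linZ (@flat_linear R N)) detZ.
by rewrite !mulf_eq0 !negb_or => /and3P[].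
Qed.

Lemma rho_rational : rational_nondegenerate_CYBE_solution rho.
Proof.
split; [exact: rho_solution | exact: (rat_rational rho_gen rho_rat) | exact: rho_nondegenerate].
Qed.

Definition phi (v : C) : {linear A -> A} := mulmxr (E v) \o mulmx (E (- v)).

Lemma phiE v x : phi v x = E (- v) *m x *m E v. Proof. by []. Qed.

Lemma phiK v x : phi v (phi (- v) x) = x.
Proof.
rewrite !phiE opprK -!mulmxA (mexpN EP) mulmx1 mulmxA (mexpN EP) mul1mx//.
Qed.

Lemma tr_phi v x : \tr (phi v x) = \tr x.
Proof. by rewrite phiE mxtrace_mulC mulmxA (mexp_opp EP) mul1mx. Qed.

Lemma phi_automorphism v : sl_automorphism (phi v).
Proof.
have slphi w x : sl x -> sl (phi w x) by rewrite /sl/= tr_phi.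
split.
  split.
  - by move=> x /slphi.
  - move=> x y _ _ /(congr1 (phi (- v))) h.
    by have := phiK (- v); rewrite opprK => K; rewrite -(K x) -(K y) h.
  - by move=> y sy; exists (phi (- v) y); [exact: slphi | exact: phiK].
move=> x y _ _; rewrite /mxcomm linearB/=; congr (_ - _).
  by rewrite (conj_mul x y (mexp_opp EP v)).
by rewrite (conj_mul y x (mexp_opp EP v)).
Qed.

Lemma phi_holomorphic x v : holomorphic_at (fun w => phi w x) v.
Proof.
have [_ dE _] := EP; apply: entire_holo => w; eexists.
exact: (mderM (mderM (mder_opp (dE (- w))) (mder_cst x w)) (dE w)).
Qed.

Lemma rbar_gauge v1 v2 : inv_by al (rho (v1 - v2)) ->
  rbar (v1 - v2) = tens_map (phi v1) (phi v2) (rho (v1 - v2)).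
Proof.
move=> h; rewrite /rbar tens_map_conj /Ad.
have EE := inv_EE EP (- v1) h.
rewrite [LHS](conj_split _ _ EE (hi := E v1 *t E v1)).
  rewrite !tensmx_mul !mul1mx !mulmx1 -!(mexp_add EP).
  have -> : v1 - v2 - v1 = - v2 by ring.
  by have -> : v1 - (v1 - v2) = v2 by ring.
by rewrite tensmx_mul !(mexpN EP) tens_11.
Qed.

Lemma rbar_equivalent U : CYBE_equivalent U rbar rho.
Proof.
split; [exact: rbar_solution | exact: rho_solution |].
exists phi; split.
- exact: phi_automorphism.
- by move=> a _ v; exact: phi_holomorphic.
- by move=> v1 v2 _ rv; apply: rbar_gauge; exact: rho_al_reg.
Qed.

Lemma Ad_bshift v k : Ad v (bshift b k) = bshift b k.
Proof.
have bE w := mexp_comm EP w bal.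
have cb : ((1%:M : A) *t E v) *m (bshift b k) = bshift b k *m ((1%:M : A) *t E v).
  rewrite /bshift /tens_one !(mulmxBr, mulmxBl) scalemx1 mul_scalar_mx mul_mx_scalar.
  by rewrite !tensmx_mul !mul1mx !mulmx1 bE.
by rewrite /Ad cb -mulmxA tens_1M (mexp_opp EP) tens_11 mulmx1.
Qed.

Lemma rbarE v : Ad v (Q v) = rbar v + b *t (1%:M : A) - (1%:M : A) *t b
  + (c / (N%:R * v)) *: tens_one R N.
Proof.
rewrite /rbar /rho AdD Ad_bshift /bshift.
move: (Ad v (Q v)) (b *t _) (_ *t b) (_ *: _) => x y z w.
by apply/matrixP => i j; rewrite !mxE; ring.
Qed.
End RationalSolution.

(** * The quantum Yang-Baxter equation *)

Section Resolvent.
Variables (R : realType) (n : nat).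
Local Notation C := (Cplx R).
Variables (k v0 : C) (q0 : 'M[C]_n).

Definition resD v : 'M[C]_n := 1%:M + (k * (v - v0)) *: q0.
Definition resd v := \det (resD v).
Definition resq v := (resd v)^-1 *: (q0 *m \adj (resD v)).

Lemma resD_poly : mpoly resD.
Proof.
apply: mpolyD; first exact: mpoly_cst.
apply: mpolyZ; last exact: mpoly_cst.
apply: polyfunM; first exact: polyfun_cst.
by apply: polyfunB; [exact: polyfun_id | exact: polyfun_cst].
Qed.

Lemma resd_poly : polyfun resd. Proof. exact: det_poly resD_poly. Qed.

Lemma resd_gen : gen_poly resd.
Proof.
apply: (@gen_polyP _ _ v0 resd_poly).
by rewrite /resd /resD subrr mulr0 scale0r addr0 det1 oner_neq0.
Qed.

Lemma resq_rat : rat resd resq.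
Proof.
exists 1%N, (fun v => q0 *m \adj (resD v)).
  by apply: mpolyM; [exact: mpoly_cst | exact: (adj_poly resD_poly)].
by move=> v dv; rewrite expr1 scalerA divff// scale1r.
Qed.

Lemma resolvent_unique q v : q *m resD v = q0 -> resd v != 0 /\ q = resq v.
Proof.
move=> h; have inv : (1%:M - (k * (v - v0)) *: q) *m resD v = 1%:M.
  by rewrite mulmxBl mul1mx -scalemxAl h addrK.
have [_ u] := mulmx1_unit inv; rewrite unitmxE unitfE in u; split=> //.
rewrite /resq -[in RHS]h -mulmxA mul_mx_adj mul_mx_scalar scalerA mulVf// scale1r//.
Qed.
End Resolvent.

Section QYBE.
Variables (R : realType) (N : nat).
Hypothesis N0 : (0 < N)%N.
Local Notation C := (Cplx R).
Local Notation A := ('M[C]_N).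
Local Notation AA := (tens2 R N).

Lemma qyexpr_tends (F F' F'' : C -> AA) X X' X'' : mtends (0 : C)^' F X ->
  mtends (0 : C)^' F' X' -> mtends (0 : C)^' F'' X'' ->
  mtends (0 : C)^' (fun x => leg12 (F x) *m leg13 (F' x) *m leg23 (F'' x)
    - leg23 (F'' x) *m leg13 (F' x) *m leg12 (F x))
   (leg12 X *m leg13 X' *m leg23 X'' - leg23 X'' *m leg13 X' *m leg12 X).
Proof.
move=> hX hX' hX''; have [l12 l13 l23] := leg_linear R N.
have h12 : mtends (0 : C)^' (fun x => leg12 (F x)) (leg12 X) by exact: mtends_linear.
have h13 : mtends (0 : C)^' (fun x => leg13 (F' x)) (leg13 X') by exact: mtends_linear.
have h23 : mtends (0 : C)^' (fun x => leg23 (F'' x)) (leg23 X'') by exact: mtends_linear.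
have m12 : mtends (0 : C)^' (fun x => leg12 (F x) *m leg13 (F' x)) (leg12 X *m leg13 X').
  by apply: mtendsM; [exact: h12 | exact: h13].
have m23 : mtends (0 : C)^' (fun x => leg23 (F'' x) *m leg13 (F' x)) (leg23 X'' *m leg13 X').
  by apply: mtendsM; [exact: h23 | exact: h13].
by apply: mtendsB; apply: mtendsM; [exact: m12 | exact: h23 | exact: m23 | exact: h12].
Qed.

Lemma QYBE_generic (U : set C) (W : C -> AA) (G : C -> Prop) : meromorphic_on U W ->
  (forall z, U z -> \forall w \near z^', G w) ->
  (forall v w, G v -> G w -> G (v + w) ->
     leg12 (W v) *m leg13 (W (v + w)) *m leg23 (W w) =
     leg23 (W w) *m leg13 (W (v + w)) *m leg12 (W v)) ->
  (forall v, G v -> G (- v) -> W v *m flip (W (- v)) = 1%:M) ->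
  unitary_QYBE_solution U W.
Proof.
move=> mW Gg hq hu; have fl : linear (@flip R N) by move=> h s t; exact: flip_lin.
split; first exact: mW.
  move=> v w rv rw rvw; apply: subr0_eq.
  apply: (@extend3 _ _ _ _ _ U W G Gg (fun s t u => leg12 s *m leg13 t *m leg23 u -
    leg23 u *m leg13 t *m leg12 s) qyexpr_tends _ v w rv rw rvw).
  by move=> x y gx gy gxy; apply/eqP; rewrite subr_eq0; apply/eqP; exact: hq.
move=> v rv rNv; apply: subr0_eq.
apply: (@extend2 _ _ _ _ _ U W G Gg (fun s t => s *m flip t - 1%:M) _ _ v rv rNv).
  move=> F F' X X' hF hF'; apply: mtendsB; last exact: mtends_cst.
  have h : mtends (0 : C)^' (fun x => flip (F' x)) (flip X') by exact: mtends_linear.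
  by apply: mtendsM; [exact: hF | exact: h].
by move=> x gx gNx; apply/eqP; rewrite subr_eq0; apply/eqP; exact: hu.
Qed.

Lemma scale_QYBE n (x y z : 'M[C]_n) a b e : x *m y *m z = z *m y *m x ->
  (a *: x) *m (b *: y) *m (e *: z) = (e *: z) *m (b *: y) *m (a *: x).
Proof.
move=> h; do 6! rewrite -?scalemxAl -?scalemxAr; rewrite !scalerA h; congr (_ *: _); ring.
Qed.

Lemma one_plus_minus n (x : 'M[C]_n) u f : x *m x = f%:M ->
  (1%:M + u *: x) *m (1%:M + u *: - x) = (1 - u ^+ 2 * f)%:M.
Proof.
move=> h; rewrite scalerN mulmxBr mulmx1 mulmxDl mul1mx -scalemxAl -scalemxAr h.
rewrite !scale_scalar_mx opprD addrA addrK raddfB/= mulrA //.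
Qed.

Variables (U : set C) (Uo : open U) (r : C -> AA) (c : C) (G : C -> Prop).
Hypotheses (c0 : c != 0) (rm : meromorphic_on U r)
  (Gg : forall z, U z -> \forall w \near z^', G w) (G0 : forall v, G v -> v != 0)
  (sq : forall v, G v -> r v *m r v = ((c / v) ^+ 2)%:M)
  (rflip : forall v, G v -> G (- v) -> flip (r (- v)) = - r v)
  (AY : forall v w, G v -> G w -> G (v + w) -> AYBEt (r v) (r (v + w)) (r w))
  (opAY : forall v w, G v -> G w -> G (v + w) -> opAYBEt (r v) (r (v + w)) (r w)).

Lemma leg23_sq v : G v -> leg23 (r v) *m leg23 (r v) = ((c / v) ^+ 2)%:M.
Proof.
move=> gv; have [_ _ l23] := leg_linear R N; have [_ _ one23] := leg_one R N.
by rewrite -leg23M sq// -scalemx1 (linZ l23) one23 scalemx1.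
Qed.

Lemma scaled_QYBE : unitary_QYBE_solution U (fun v => (v / c) *: r v).
Proof.
have [l12 l13 l23] := leg_linear R N.
have fl : linear (@flip R N) by move=> h s t; exact: flip_lin.
apply: (@QYBE_generic U _ G _ Gg).
- have hp : meromorphic_on U (fun v : C => (v / c)%:M : 'M[C]_(N * N)).
    apply: mero_holo => z _; apply: entire_holo => v.
    have d1 := hasderM (hasder_id v) (hasder_cst c^-1 v).
    have h := mderZ d1 (mder_cst (1%:M : 'M[C]_(N * N)) v).
    eexists; apply: mder_near h; apply/nearCP; exists 1 => // w _.
    exact: scalemx1.
  apply: mero_near (meroM hp rm) => z _; apply/dnearCP; exists 1 => // w _.
  by rewrite mul_scalar_mx.
- move=> v w gv gw gvw; rewrite (linZ l12) (linZ l13) (linZ l23); apply: scale_QYBE.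
  exact: (triple_QYBE (AY gv gw gvw) (opAY gv gw gvw) (leg23_sq gw)).
- move=> v gv gNv; rewrite (linZ fl) rflip// -scalemxAl -scalemxAr mulmxN sq//.
  rewrite !scalerN scalerA scale_scalar_mx -raddfN/=; congr (_%:M).
  by have v0 := G0 gv; field; rewrite v0 c0.
Qed.

Lemma addc_gen (a : C) : gen_poly (fun v => v + a).
Proof.
exists ('X + a%:P) => [|v]; last by rewrite hornerD hornerX hornerC.
by rewrite -size_poly_eq0 size_XaddC.
Qed.

Lemma AYBE_to_QYBE_solution u : unitary_QYBE_solution U (AYBE_to_QYBE r c u).
Proof.
have [l12 l13 l23] := leg_linear R N; have [one12 one13 one23] := leg_one R N.
have fl : linear (@flip R N) by move=> h s t; exact: flip_lin.
have flip1 : flip (tens_one R N) = tens_one R N by rewrite /tens_one -tens_11 flip_tens.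
pose G' v := G v /\ v + c * u != 0.
have Gg' z : U z -> \forall w \near z^', G' w.
  by move=> Uz; exact: (filterI (Gg Uz) (gen_near z (addc_gen (c * u)))).
apply: (@QYBE_generic U _ G' _ Gg').
- have hp : meromorphic_on U (fun v : C => (v / (v + c * u))%:M : 'M[C]_(N * N)).
    apply: (rat_mero (addc_gen (c * u))); exists 1%N, (fun v => v *: 1%:M).
      by apply: mpolyZ; [exact: polyfun_id | exact: mpoly_cst].
    by move=> v vc; rewrite expr1 scale_scalar_mx scalemx1 mulrC divfK.
  have hu : meromorphic_on U (fun v : C => u%:M *m r v).
    apply: meroM rm; apply: mero_holo => z _; apply: entire_holo => v.
    by eexists; exact: mder_cst.
  have h1 : meromorphic_on U (fun v : C => tens_one R N).
    by apply: mero_holo => z _; apply: entire_holo => v; eexists; exact: mder_cst.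
  apply: mero_near (meroM hp (meroD h1 hu)) => z Uz; apply: filterS (Gg' z Uz) => w [gw wc].
  rewrite /AYBE_to_QYBE mul_scalar_mx mul_scalar_mx; congr (_ *: _).
  have w0 := G0 gw.
  rewrite -[1](divff w0) -mulrDl invfM invrK mulrC//.
- move=> v w [gv _] [gw _] [gvw _].
  rewrite /AYBE_to_QYBE (linZ l12) (linZ l13) (linZ l23); apply: scale_QYBE.
  rewrite (linD l12) (linD l13) (linD l23) (linZ l12) (linZ l13) (linZ l23) one12 one13 one23.
  exact: (one_plus_QYBE _ (AY gv gw gvw) (opAY gv gw gvw) (leg23_sq gw)).
- move=> v [gv vc] [gNv Nvc]; have v0 := G0 gv.
  rewrite /AYBE_to_QYBE (linZ fl) (linD fl) (linZ fl) rflip// flip1 /tens_one.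
  rewrite -scalemxAl -scalemxAr scalerA (one_plus_minus u (sq gv)).
  rewrite scale_scalar_mx; congr (_%:M).
  field; rewrite v0 addrC vc/=.
  by rewrite andbT addrC.
Qed.
End QYBE.

Section LimitAtInfinity.
Variables (R : realType) (N : nat).
Local Notation C := (Cplx R).
Local Notation AA := (tens2 R N).

#[local] Instance cinfty_filter : ProperFilter (@cinfty R).
Proof.
apply: filter_from_proper => [|M M0].
  apply: filter_from_filter; first by exists 1; exact: ltr01.
  move=> M M' M0 M'0; exists (M + M'); first exact: addr_gt0.
  move=> u /= h; split; apply: le_lt_trans h; first by rewrite lerDl ltW.
  by rewrite lerDr ltW.
by exists (M + 1) => /=; rewrite gtr0_norm ?ltrDl// addr_gt0.
Qed.

Lemma inv_affine_tends (a : C) : a != 0 -> tends (@cinfty R) (fun u => (1 + a * u)^-1) 0.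
Proof.
move=> a0; apply/tendsP => e e0; exists ((1 + e^-1) / `|a|) => /=.
  by rewrite divr_gt0 ?normr_gt0// addr_gt0 ?invr_gt0.
move=> u /= hu; rewrite sub0r normrN normfV.
have h : e^-1 <= `|1 + a * u|.
  have h1 : `|a * u| <= `|1 + a * u| + 1.
    have e1 : a * u = (1 + a * u) - 1 by ring.
    by rewrite [X in `|X| <= _]e1 -[X in _ <= _ + X](normr1 C) ler_normB.
  have h2 : 1 + e^-1 < `|a * u| by rewrite normrM mulrC -ltr_pdivrMr ?normr_gt0.
  by rewrite -(lerD2r 1) [e^-1 + 1]addrC; apply: le_trans (ltW h2) h1.
rewrite -[e]invrK lef_pV2 ?posrE ?invr_gt0//.
by apply: lt_le_trans h; rewrite invr_gt0.
Qed.

Lemma AYBE_to_QYBE_limit (r : C -> AA) (c v : C) : c != 0 -> v != 0 ->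
  AYBE_to_QYBE r c u v @[u --> @cinfty R] --> (v / c) *: r v.
Proof.
move=> c0 v0; have cv0 : c / v != 0 by rewrite mulf_neq0// invr_neq0.
have h := inv_affine_tends cv0.
have gen : \forall u \near @cinfty R, 1 + c / v * u != 0.
  exists (`|v / c|) => /= [|u]; first by rewrite normr_gt0 mulf_neq0// invr_neq0.
  move=> hu; apply/negP => /eqP e; move: hu.
  have -> : u = - (v / c).
    have e' : c / v * u = -1 by apply/eqP; rewrite -addr_eq0 addrC e.
    have uE : u = v / c * (c / v * u) by field; rewrite v0 c0.
    by rewrite uE e' mulrN1.
  by rewrite /= normrN ltxx.
have h2 : tends (@cinfty R) (fun u => (1 + c / v * u)^-1 * u) (v / c).
  have : tends (@cinfty R) (fun u => v / c * (1 - (1 + c / v * u)^-1)) (v / c * (1 - 0)).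
    by apply: tendsM; [exact: tends_cst | apply: tendsB; [exact: tends_cst | exact: h]].
  rewrite subr0 mulr1; apply: tends_near; apply: filterS gen => u hu.
  by field; rewrite c0 v0 /= (_ : v + c * u = v * (1 + c / v * u)) ?mulf_neq0//; field.
have hM : mtends (@cinfty R) (fun u => AYBE_to_QYBE r c u v) ((v / c) *: r v).
  have : mtends (@cinfty R) (fun u => (1 + c / v * u)^-1 *: tens_one R N +
      ((1 + c / v * u)^-1 * u) *: r v) (0 *: tens_one R N + (v / c) *: r v).
    apply: mtendsD; first by apply: mtendsZ; [exact: h | exact: mtends_cst].
    by apply: mtendsZ; [exact: h2 | exact: mtends_cst].
  rewrite scale0r add0r; apply: mtends_near; apply: nearW => u.
  by rewrite /AYBE_to_QYBE scalerDr scalerA mulrAC.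
move=> S [P MP sPS].
have hP : \forall u \near @cinfty R, forall i j, P i j (AYBE_to_QYBE r c u v i j).
  refine (@filter_forall _ _ (fun i u => forall j, P i j (AYBE_to_QYBE r c u v i j)) _ _ _) => i.
  refine (@filter_forall _ _ (fun j u => P i j (AYBE_to_QYBE r c u v i j)) _ _ _) => j.
  exact: (hM i j (P i j) (MP i j)).
by apply: filterS hP => u; exact: sPS.
Qed.
End LimitAtInfinity.

Section GaugeForm.
Variables (R : realType) (N : nat).
Hypothesis N0 : (0 < N)%N.
Local Notation C := (Cplx R).
Local Notation A := ('M[C]_N).
Local Notation AA := (tens2 R N).
Variables (U : set C) (r : C -> AA).
Hypotheses (Uo : open U) (Uc : connected U) (U0 : U 0)
  (hr : nondegenerate_unitary_AYBE_solution U r).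

Lemma inv_byZ (k : C) (a : A) (t : AA) : inv_by a t -> inv_by (k *: a) t.
Proof.
rewrite /inv_by tens_Z1 tens_Z2 -scalerDr; move: (a *t _ + _) => S h.
by rewrite -scalemxAl -scalemxAr h.
Qed.

Lemma pt_linear : linear (@pt R N).
Proof. by move=> k s t; exact: pt_lin. Qed.

Theorem gauge_form : exists (c : C) (al b : A) (E : C -> A) (Q : C -> AA) (d : C -> C),
  [/\ [/\ c != 0, is_mexp al E, al *m b = b *m al & \tr b = 0],
      [/\ polyfun d, gen_poly d, rat d Q & mtends (0 : C)^' (fun v => v *: Q v) (c *: permt R N)],
      (forall v, regular_pt U r v -> d v != 0 /\ r v = Ad E v (Q v)),
      [/\ (forall v, d v != 0 -> inv_by al (Q v)), (forall v, d v != 0 -> inv_by b (Q v)),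
          (forall v, d v != 0 -> d (- v) != 0 -> Q (- v) = - flip (Q v)),
          (forall v, v != 0 -> d v != 0 -> Q v *m Q v = ((c / v) ^+ 2)%:M) &
          (forall v, v != 0 -> d v != 0 -> ptr2 (Q v) = N%:R *: b + (c / v)%:M)] &
      (forall v w, d v != 0 -> d w != 0 -> d (v + w) != 0 -> AYBEt (Q v) (Q (v + w)) (Q w)) /\
      (forall v w, d v != 0 -> d w != 0 -> d (v + w) != 0 ->
         d (- v) != 0 -> d (- w) != 0 -> d (- (v + w)) != 0 -> opAYBEt (Q v) (Q (v + w)) (Q w))].
Proof.
have [c [sg [c0 _ pole Ric]]] := riccati N0 Uo U0 hr.
have [eps eps0 [b trb ball]] := near_form N0 Uo U0 hr c0 pole Ric.
have Ric' := riccati_opmul Ric; pose a0 := al0 sg; rewrite -/a0 in Ric'.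
have ba0 := al_b N0 hr eps0 Ric' ball.
pose k := (c * N%:R)^-1; pose al := k *: a0.
have [E [E0 [dE Eal]]] := mexp_exists al; have EP : is_mexp al E by split.
have [v0 v0I hq] := resolvent_formula N0 Uo U0 hr c0 eps0 Ric' EP Uc.
pose q0 := qh r E v0; pose d := resd k v0 q0; pose Q v : AA := pt (resq k v0 q0 v).
have alb : al *m b = b *m al by rewrite -scalemxAl ba0 scalemxAr.
have dp : polyfun d := resd_poly k v0 q0.
have dg : gen_poly d := resd_gen k v0 q0.
have Qrat : rat d Q := rat_linear pt_linear (resq_rat k v0 q0).
have regQ v : regular_pt U r v -> d v != 0 /\ qh r E v = pt (Q v).
  by move=> rv; have [dv qE] := resolvent_unique (hq v rv); split; rewrite ?ptK.
have rQ v : regular_pt U r v -> d v != 0 /\ r v = Ad E v (Q v).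
  move=> rv; have [dv qE] := regQ v rv; split; first exact: dv.
  have -> : Q v = Ad E (- v) (r v).
    by rewrite -(ptK (Q v)) -qE /qh ptK /qt /Ad opprK.
  by rewrite (AdK EP).
have mball v : 0 < `|v| < (eps%:C)%C -> [/\ d v != 0, r v = Ad E v (Q v),
    r v *m r v = ((c / v) ^+ 2)%:M & ptr2 (r v) = N%:R *: b + (c / v)%:M].
  by move=> vI; have [rv _ sq p2] := ball v vI; have [dv rE] := rQ v rv; split.
have bal v : 0 < `|v| < (eps%:C)%C -> inv_by al (r v).
  by move=> vI; apply: inv_byZ; exact: (al_inv hr Ric' ball vI).
have bb := b_inv N0 hr ball; have bf := unit_ball hr ball.
have bA v w : 0 < `|v| < (eps%:C)%C -> 0 < `|w| < (eps%:C)%C -> 0 < `|v + w| < (eps%:C)%C ->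
    AYBEt (r v) (r (v + w)) (r w).
  move=> vI wI vwI; have [rv _ _ _] := ball v vI; have [rw _ _ _] := ball w wI.
  by have [rvw _ _ _] := ball _ vwI; exact: (AYBE_reg hr rv rw rvw).
have [rm _ _] := hr.1.
have Qpole : mtends (0 : C)^' (fun v => v *: Q v) (c *: permt R N).
  have sub (P : C -> Prop) : (\forall w \near (0 : C), P w) -> \forall w \near (0 : C)^', P w.
    by case/nearCP => e e0 hP; apply/dnearCP; exists e => // w /andP[_]; exact: hP.
  have h : mtends (0 : C)^' (fun v => v *: qh r E v)
     (pt ((1%:M : A) *t E (- 0) *m (c *: permt R N) *m ((1%:M : A) *t E 0))).
    exact: (@qh_tends R N r c a0 E EP 0 (0 : C)^' _ (fun v => v) _ sub (pole_mtends pole)).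
  have h' := @mtends_pt R N _ _ (fun v => v *: qh r E v) _ h.
  have EN0 : E (- 0) = 1%:M by rewrite oppr0.
  have e0 (X : AA) : pt (pt (((1%:M : A) *t E (- 0)) *m X *m ((1%:M : A) *t E 0))) = X.
    rewrite ptK EN0 E0 tens_11.
    by rewrite mul1mx mulmx1.
  have h'' := mtends_eq h' (e0 _).
  have near_eq : \forall v \near (0 : C)^', pt (v *: qh r E v) = v *: Q v.
    apply: filterS (reg_generic Uo rm U0) => v rv.
    have [_ qE] := regQ v rv; rewrite qE -ptZ ptK; exact: erefl.
  exact: mtends_near near_eq h''.
exists c, al, b, E, Q, d; split.
- by split.
- by split.
- exact: rQ.
- split.
  + exact: (Q_al EP eps0 dp Qrat mball bal).
  + exact: (Q_b EP eps0 dp Qrat alb mball bb).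
  + exact: (Q_flip EP eps0 dp Qrat mball bal bf).
  + exact: (Q_sq EP eps0 dp Qrat mball).
  + exact: (Q_ptr2 EP eps0 dp Qrat mball).
- split; first exact: (Q_AYBE EP eps0 dp Qrat mball bal bA).
  exact: (Q_opAYBE EP eps0 dp Qrat mball bal bf bA).
Qed.
End GaugeForm.

Theorem theorem0p2 (R : realType) (N : nat) (hN : (1 < N)%N)
    (U : set (Cplx R)) (hUopen : open U) (hUconn : connected U) (hU0 : U 0)
    (r : Cplx R -> tens2 R N)
    (hr : nondegenerate_unitary_AYBE_solution U r) :
  exists (rbar : Cplx R -> tens2 R N) (b : 'M[Cplx R]_N) (c : Cplx R),
    [/\ (forall v, regular_pt U r v -> v != 0 ->
           r v = rbar v + b *t (1%:M : 'M[Cplx R]_N)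
                 - (1%:M : 'M[Cplx R]_N) *t b
                 + (c / (N%:R * v)) *: tens_one R N),
        (exists rho, rational_nondegenerate_CYBE_solution rho /\
                     CYBE_equivalent U rbar rho),
        (sl b /\ infinitesimal_symmetry U rbar b),
        c != 0
      & [/\ (forall u, unitary_QYBE_solution U (AYBE_to_QYBE r c u)),
            (forall v, regular_pt U r v -> v != 0 ->
               AYBE_to_QYBE r c u v @[u --> @cinfty R] --> (v / c) *: r v)
          & unitary_QYBE_solution U (fun v => (v / c) *: r v)]].
Proof.
have N0 : (0 < N)%N by exact: ltnW.
have [c [al [b [E [Q [d [[c0 EP alb trb] [dp dg Qrat Qpole] rQ
  [Qal Qb Qflip Qsq Qptr2] [QAYBE QopAYBE]]]]]]]] := gauge_form N0 hUopen hUconn hU0 hr.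
have [[rm _ runit] _] := hr.
pose G v := regular_pt U r v /\ good d v.
have Gg z : U z -> \forall w \near z^', G w.
  by move=> Uz; exact: (filterI (reg_generic hUopen rm Uz) (good_near dp dg z)).
have G0 v : G v -> v != 0 by case=> _ /goodP[].
have Gsq v : G v -> r v *m r v = ((c / v) ^+ 2)%:M.
  case=> rv /goodP[v0 dv _]; have [_ ->] := rQ v rv.
  by rewrite -(AdM EP) Qsq// (Ad_scalar EP).
have Gflip v : G v -> G (- v) -> flip (r (- v)) = - r v.
  by move=> [rv _] [rNv _]; exact: runit.
have GA v w : G v -> G w -> G (v + w) -> AYBEt (r v) (r (v + w)) (r w).
  by move=> [rv _] [rw _] [rvw _]; exact: (AYBE_reg hr rv rw rvw).
have GopA v w : G v -> G w -> G (v + w) -> opAYBEt (r v) (r (v + w)) (r w).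
  move=> [rv gv] [rw gw] [rvw gvw].
  have [_ dv dNv] := goodP gv; have [_ dw dNw] := goodP gw; have [_ dvw dNvw] := goodP gvw.
  have [g [gi [gg g12 g13 g23]]] := triple_gauge EP v w (Q v) (Q (v + w)) (Qal w dw).
  have [_ ev] := rQ v rv; have [_ ew] := rQ w rw; have [_ evw] := rQ _ rvw.
  rewrite -ev -ew -evw in g12 g13 g23.
  exact: (conj_opAYBE gg g12 g13 g23 (QopAYBE v w dv dw dvw dNv dNw dNvw)).
exists (rbar b E c Q), b, c; split.
- by move=> v rv _; have [_ ->] := rQ v rv; exact: (rbarE c Q EP alb v).
- exists (rho b c Q); split.
    exact: (rho_rational N0 c0 trb dp dg Qrat Qb Qflip Qptr2 QAYBE QopAYBE Qpole).
  exact: (rbar_equivalent N0 EP alb trb dp dg Qrat Qal Qb Qflip Qptr2 QAYBE QopAYBE).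
- by split; [exact: trb | exact: (rbar_symmetry EP alb dp dg Qb)].
- exact: c0.
- split.
  + exact: (AYBE_to_QYBE_solution rm Gg G0 Gsq Gflip GA GopA).
  + by move=> v _ v0; exact: AYBE_to_QYBE_limit.
  + exact: (scaled_QYBE c0 rm Gg G0 Gsq Gflip GA GopA).
Qed.
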